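(* There exist absolute constants $0<c\le C$ such that for all integers $d\ge1$, $s\in\{1,\dots,d\}$, all $\rho\in[\sqrt d,d]$ and all $\sigma>0$: \[ \sup_{(\boldsymbol\theta,\boldsymbol\Sigma)\in\Theta(s,d,\rho)}\mathbf E_{\boldsymbol\theta,\boldsymbol\Sigma}[(\tilde N-\|\boldsymbol\theta\|_2)^2]\le C\sigma^2\phi(s,\rho^2), \] and \[ c\,\sigma^2\le \inf_{\hat T}\sup_{(\boldsymbol\theta,\boldsymbol\Sigma)\in\Theta(s,d,\rho)}\frac{\mathbf E_{\boldsymbol\theta,\boldsymbol\Sigma}[(\hat T-\|\boldsymbol\theta\|_2)^2]}{\phi(s,\rho^2)}\le C\sigma^2, \] the infimum being over all estimators $\hat T$.
   Context: Model: one observes $\boldsymbol Y=\boldsymbol\theta+\sigma\boldsymbol\varepsilon\in\mathbb R^d$, $\boldsymbol\varepsilon\sim\mathcal N(\boldsymbol0,\boldsymbol\Sigma)$, $\sigma>0$ known; $\mathbf E_{\boldsymbol\theta,\boldsymbol\Sigma}$ is the expectation under this model. $B_0(s,d)=\{\boldsymbol\theta:\|\boldsymbol\theta\|_0\le s\}$. $\Theta(s,d,\rho)=\{(\boldsymbol\theta,\boldsymbol\Sigma):\boldsymbol\theta\in B_0(s,d),\ \boldsymbol\Sigma\text{ covariance matrix with }\boldsymbol\Sigma_{ii}=1\ \forall i,\ \|\boldsymbol\Sigma\|_F\le\rho\}$. For $t>0$: $\phi(s,t)=s\log(1+t/s^2)$ if $s\le\sqrt t$, $\phi(s,t)=\sqrt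 t$ otherwise. Estimator $\tilde N$: let $\tau=3\sqrt{\log(1+\rho^2/s^2)}$, $\beta_s=\mathbf E[Z^2\mid|Z|\ge\tau]$ with $Z\sim\mathcal N(0,1)$, $\sigma_i^2=\boldsymbol\Sigma_{ii}$, \[ \tilde Q=\begin{cases}\sum_{i=1}^d(Y_i^2-\sigma^2\sigma_i^2\beta_s)\mathbb 1\{|Y_i|>\sigma\sigma_i\tau\}, & s\le\rho,\\ \sum_{i=1}^d(Y_i^2-\sigma^2\sigma_i^2), &\text{otherwise},\end{cases}\qquad\tilde N=\sqrt{|\tilde Q|}. \] *)

(* Defs.v *)
From HB Require Import structures.
From Stdlib Require Import ClassicalEpsilon.
From mathcomp Require Import all_boot all_order all_algebra.
From mathcomp Require Import all_classical all_reals all_analysis.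

Set Implicit Arguments.
Unset Strict Implicit.
Unset Printing Implicit Defensive.

Import Order.TTheory GRing.Theory Num.Def Num.Theory.
Import numFieldNormedType.Exports.

Local Open Scope classical_set_scope.
Local Open Scope ring_scope.

Section Defs.
Variable R : realType.

Definition stdN := @normal_prob R 0 1.

(** Expectation of F(Z), Z = (Z_1,...,Z_n) with i.i.d. N(0,1) coordinates,
    written as the iterated integral (Tonelli) over the coordinates. *)
Fixpoint gauss_int (n : nat) : (n.-tuple R -> \bar R) -> \bar R :=
  match n return (n.-tuple R -> \bar R) -> \bar R with
  | 0 => fun F => F [tuple]
  | n'.+1 => fun F =>
      (\int[stdN]_x gauss_int (fun t : n'.-tuple R => F [tuple of x :: t]))%E
  end.

Definition colt d (z : d.-tuple R) : 'cV[R]_d := \col_i tnth z i.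

Definition is_cov d (S : 'M[R]_d) : Prop :=
  S^T = S /\ forall x : 'cV[R]_d, 0 <= (x^T *m S *m x) 0 0.

(** a (chosen) square root A with A A^T = S; the law of A Z (Z std Gaussian)
    is N(0, A A^T) = N(0,S) and does not depend on the choice of A. *)
Definition cov_sqrt d (S : 'M[R]_d) : 'M[R]_d :=
  epsilon (inhabits 0) (fun A : 'M[R]_d => A *m A^T = S).

(** E_{theta,Sigma}[F(Y)] where Y = theta + sigma eps, eps ~ N(0,Sigma) *)
Definition model_expect d (sigma : R) (theta : 'cV[R]_d) (S : 'M[R]_d)
    (F : 'cV[R]_d -> \bar R) : \bar R :=
  gauss_int (fun z : d.-tuple R =>
               F (theta + sigma *: (cov_sqrt S *m colt z))).

Definition norm2 d (v : 'cV[R]_d) : R := Num.sqrt (\sum_i v i 0 ^+ 2).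

Definition frob d (S : 'M[R]_d) : R := Num.sqrt (\sum_i \sum_j S i j ^+ 2).

Definition l0 d (v : 'cV[R]_d) : nat := #|[set i | v i 0 != 0]|.

Definition Theta d (s : nat) (rho : R) (theta : 'cV[R]_d) (S : 'M[R]_d) : Prop :=
  (l0 theta <= s)%N /\ is_cov S /\ (forall i, S i i = 1) /\ frob S <= rho.

Definition phi (s : nat) (t : R) : R :=
  if s%:R <= Num.sqrt t then s%:R * ln (1 + t / (s%:R ^+ 2)) else Num.sqrt t.

Definition risk d (sigma : R) (T : 'cV[R]_d -> R) theta S : \bar R :=
  model_expect sigma theta S (fun y => ((T y - norm2 theta) ^+ 2)%:E).

Definition estimator d (T : 'cV[R]_d -> R) : Prop :=
  measurable_fun [set: d.-tuple R] (fun z => T (colt z)).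

Definition tau (s : nat) (rho : R) : R :=
  3 * Num.sqrt (ln (1 + rho ^+ 2 / (s%:R ^+ 2))).

(** beta = E[Z^2 | |Z| >= t] for Z ~ N(0,1) *)
Definition beta (t : R) : R :=
  fine (\int[stdN]_x ((x ^+ 2) * (\1_[set y : R | t <= `|y|] x))%:E)%E
  / fine (stdN [set y : R | t <= `|y|]).

Definition Ntilde d (s : nat) (rho sigma : R) (S : 'M[R]_d) (Y : 'cV[R]_d) : R :=
  let t := tau s rho in
  let Q := if s%:R <= rho then
             \sum_i (Y i 0 ^+ 2 - sigma ^+ 2 * S i i * beta t)
                    * (if sigma * Num.sqrt (S i i) * t < `|Y i 0| then 1 else 0)
           else \sum_i (Y i 0 ^+ 2 - sigma ^+ 2 * S i i) in
  Num.sqrt `|Q|.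

(** sup over Theta(s,d,rho) of the quadratic risk of a procedure that may
    use the (known) covariance Sigma, as N tilde does through sigma_i *)
Definition max_riskS d (s : nat) (rho sigma : R)
    (T : 'M[R]_d -> 'cV[R]_d -> R) : \bar R :=
  ereal_sup [set r | exists (theta : 'cV[R]_d) (S : 'M[R]_d),
                       Theta s rho theta S /\ r = risk sigma (T S) theta S].

Definition max_risk d (s : nat) (rho sigma : R) (T : 'cV[R]_d -> R) : \bar R :=
  max_riskS s rho sigma (fun _ => T).

End Defs.

(* Main.v *)
Require Import Defs.
From HB Require Import structures.
From mathcomp Require Import all_boot all_order all_algebra.
From mathcomp Require Import all_classical all_reals all_analysis.
From mathcomp Require Import measurable_realfun ring lra zify.
Import Order.TTheory GRing.Theory Num.Def Num.Theory.
Import numFieldNormedType.Exports.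
Set Implicit Arguments.
Unset Strict Implicit.
Unset Printing Implicit Defensive.
Local Open Scope classical_set_scope.
Local Open Scope ring_scope.

(* Upper bound.  Off the support of theta, the summands of Q~ are g(X_i) with X_i
   standard Gaussian and g(x) = (x^2 - beta) 1{|x| > tau} even and centred.  For
   unit Gaussians of correlation r, |Cov(g(X), g(X'))| is at most C r^2 times the
   squared exponential-weighted sup norm of g: for small r the symmetrized Mehler
   kernel is 1 + O(r^2), for large r a crude second moment bound suffices.  Summing
   over pairs yields ||Sigma||_F^2 <= rho^2 times (tau^2 exp(-tau^2/16))^2, which the
   choice of tau balances against phi^2.  On the support the thresholding error is at
   most s sigma^2 (tau^2 + beta), and the linear term has variance of order
   sigma^2 s ||theta||^2.  Altogether
   E(Q~ - ||theta||^2)^2 <= C A (A + ||theta||^2) with A = sigma^2 phi, and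
   (sqrt|x| - t)^2 <= A + 2 (x - t^2)^2 / (A + t^2) turns this into the bound on N~.

   Lower bound.  Take Sigma block diagonal with perfectly correlated blocks of size m,
   and theta constant on q blocks chosen at random, one in each of q groups of k
   blocks.  By Cameron-Martin the mixture of these models has a likelihood ratio with
   respect to theta = 0 whose second moment is E exp(lambda * overlap) <= 2, so no
   estimator can be accurate under both.  Choosing (m, q, k) in terms of s and rho
   gives the rate phi(s, rho^2). *)

(** * The standard Gaussian measure *)

(** The covariance may be singular, so the observation need not have a density. The second moment of
    the statistic, however, only involves pairs of coordinates, and a pair of linear forms of a
    standard Gaussian vector is distributed as a pair of linear forms of two independent Gaussians.
    Plane rotations of the product measure are thus enough to handle every covariance matrix. The
    weight [expR (x ^+ 2 / 8)] is dictated by the worst case: at full correlation the product of two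
    such weights is [expR (x ^+ 2 / 4)], which is still integrable, with expectation [Num.sqrt 2].
    The factor 3 in [tau] is what this weight requires. With [L = ln (1 + rho ^+ 2 / s ^+ 2)] one
    has [tau ^+ 2 = 9 * L], so the squared decay [expR (- tau ^+ 2 / 8)] is at most [expR (- L)],
    and [expR (- L) * rho ^+ 2 <= s ^+ 2]. Expectations are taken of nonnegative functions only,
    with values in the extended reals. A centred function therefore always enters as a difference of
    two nonnegative ones, and each two-sided estimate is proved as two one-sided ones. *)

Section lebesgue_affine.
Context {R : realType}.
Notation mu := (@lebesgue_measure R).

Lemma measurable_affine (a b : R) :
  measurable_fun [set: measurableTypeR R] (fun y : R => a * y + b : measurableTypeR R).
Proof. by apply: measurable_funD => //; exact: measurable_funM. Qed.

(** The scaled pushforward is a measure that agrees with Lebesgue measure on half-open intervals,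
    and these determine it. *)
Lemma lebesgue_measure_affine (a b : R) (A : set R) : 0 < a -> measurable A ->
  (a%:E * mu ((fun y => (a * y + b)%R) @^-1` A) = mu A)%E.
Proof.
move=> a0 mA.
have ma := measurable_affine a b.
pose nu := measure_function_pushforward__canonical__measure_function_Measure mu ma.
pose m := [the {measure set (measurableTypeR R) -> \bar R} of
  mscale (NngNum (ltW a0)) nu].
rewrite [RHS](@lebesgue_measure_unique R m)//= => X [[u v] _ <-].
rewrite /m /mscale /= /pushforward.
have -> : (fun y => a * y + b) @^-1` `]u, v]%classic = `] (u - b) / a, (v - b) / a ]%classic.
  by apply/seteqP; split => y /=; rewrite !in_itv /= ltr_pdivrMr// ler_pdivlMr// => /andP[h1 h2];
    apply/andP; split; lra.
rewrite !lebesgue_measure_itv/= !lte_fin ltr_pM2r ?invr_gt0// ltrD2r.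
case: ifPn => _; last by rewrite mule0.
by rewrite -!EFinD -EFinM; congr _%:E; field; rewrite gt_eqF.
Qed.

Lemma integral_affine (a b : R) (f : R -> \bar R) : 0 < a ->
  measurable_fun setT f -> (forall x, 0 <= f x)%E ->
  (\int[mu]_y f (a * y + b)%R = a^-1%:E * \int[mu]_y f y)%E.
Proof.
move=> a0 mf f0.
have ma := measurable_affine a b.
rewrite -[LHS](@ge0_integral_pushforward _ _ _ _ R _ ma mu setT f)//.
pose k := NngNum (ltW a0).
pose nu := measure_function_pushforward__canonical__measure_function_Measure mu ma.
have -> : (\int[mu]_y f y = \int[mscale k nu]_y f y)%E.
  apply: eq_measure_integral => /= A mA _.
  by rewrite -(lebesgue_measure_affine b a0 mA) /mscale.
rewrite ge0_integral_mscale//= muleA -EFinM mulVf ?mul1e//.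
by rewrite gt_eqF.
Qed.

Lemma integral_shift (b : R) (f : R -> \bar R) :
  measurable_fun setT f -> (forall x, 0 <= f x)%E ->
  (\int[mu]_y f (y + b)%R = \int[mu]_y f y)%E.
Proof.
move=> mf f0; have := integral_affine b (@ltr01 R) mf f0.
rewrite invr1 mul1e => <-; apply: eq_integral => y _.
by rewrite mul1r.
Qed.

Lemma lebesgue_integral_opp (f : R -> \bar R) :
  measurable_fun setT f -> (forall x, 0 <= f x)%E ->
  (\int[mu]_y f (- y)%R = \int[mu]_y f y)%E.
Proof.
move=> mf f0.
have mo : measurable_fun [set: measurableTypeR R] (fun y : R => - y : measurableTypeR R).
  exact: oppr_measurable.
rewrite -[LHS](@ge0_integral_pushforward _ _ _ _ R _ mo mu setT f)//.
by apply: eq_measure_integral => /= A mA _; exact: lebesgue_measureN.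
Qed.

End lebesgue_affine.

Section stdN.
Context {R : realType}.
Notation mu := (@lebesgue_measure R).
Notation stdN := (@stdN R).

HB.instance Definition _ := Probability.on stdN.

Definition gpdf (x : R) : R := normal_pdf 0 1 x.

Lemma gpdfE x : gpdf x = normal_peak 1 * expR (- x ^+ 2 / 2).
Proof.
by rewrite /gpdf normal_pdfE ?oner_neq0// /normal_fun subr0 expr1n.
Qed.

Lemma gpdf_ge0 x : 0 <= gpdf x. Proof. exact: normal_pdf_ge0. Qed.

Lemma measurable_gpdf : measurable_fun setT gpdf.
Proof. exact: measurable_normal_pdf. Qed.

Import HBNNSimple.

(** [normal_prob] is defined on sets as an integral of the density, so the identity is immediate for
    indicators. Simple functions and monotone convergence carry it to every nonnegative [f]. *)
Lemma integral_stdN (f : R -> \bar R) :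
  measurable_fun setT f -> (forall x, 0 <= f x)%E ->
  (\int[stdN]_x f x = \int[mu]_x (f x * (gpdf x)%:E))%E.
Proof.
move=> mf f0.
pose f_ := nnsfun_approx measurableT mf.
have ndf x m n : (m <= n)%N -> f_ m x <= f_ n x by move=> mn; exact/lefP/nd_nnsfun_approx.
have f_0 n x : 0 <= f_ n x by [].
have mf_ n : measurable_fun setT (f_ n) by exact: measurable_funP.
have mg := measurable_gpdf.
transitivity (lim (\int[stdN]_x (f_ n x)%:E @[n --> \oo])%E).
  rewrite -monotone_convergence//=.
  - apply: eq_integral => ? /[!inE] xD; apply/esym/cvg_lim => //=.
    exact: cvg_nnsfun_approx.
  - by move=> n; apply/measurable_EFinP; exact: (measurable_funP (f_ n)).
  - by move=> n ? _; rewrite lee_fin.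
  - by move=> x _ m n mn; rewrite lee_fin; exact: ndf.
rewrite [RHS](_ : _ = lim (\int[mu]_x ((f_ n x)%:E * (gpdf x)%:E) @[n --> \oo])%E); last first.
  rewrite -monotone_convergence//=.
  - apply: eq_integral => x /[!inE] xD; apply/esym/cvg_lim => //.
    apply: cvgeZr => //; exact: cvg_nnsfun_approx.
  - by move=> n; apply: emeasurable_funM; apply/measurable_EFinP => //; exact: mf_.
  - by move=> n ? _; rewrite mule_ge0// lee_fin// gpdf_ge0.
  - move=> x _ ? ? ?; apply: lee_wpmul2r; first by rewrite lee_fin gpdf_ge0.
    by rewrite lee_fin; exact: ndf.
apply: congr_lim; apply/funext => n /=.
rewrite (_ : (fun x => (f_ n x)%:E * (gpdf x)%:E)%E =
   (fun x => \sum_(k \in range (f_ n)) (k * \1_(f_ n @^-1` [set k]) x)%:E * (gpdf x)%:E)%E); last first.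
  apply/funext => x.
  rewrite {1}(fimfunE (f_ n)) -fsumEFin// ge0_mule_fsuml// => r.
  exact: nnfun_muleindic_ge0.
have nn r (x : R) : (0 <= (r * \1_(f_ n @^-1` [set r]) x)%:E)%E.
  by rewrite EFinM; exact: nnfun_muleindic_ge0.
have mi k : measurable (f_ n @^-1` [set k]) by rewrite -[X in measurable X]setTI; exact: measurable_funP.
have mi1 k : measurable_fun setT (\1_(f_ n @^-1` [set k]) : R -> R) by exact: measurable_indic.
have mif k : measurable_fun setT (fun x : R => k * \1_(f_ n @^-1` [set k]) x) by exact: measurable_funM.
rewrite [RHS]ge0_integral_fsum//; last 2 first.
  - by move=> r; apply: emeasurable_funM; apply/measurable_EFinP; [exact: (mif r)|].
  - by move=> r x _; apply: mule_ge0; [exact: nn|rewrite lee_fin gpdf_ge0].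
transitivity (\int[stdN]_x (\sum_(k \in range (f_ n)) (k * \1_(f_ n @^-1` [set k]) x)%:E))%E.
  by apply: eq_integral => x _; rewrite {1}(fimfunE (f_ n)) -fsumEFin.
rewrite ge0_integral_fsum; [|by []|by move=> r; apply/measurable_EFinP; exact: (mif r)|
  by move=> r x _; exact: nn|by []].
apply: eq_fsbigr => r _.
(* A negative level has an empty preimage, so its term vanishes on both sides. *)
have [r0|r0] := ltP r 0.
  rewrite (preimage_nnfun0 _ r0).
  by rewrite !integral0_eq// => x _; rewrite indicE in_set0 mulr0 ?mul0e.
have r0e : (0 <= r%:E)%E by rewrite lee_fin.
have mZ : measurable_fun setT (fun x => (\1_(f_ n @^-1` [set r]) x)%:E * (gpdf x)%:E)%E.
  by apply: emeasurable_funM; apply/measurable_EFinP; [exact: (mi1 r)|].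
have Z0 x : (0 <= (\1_(f_ n @^-1` [set r]) x)%:E * (gpdf x)%:E)%E.
  by rewrite mule_ge0// lee_fin// gpdf_ge0.
under [RHS]eq_integral do rewrite EFinM -muleA.
rewrite [RHS]ge0_integralZl//.
under eq_integral do rewrite EFinM.
rewrite ge0_integralZl//; last by apply/measurable_EFinP; exact: (mi1 r).
rewrite integral_indic; [|by []|exact: mi].
congr (_ * _)%E; transitivity (@normal_prob R 0 1 (f_ n @^-1` [set r])).
  by congr (@normal_prob R 0 1 _); exact: setIT.
rewrite /normal_prob [LHS]integral_mkcond /=.
apply: eq_integral => x _.
by rewrite patchE indicE /=; case: ifPn => _; rewrite ?mul1e ?mul0e.
Qed.

Definition ofR (x : measurableTypeR R) : R := x.

Lemma measurable_ofR : measurable_fun setT ofR.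
Proof. by move=> _ A mA; rewrite setTI. Qed.

HB.instance Definition _ := isMeasurableFun.Build _ _ _ _ ofR measurable_ofR.

(* [stdN] lives on [measurableTypeR R], whose display differs from that of [R]. *)
Definition stdR : probability R R := distribution stdN ofR.

Lemma stdRE (f : R -> \bar R) :
  measurable_fun setT f -> (forall x, 0 <= f x)%E ->
  (\int[stdR]_x f x = \int[stdN]_x f x)%E.
Proof. by move=> mf f0; rewrite ge0_integral_distribution. Qed.

End stdN.

Section stdN2.
Context {R : realType}.
Notation mu := (@lebesgue_measure R).
Notation stdN := (@stdN R).
Notation stdR := (@stdR R).

(** Density of the law of [c * y + m], [y] standard Gaussian, relative to the standard Gaussian
    instead of Lebesgue measure; the peaks of the two densities cancel up to [c^-1]. *)
Definition affine_density (m c w : R) : R :=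
  c^-1 * expR (w ^+ 2 / 2 - (w - m) ^+ 2 / (2 * c ^+ 2)).

Lemma affine_density_ge0 m c w : 0 < c -> 0 <= affine_density m c w.
Proof. by move=> c0; rewrite mulr_ge0 ?expR_ge0// invr_ge0 ltW. Qed.

Lemma measurable_affine_density m c : measurable_fun setT (affine_density m c).
Proof.
apply: measurable_funM => //; apply: measurableT_comp => //.
apply: measurable_funB; apply: measurable_funM => //; apply: measurable_funX => //.
exact: measurable_funB.
Qed.

Lemma stdN_affine (m c : R) (f : R -> \bar R) : 0 < c ->
  measurable_fun setT f -> (forall x, 0 <= f x)%E ->
  (\int[stdN]_y f (c * y + m)%R = \int[stdN]_w (f w * (affine_density m c w)%:E))%E.
Proof.
move=> c0 mf f0.
have mg := @measurable_gpdf R.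
have mfg : measurable_fun setT (fun y : R => f (c * y + m)%R).
  by apply: measurableT_comp => //; apply: measurable_funD => //; exact: measurable_funM.
pose H := fun w : R => (f w * (gpdf ((w - m) / c))%:E)%E.
have mH : measurable_fun setT H.
  apply: emeasurable_funM => //; apply/measurable_EFinP; apply: measurableT_comp => //.
  by apply: measurable_funM => //; exact: measurable_funB.
have H0 w : (0 <= H w)%E by rewrite mule_ge0// lee_fin gpdf_ge0.
have ic0 : (0 <= c^-1%:E)%E by rewrite lee_fin invr_ge0 ltW.
rewrite integral_stdN//.
transitivity (\int[mu]_y H (c * y + m)%R)%E.
  apply: eq_integral => y _; rewrite /H; congr (_ * (gpdf _)%:E)%E.
  by rewrite addrK mulrAC divff ?mul1r// gt_eqF.
rewrite integral_affine// -ge0_integralZl// integral_stdN; last 2 first.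
- by apply: emeasurable_funM => //; apply/measurable_EFinP; exact: measurable_affine_density.
- by move=> w; rewrite mule_ge0// lee_fin affine_density_ge0.
apply: eq_integral => w _; rewrite /H muleCA -muleA -!EFinM; congr (_ * _%:E)%E.
rewrite !gpdfE /affine_density mulrCA [RHS]mulrAC -!mulrA [RHS]mulrCA -expRD.
by congr (_ * (_ * expR _)); field; rewrite gt_eqF.
Qed.

Lemma stdN_opp (f : R -> \bar R) :
  measurable_fun setT f -> (forall x, 0 <= f x)%E ->
  (\int[stdN]_y f (- y)%R = \int[stdN]_y f y)%E.
Proof.
move=> mf f0; have mg := @measurable_gpdf R.
have mfo : measurable_fun setT (fun y : R => f (- y)%R) by exact: measurableT_comp.
rewrite !integral_stdN//.
pose H := fun w : R => (f w * (gpdf w)%:E)%E.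
have mH : measurable_fun setT H by apply: emeasurable_funM => //; exact/measurable_EFinP.
have H0 w : (0 <= H w)%E by rewrite mule_ge0// lee_fin gpdf_ge0.
transitivity (\int[mu]_y H (- y)%R)%E; last exact: (lebesgue_integral_opp mH H0).
by apply: eq_integral => y _; rewrite /H !gpdfE sqrrN.
Qed.

Lemma measurable_pair_snd d1 d2 d3 (T1 : measurableType d1) (T2 : measurableType d2)
  (T3 : measurableType d3) (f : T1 * T2 -> T3) x :
  measurable_fun setT f -> measurable_fun setT (fun y => f (x, y)).
Proof. by move=> mf; apply: measurableT_comp => //; exact: measurable_pair1. Qed.

Lemma measurable_pair_fst d1 d2 d3 (T1 : measurableType d1) (T2 : measurableType d2)
  (T3 : measurableType d3) (f : T1 * T2 -> T3) y :
  measurable_fun setT f -> measurable_fun setT (fun x => f (x, y)).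
Proof. by move=> mf; apply: measurableT_comp => //; exact: measurable_pair2. Qed.

Lemma lebesgue_shear_fst (t : R) (H : R * R -> \bar R) :
  measurable_fun setT H -> (forall p, 0 <= H p)%E ->
  (\int[mu]_x \int[mu]_y H (x + t * y, y)%R = \int[mu]_x \int[mu]_y H (x, y))%E.
Proof.
move=> mH H0.
have mT : measurable_fun setT (fun p : R * R => (p.1 + t * p.2, p.2)).
  apply: measurable_fun_pair => //=; apply: measurable_funD => //.
  exact: measurable_funM.
rewrite (@fubini_tonelli _ _ _ _ R mu mu (fun p => H (p.1 + t * p.2, p.2)%R))//; last exact: measurableT_comp.
rewrite (@fubini_tonelli _ _ _ _ R mu mu H)//.
apply: eq_integral => y _; rewrite /fubini_G /=.
rewrite (@integral_shift R (t * y) (fun x => H (x, y)))//.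
exact: (measurable_pair_fst y mH).
Qed.

Lemma lebesgue_shear_snd (t : R) (H : R * R -> \bar R) :
  measurable_fun setT H -> (forall p, 0 <= H p)%E ->
  (\int[mu]_x \int[mu]_y H (x, y + t * x)%R = \int[mu]_x \int[mu]_y H (x, y))%E.
Proof.
move=> mH H0; apply: eq_integral => x _.
rewrite (@integral_shift R (t * x) (fun y => H (x, y)))//.
exact: (measurable_pair_snd x mH).
Qed.

(* A plane rotation is a product of three shears. *)
Lemma lebesgue_rotation (c s : R) (H : R * R -> \bar R) : 0 <= c -> c ^+ 2 + s ^+ 2 = 1 ->
  measurable_fun setT H -> (forall p, 0 <= H p)%E ->
  (\int[mu]_x \int[mu]_y H (c * x - s * y, s * x + c * y)%R
   = \int[mu]_x \int[mu]_y H (x, y))%E.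
Proof.
move=> c0 cs mH H0.
have c1 : 1 + c != 0 by rewrite gt_eqF// ltr_wpDr.
(* The tangent of half the rotation angle, which is the parameter of the two outer shears; [0 <= c]
   keeps the denominator positive. *)
pose t := s / (1 + c).
have ts : t * s = 1 - c.
  apply: (mulIf c1); rewrite /t mulrAC divfK//.
  have : s ^+ 2 = 1 - c ^+ 2 by lra.
  rewrite expr2 => ->; ring.
have tc : t * (1 + c) = s by rewrite /t divfK.
pose K2 := fun p : R * R => H (p.1 + (- t) * p.2, p.2).
pose K1 := fun p : R * R => K2 (p.1, p.2 + s * p.1).
have mK2 : measurable_fun setT K2.
  apply: (measurableT_comp mH); apply: measurable_fun_pair => //=.
  by apply: measurable_funD => //; exact: measurable_funM.
have mK1 : measurable_fun setT K1.
  apply: (measurableT_comp mK2); apply: measurable_fun_pair => //=.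
  by apply: measurable_funD => //; exact: measurable_funM.
transitivity (\int[mu]_x \int[mu]_y K1 (x + (- t) * y, y)%R)%E.
  apply: eq_integral => x _; apply: eq_integral => y _.
  rewrite /K1 /K2 /=; congr H; congr pair.
    transitivity ((1 - t * s) * x - (2 * t - t * (t * s)) * y); last by ring.
    by rewrite ts -{1}tc; ring.
  transitivity (s * x + (1 - t * s) * y); last by ring.
  by rewrite ts; ring.
have K20 p : (0 <= K2 p)%E by exact: H0.
have K10 p : (0 <= K1 p)%E by exact: H0.
apply: (etrans (lebesgue_shear_fst (- t) mK1 K10)).
apply: (etrans (lebesgue_shear_snd s mK2 K20)).
exact: (lebesgue_shear_fst (- t) mH H0).
Qed.

Lemma stdN2_lebesgue (G : R * R -> \bar R) :
  measurable_fun setT G -> (forall p, 0 <= G p)%E ->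
  (\int[stdN]_x \int[stdN]_y G (x, y)
   = \int[mu]_x \int[mu]_y (G (x, y) * (gpdf x * gpdf y)%:E))%E.
Proof.
move=> mG G0; have mg := @measurable_gpdf R.
have mF : measurable_fun setT (fun x : R => \int[stdR]_y G (x, y))%E.
  exact: (@measurable_fun_fubini_tonelli_F _ _ _ _ R stdR G).
have mGx x : measurable_fun setT (fun y : R => G (x, y)) by exact: measurable_pair_snd.
under eq_integral do rewrite -stdRE//.
rewrite integral_stdN//; last by move=> x; exact: integral_ge0.
apply: eq_integral => x _; rewrite stdRE// integral_stdN//.
have mH : measurable_fun setT (fun y : R => G (x, y) * (gpdf y)%:E)%E.
  by apply: emeasurable_funM => //; exact/measurable_EFinP.
rewrite -ge0_integralZr//; last 2 first.
- by move=> y _; rewrite mule_ge0// lee_fin gpdf_ge0.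
- by rewrite lee_fin gpdf_ge0.
by apply: eq_integral => y _; rewrite -muleA -EFinM [gpdf y * _]mulrC.
Qed.

Lemma gpdf_rotation (c s x y : R) : c ^+ 2 + s ^+ 2 = 1 ->
  gpdf (c * x - s * y) * gpdf (s * x + c * y) = gpdf x * gpdf y.
Proof.
move=> cs; rewrite !gpdfE mulrACA -expRD [RHS]mulrACA -expRD.
congr (_ * expR _).
have : (c * x - s * y) ^+ 2 + (s * x + c * y) ^+ 2 = (c ^+ 2 + s ^+ 2) * (x ^+ 2 + y ^+ 2) by ring.
by rewrite cs mul1r => E; lra.
Qed.

Lemma stdN2_rotation (c s : R) (G : R * R -> \bar R) : 0 <= c -> c ^+ 2 + s ^+ 2 = 1 ->
  measurable_fun setT G -> (forall p, 0 <= G p)%E ->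
  (\int[stdN]_x \int[stdN]_y G (c * x - s * y, s * x + c * y)%R
   = \int[stdN]_x \int[stdN]_y G (x, y))%E.
Proof.
move=> c0 cs mG G0.
have mg := @measurable_gpdf R.
have mT : measurable_fun setT (fun p : R * R => (c * p.1 - s * p.2, s * p.1 + c * p.2)).
  apply: measurable_fun_pair => //=; [apply: measurable_funB|apply: measurable_funD] => //;
    exact: measurable_funM.
pose G' := fun p : R * R => G (c * p.1 - s * p.2, s * p.1 + c * p.2).
have mG' : measurable_fun setT G' by exact: measurableT_comp.
have G'0 p : (0 <= G' p)%E by exact: G0.
apply: (etrans (stdN2_lebesgue mG' G'0)).
apply/esym; apply: (etrans (stdN2_lebesgue mG G0)); apply/esym.
pose H := fun p : R * R => (G p * (gpdf p.1 * gpdf p.2)%:E)%E.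
have mH : measurable_fun setT H.
  apply: emeasurable_funM => //; apply/measurable_EFinP; apply: measurable_funM => //=;
    exact: measurableT_comp.
have H0 p : (0 <= H p)%E by rewrite mule_ge0// lee_fin mulr_ge0// gpdf_ge0.
apply: (etrans _ (lebesgue_rotation c0 cs mH H0)).
apply: eq_integral => x _; apply: eq_integral => y _ /=; rewrite /G' /H /=.
by rewrite gpdf_rotation.
Qed.

Lemma stdR_affine (m c : R) (f : R -> \bar R) : 0 < c ->
  measurable_fun setT f -> (forall x, 0 <= f x)%E ->
  (\int[stdR]_y f (c * y + m)%R = \int[stdR]_w (f w * (affine_density m c w)%:E))%E.
Proof.
move=> c0 mf f0; rewrite !stdRE//; first exact: stdN_affine.
- by apply: emeasurable_funM => //; apply/measurable_EFinP; exact: measurable_affine_density.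
- by move=> w; rewrite mule_ge0// lee_fin affine_density_ge0.
- apply: measurableT_comp => //; apply: measurable_funD => //; exact: measurable_funM.
Qed.

Lemma stdR_opp (f : R -> \bar R) :
  measurable_fun setT f -> (forall x, 0 <= f x)%E ->
  (\int[stdR]_y f (- y)%R = \int[stdR]_y f y)%E.
Proof.
by move=> mf f0; rewrite !stdRE//; [exact: stdN_opp|exact: measurableT_comp].
Qed.

Lemma stdR2E (G : R * R -> \bar R) :
  measurable_fun setT G -> (forall p, 0 <= G p)%E ->
  (\int[stdR]_x \int[stdR]_y G (x, y) = \int[stdN]_x \int[stdN]_y G (x, y))%E.
Proof.
move=> mG G0; rewrite stdRE.
- by apply: eq_integral => x _; rewrite stdRE//; exact: measurable_pair_snd.
- exact: (@measurable_fun_fubini_tonelli_F _ _ _ _ R stdR G).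
- by move=> x; exact: integral_ge0.
Qed.

Lemma stdR2_rotation (c s : R) (G : R * R -> \bar R) : 0 <= c -> c ^+ 2 + s ^+ 2 = 1 ->
  measurable_fun setT G -> (forall p, 0 <= G p)%E ->
  (\int[stdR]_x \int[stdR]_y G (c * x - s * y, s * x + c * y)%R
   = \int[stdR]_x \int[stdR]_y G (x, y))%E.
Proof.
move=> c0 cs mG G0.
have mT : measurable_fun setT (fun p : R * R => G (c * p.1 - s * p.2, s * p.1 + c * p.2)).
  apply: measurableT_comp => //.
  apply: measurable_fun_pair => //=; [apply: measurable_funB|apply: measurable_funD] => //;
    exact: measurable_funM.
apply: (etrans (stdR2E mT (fun p => G0 _))).
by apply: (etrans (stdN2_rotation c0 cs mG G0)); rewrite stdR2E.
Qed.

End stdN2.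

(** * Gaussian vectors *)

Section gaussP.
Context {R : realType}.
Notation stdR := (@stdR R).

Definition cons_pair n (p : R * n.-tuple R) : n.+1.-tuple R := [tuple of p.1 :: p.2].

Lemma measurable_cons_pair n : measurable_fun setT (@cons_pair n).
Proof. exact: (@measurable_cons _ _ _ R fst n snd). Qed.

HB.instance Definition _ n :=
  isMeasurableFun.Build _ _ _ _ (@cons_pair n) (@measurable_cons_pair n).

(** A genuine probability measure behind the iterated integral [gauss_int], so that additivity and
    monotonicity hold in dimension [n]; [gauss_intE] identifies the two. *)
Fixpoint gaussP n : probability (n.-tuple R) R :=
  match n return probability (n.-tuple R) R with
  | 0 => \d_[tuple]
  | n'.+1 => distribution (stdR \x gaussP n')%E (@cons_pair n')
  end.

Lemma gaussPS n (F : n.+1.-tuple R -> \bar R) :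
  measurable_fun setT F -> (forall z, 0 <= F z)%E ->
  (\int[gaussP n.+1]_z F z = \int[stdR]_x \int[gaussP n]_t F [tuple of x :: t])%E.
Proof.
move=> mF F0.
rewrite /= ge0_integral_distribution// fubini_tonelli1//; last by move=> p; exact: F0.
by apply: measurableT_comp => //; exact: measurable_cons_pair.
Qed.

Lemma gaussPS_measurable n (F : n.+1.-tuple R -> \bar R) :
  measurable_fun setT F -> (forall z, 0 <= F z)%E ->
  measurable_fun setT (fun x => \int[gaussP n]_t F [tuple of x :: t])%E.
Proof.
move=> mF F0.
apply: (@measurable_fun_fubini_tonelli_F _ _ _ _ R (gaussP n) (fun p => F (cons_pair p))) => //.
by apply: measurableT_comp => //; exact: measurable_cons_pair.
Qed.

Lemma gauss_intE n (F : n.-tuple R -> \bar R) :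
  measurable_fun setT F -> (forall z, 0 <= F z)%E ->
  gauss_int F = (\int[gaussP n]_z F z)%E.
Proof.
elim: n F => [|n IH] F mF F0.
  by rewrite /= integral_dirac// diracT mul1e.
rewrite gaussPS// stdRE; last 2 first.
- exact: gaussPS_measurable.
- by move=> x; exact: integral_ge0.
rewrite /=; apply: eq_integral => x _; rewrite IH//.
apply: measurableT_comp => //.
by apply: (measurable_pair_snd x (@measurable_cons_pair n)).
Qed.

Definition dot n (a : 'cV[R]_n) (z : n.-tuple R) : R := \sum_i a i 0 * tnth z i.

Lemma measurable_dot n (a : 'cV[R]_n) : measurable_fun setT (dot a).
Proof.
apply: measurable_sum => i; apply: measurable_funM => //; exact: measurable_tnth.
Qed.

Definition tailv n (u : 'cV[R]_n.+1) : 'cV[R]_n := \col_i u (lift ord0 i) 0.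

Lemma dotS n (a : 'cV[R]_n.+1) x (t : n.-tuple R) :
  dot a [tuple of x :: t] = a 0 0 * x + dot (tailv a) t.
Proof.
rewrite /dot big_ord_recl tnth0; congr (_ + _); apply: eq_bigr => i _.
by rewrite mxE tnthS.
Qed.

Definition dotv n (a b : 'cV[R]_n) : R := \sum_i a i 0 * b i 0.

Lemma dotvS n (a b : 'cV[R]_n.+1) : dotv a b = a 0 0 * b 0 0 + dotv (tailv a) (tailv b).
Proof.
by rewrite /dotv big_ord_recl; congr (_ + _); apply: eq_bigr => i _; rewrite !mxE.
Qed.

Definition addt n (z : n.-tuple R) (u : 'cV[R]_n) : n.-tuple R := [tuple tnth z i + u i 0 | i < n].

Lemma addtS n x (t : n.-tuple R) (u : 'cV[R]_n.+1) :
  addt [tuple of x :: t] u = [tuple of (x + u 0 0) :: addt t (tailv u)].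
Proof.
apply: eq_from_tnth => i; rewrite tnth_mktuple.
have [->|] := eqVneq i ord0; first by rewrite !tnth0.
by case: (unliftP ord0 i) => [j ->|->//] _; rewrite !tnthS tnth_mktuple mxE.
Qed.

Lemma measurable_addt n (u : 'cV[R]_n) : measurable_fun setT (fun z : n.-tuple R => addt z u).
Proof.
apply/measurable_fun_tnthP => i /=.
rewrite (_ : _ \o _ = fun z => tnth z i + u i 0); last by apply/funext => z /=; rewrite tnth_mktuple.
by apply: measurable_funD => //; exact: measurable_tnth.
Qed.

Lemma measurable_consr n (F : n.+1.-tuple R -> \bar R) x :
  measurable_fun setT F -> measurable_fun setT (fun t : n.-tuple R => F [tuple of x :: t]).
Proof.
move=> mF; apply: measurableT_comp => //.
exact: (measurable_pair_snd x (@measurable_cons_pair n)).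
Qed.

Lemma cameron_martin n (u : 'cV[R]_n) (F : n.-tuple R -> \bar R) :
  measurable_fun setT F -> (forall z, 0 <= F z)%E ->
  (\int[gaussP n]_z F (addt z u)
   = \int[gaussP n]_z (F z * (expR (dot u z - dotv u u / 2))%:E))%E.
Proof.
elim: n u F => [|n IH] u F mF F0.
  rewrite /= !integral_dirac// ?diracT ?mul1e.
  - rewrite /dot /dotv !big_ord0 mul0r subr0 expR0 mule1.
    by congr F; apply: eq_from_tnth; case.
  - apply: emeasurable_funM => //; apply/measurable_EFinP; apply: measurableT_comp => //.
    by apply: measurable_funB => //; exact: measurable_dot.
  - by apply: measurableT_comp => //; exact: measurable_addt.
have mE (v : 'cV[R]_n) : measurable_fun setT (fun z => (expR (dot v z - dotv v v / 2))%:E).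
  apply/measurable_EFinP; apply: measurableT_comp => //.
  by apply: measurable_funB => //; exact: measurable_dot.
have mE1 (v : 'cV[R]_n.+1) : measurable_fun setT (fun z => (expR (dot v z - dotv v v / 2))%:E).
  apply/measurable_EFinP; apply: measurableT_comp => //.
  by apply: measurable_funB => //; exact: measurable_dot.
rewrite gaussPS//; last first.
  by apply: measurableT_comp => //; exact: measurable_addt.
rewrite gaussPS; [|exact: emeasurable_funM|by move=> z; rewrite mule_ge0// lee_fin expR_ge0].
(* [G] carries the factor that the induction hypothesis produces for the last [n] coordinates, so
   that only the shift of the first coordinate is left; it is [stdR_affine] with slope 1. *)
pose G (z : n.+1.-tuple R) := (F z * (expR (dot (tailv u) [tuple of behead z] - dotv (tailv u) (tailv u) / 2))%:E)%E.
have mG : measurable_fun setT G.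
  apply: emeasurable_funM => //.
  apply: (measurableT_comp (mE (tailv u))).
  exact: measurable_behead.
have G0 z : (0 <= G z)%E by rewrite mule_ge0// lee_fin expR_ge0.
have GE x (t : n.-tuple R) : G [tuple of x :: t] =
    (F [tuple of x :: t] * (expR (dot (tailv u) t - dotv (tailv u) (tailv u) / 2))%:E)%E.
  have bE : [tuple of behead [tuple of x :: t]] = t by apply: val_inj.
  by rewrite /G bE.
transitivity (\int[stdR]_x \int[gaussP n]_t G [tuple of (1 * x + u 0 0)%R :: t])%E.
  apply: eq_integral => x _; rewrite mul1r.
  under eq_integral do rewrite addtS.
  under [RHS]eq_integral do rewrite GE.
  rewrite (IH (tailv u) (fun t => F [tuple of (x + u 0 0)%R :: t]))//.
  exact: measurable_consr.
rewrite (@stdR_affine R (u 0 0) 1 (fun x => \int[gaussP n]_t G [tuple of x :: t])%E)//; last 2 first.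
- exact: gaussPS_measurable.
- by move=> x; exact: integral_ge0.
apply: eq_integral => x _.
rewrite -ge0_integralZr//; last 2 first.
- exact: measurable_consr.
- by rewrite lee_fin affine_density_ge0.
apply: eq_integral => t _; rewrite GE -muleA -EFinM; congr (_ * _%:E)%E.
rewrite /affine_density invr1 mul1r -expRD dotS dotvS; congr expR.
by field.
Qed.

Lemma polar (p q : R) : exists c s t : R, [/\ 0 <= c, c ^+ 2 + s ^+ 2 = 1, p = t * c & q = t * s].
Proof.
have [p0|p0] := eqVneq p 0.
  by exists 0, 1, q; split; rewrite ?expr0n ?expr1n ?add0r ?mulr0 ?mulr1.
pose N := Num.sqrt (p ^+ 2 + q ^+ 2).
have pq : 0 < p ^+ 2 + q ^+ 2 by rewrite ltr_wpDr ?sqr_ge0// exprn_even_gt0.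
have N0 : 0 < N by rewrite sqrtr_gt0.
have N2 : N ^+ 2 = p ^+ 2 + q ^+ 2 by rewrite sqr_sqrtr// ltW.
(* The radius takes the sign of [p], so that [c = p / t] is nonnegative as the shear decomposition
   of a rotation requires. *)
pose t := Num.sg p * N.
have sg2 : Num.sg p ^+ 2 = 1 by rewrite sqr_sg p0.
have t2 : t ^+ 2 = p ^+ 2 + q ^+ 2 by rewrite exprMn sg2 mul1r.
have t0 : t != 0 by rewrite mulf_neq0 ?sgr_eq0// gt_eqF.
exists (p / t), (q / t), t; split; rewrite ?[t * _]mulrC ?divfK//.
  rewrite {1}[p]numEsg /t -mulf_div divff ?sgr_eq0// mul1r.
  by rewrite divr_ge0// ltW.
by rewrite !expr_div_n -mulrDl t2 divff// gt_eqF.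
Qed.

Lemma stdR_cst (k : \bar R) : (\int[stdR]_x k = k)%E.
Proof.
rewrite integral_cst//; have E : stdR setT = 1%E := probability_setT stdR.
by rewrite -[RHS]mule1; congr (_ * _)%E; exact: E.
Qed.

(** Brings the third variable outermost, so that a rotation can act on the other two. *)
Lemma stdR2_swap (K : (R * R) * R -> \bar R) :
  measurable_fun setT K -> (forall p, 0 <= K p)%E ->
  (\int[stdR]_z \int[stdR]_x \int[stdR]_y K ((z, x), y)
   = \int[stdR]_y \int[stdR]_z \int[stdR]_x K ((z, x), y))%E.
Proof.
move=> mK K0.
have mF := @measurable_fun_fubini_tonelli_F _ _ _ _ R stdR K mK K0.
have F0 p : (0 <= fubini_F stdR K p)%E by exact: integral_ge0.
apply: (etrans (esym (@fubini_tonelli1 _ _ _ _ R stdR stdR _ mF F0))).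
pose PP : probability (R * R)%type R := (stdR \x stdR)%E.
have E := @fubini_tonelli _ _ _ _ R PP stdR K mK K0.
apply: (etrans E).
apply: eq_integral => y _.
have my := measurable_pair_fst y mK.
exact: (@fubini_tonelli1 _ _ _ _ R stdR stdR (fun p => K (p, y)) my).
Qed.

(* [(al, 0; be, ga)] is a Cholesky factor of the Gram matrix of [a, b]; adding one
   coordinate updates it by two plane rotations. *)
Lemma gaussP_law2 n (a b : 'cV[R]_n) : exists al be ga : R,
  [/\ al ^+ 2 = dotv a a, al * be = dotv a b, be ^+ 2 + ga ^+ 2 = dotv b b &
   forall F : R * R -> \bar R, measurable_fun setT F -> (forall p, 0 <= F p)%E ->
   (\int[gaussP n]_z F (dot a z, dot b z)
    = \int[stdR]_x \int[stdR]_y F (al * x, be * x + ga * y)%R)%E].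
Proof.
elim: n a b => [|n IH] a b.
  exists 0, 0, 0; rewrite /dotv !big_ord0 !expr0n/= mulr0 addr0; split => // F mF F0.
  rewrite integral_dirac//; last first.
    apply: measurableT_comp => //; apply: measurable_fun_pair; exact: measurable_dot.
  rewrite diracT mul1e /dot !big_ord0.
  transitivity (\int[stdR]_x \int[stdR]_y F (0%R, 0%R))%E; last first.
    by apply: eq_integral => x _; apply: eq_integral => y _; rewrite !mul0r addr0.
  by rewrite !stdR_cst.
have [al [be [ga [Ha Hab Hb HF]]]] := IH (tailv a) (tailv b).
(* The first rotation makes the form of [a] depend on one variable [x] only; the form of [b] becomes
   [be' * x + de * w + ga * y]. The second rotation merges [de * w + ga * y] into a single variable
   with coefficient [t']. *)
have [c [s [t [c0 cs pE qE]]]] := polar (a 0 0) al.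
pose be' := b 0 0 * c + be * s.
pose de := be * c - b 0 0 * s.
have [c' [s' [t' [c'0 cs' pE' qE']]]] := polar de ga.
exists t, be', t'; split.
- by rewrite dotvS -Ha pE qE -!expr2 !exprMn -mulrDr cs mulr1.
- by rewrite dotvS -Hab pE qE /be'; ring.
- rewrite dotvS -Hb -[t' ^+ 2]mulr1 -cs' mulrDr -!exprMn -pE' -qE' /be' /de.
  have -> : (b 0 0 * c + be * s) ^+ 2 + ((be * c - b 0 0 * s) ^+ 2 + ga ^+ 2) =
    (c ^+ 2 + s ^+ 2) * (b 0 0 ^+ 2 + be ^+ 2) + ga ^+ 2 by ring.
  by rewrite cs mul1r -!expr2 addrA.
move=> F mF F0.
have mlin (p q r p' q' r' : R) : measurable_fun setT
   (fun v : R * R => F (p * v.1 + q * v.2 + r, p' * v.1 + q' * v.2 + r')).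
  apply: (measurableT_comp mF); apply: measurable_fun_pair => /=; apply: measurable_funD => //;
   apply: measurable_funD; exact: measurable_funM.
rewrite gaussPS; [|by apply: measurableT_comp => //; apply: measurable_fun_pair; exact: measurable_dot|by []].
pose G1 (y : R) := fun v : R * R => F (a 0 0 * v.1 + al * v.2, b 0 0 * v.1 + be * v.2 + ga * y).
pose G2 (y : R) := fun v : R * R => F (t * v.1, be' * v.1 + de * v.2 + ga * y).
transitivity (\int[stdR]_z \int[stdR]_x \int[stdR]_y G1 y (z, x))%E.
  apply: eq_integral => z _.
  under eq_integral do rewrite !dotS.
  rewrite (HF (fun p => F (a 0 0 * z + p.1, b 0 0 * z + p.2)%R))//=.
    apply: eq_integral => x _; apply: eq_integral => y _.
    by rewrite /G1 /= addrA.
  apply: measurableT_comp => //; apply: measurable_fun_pair => /=; exact: measurable_funD.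
have mG1 : measurable_fun setT (fun w : (R * R) * R => G1 w.2 w.1).
  apply: (measurableT_comp mF); apply: measurable_fun_pair => /=.
    by apply: measurable_funD; apply: measurable_funM => //; apply: measurableT_comp.
  apply: measurable_funD; last exact: measurable_funM.
  by apply: measurable_funD; apply: measurable_funM => //; apply: measurableT_comp.
have mG2 : measurable_fun setT (fun w : (R * R) * R => G2 w.2 w.1).
  apply: (measurableT_comp mF); apply: measurable_fun_pair => /=.
    by apply: measurable_funM => //; apply: measurableT_comp.
  apply: measurable_funD; last exact: measurable_funM.
  by apply: measurable_funD; apply: measurable_funM => //; apply: measurableT_comp.
apply: (etrans (stdR2_swap mG1 (fun w => F0 _))).
transitivity (\int[stdR]_y \int[stdR]_x \int[stdR]_w G2 y (x, w))%E.
  apply: eq_integral => y _.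
  have cs2 : c ^+ 2 + (- s) ^+ 2 = 1 by rewrite sqrrN.
  apply: (etrans _ (stdR2_rotation c0 cs2 (measurable_pair_fst y mG2) (fun w => F0 _))).
  apply: eq_integral => z _; apply: eq_integral => x _.
  rewrite /G1 /G2 /=; congr F; congr pair; first by rewrite pE qE; ring.
  rewrite -[b 0 0 * z + be * x]mul1r -cs /be' /de; ring.
apply: (etrans (esym (stdR2_swap mG2 (fun w => F0 _)))).
apply: eq_integral => x _.
pose H := fun v : R * R => F (t * x, be' * x + t' * v.1).
have mH : measurable_fun setT H.
  apply: (measurableT_comp mF); apply: measurable_fun_pair => //=.
  by apply: measurable_funD => //; exact: measurable_funM.
have cs2 : c' ^+ 2 + (- s') ^+ 2 = 1 by rewrite sqrrN.
transitivity (\int[stdR]_w \int[stdR]_y H (w, y))%E.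
  apply: (etrans _ (stdR2_rotation c'0 cs2 mH (fun w => F0 _))).
  apply: eq_integral => w _; apply: eq_integral => y _.
  by rewrite /G2 /H /=; congr F; congr pair; rewrite pE' qE'; ring.
by apply: eq_integral => w _; rewrite /H /= stdR_cst.
Qed.

End gaussP.

(** * Expectations of nonnegative measurable functions *)

Section Ex.
Context d (T : measurableType d) {R : realType} (P : probability T R).
Implicit Types f g : T -> R.

Definition Ex f : \bar R := (\int[P]_x (f x)%:E)%E.

(** For such functions additivity, monotonicity and exchange of integrals hold without integrability
    conditions. Finiteness is recovered afterwards from an upper bound, by [Ex_fin_le]. *)
Definition nnm f := measurable_fun setT f /\ forall x, 0 <= f x.

Lemma Ex_ge0 f : nnm f -> (0 <= Ex f)%E.
Proof. by case=> mf f0; apply: integral_ge0 => x _; rewrite lee_fin. Qed.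

Lemma Ex_le f g : nnm f -> nnm g -> (forall x, f x <= g x) -> (Ex f <= Ex g)%E.
Proof.
move=> [mf f0] [mg g0] fg; apply: ge0_le_integral => //.
- by move=> x _; rewrite lee_fin.
- exact/measurable_EFinP.
- exact/measurable_EFinP.
- by move=> x _; rewrite lee_fin.
Qed.

Lemma eq_Ex f g : f =1 g -> Ex f = Ex g.
Proof. by move=> fg; apply: eq_integral => x _; rewrite fg. Qed.

Lemma ExD f g : nnm f -> nnm g -> Ex (fun x => f x + g x) = (Ex f + Ex g)%E.
Proof.
move=> [mf f0] [mg g0]; rewrite /Ex.
under eq_integral do rewrite EFinD.
by rewrite ge0_integralD//; [by move=> x _; rewrite lee_fin|exact/measurable_EFinP|
  by move=> x _; rewrite lee_fin|exact/measurable_EFinP].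
Qed.

Lemma ExZ k f : 0 <= k -> nnm f -> Ex (fun x => k * f x) = (k%:E * Ex f)%E.
Proof.
move=> k0 [mf f0]; rewrite /Ex.
under eq_integral do rewrite EFinM.
rewrite ge0_integralZl//; first exact/measurable_EFinP.
by move=> x _; rewrite lee_fin.
Qed.

Lemma Ex_cst k : Ex (fun=> k) = k%:E.
Proof.
rewrite /Ex integral_cst//; have E : P setT = 1%E := probability_setT P.
by rewrite -[RHS]mule1; congr (_ * _)%E; exact: E.
Qed.

Lemma nnm_cst k : 0 <= k -> nnm (fun=> k).
Proof. by move=> k0; split. Qed.

Lemma nnmD f g : nnm f -> nnm g -> nnm (fun x => f x + g x).
Proof.
by move=> [mf f0] [mg g0]; split=> [|x]; [exact: measurable_funD|exact: addr_ge0].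
Qed.

Lemma nnmM f g : nnm f -> nnm g -> nnm (fun x => f x * g x).
Proof.
by move=> [mf f0] [mg g0]; split=> [|x]; [exact: measurable_funM|exact: mulr_ge0].
Qed.

Lemma nnmZ k f : 0 <= k -> nnm f -> nnm (fun x => k * f x).
Proof. by move=> k0 nf; apply: nnmM => //; exact: nnm_cst. Qed.

Lemma nnm_sum (I : Type) (r : seq I) (Q : pred I) (f : I -> T -> R) :
  (forall i, nnm (f i)) -> nnm (fun x => \sum_(i <- r | Q i) f i x).
Proof.
move=> nf; split=> [|x]; last by apply: sumr_ge0 => i _; exact: (nf i).2.
elim: r => [|i r IH].
  rewrite (_ : (fun x => _) = cst 0)//; last by apply/funext => x; rewrite big_nil.
rewrite (_ : (fun x => _) = (fun x => (if Q i then f i x else 0) + \sum_(j <- r | Q j) f j x)).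
  apply: measurable_funD => //; case: (Q i) => //; exact: (nf i).1.
by apply/funext => x; rewrite big_cons; case: (Q i); rewrite ?add0r.
Qed.

Lemma Ex_sum (I : Type) (r : seq I) (Q : pred I) (f : I -> T -> R) :
  (forall i, nnm (f i)) ->
  Ex (fun x => \sum_(i <- r | Q i) f i x) = (\sum_(i <- r | Q i) Ex (f i))%E.
Proof.
move=> nf; elim: r => [|i r IH].
  by rewrite big_nil -[RHS](Ex_cst 0); apply: eq_Ex => x; rewrite big_nil.
rewrite big_cons -IH; case: ifPn => Qi.
  rewrite -ExD//; last exact: nnm_sum.
  by apply: eq_Ex => x; rewrite big_cons Qi.
by apply: eq_Ex => x; rewrite big_cons (negbTE Qi).
Qed.

Lemma nnm_sqr f : measurable_fun setT f -> nnm (fun x => f x ^+ 2).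
Proof. by move=> mf; split=> [|x]; [exact: measurable_funX|exact: sqr_ge0]. Qed.

Lemma nnm_exp f : measurable_fun setT f -> nnm (fun x => expR (f x)).
Proof. by move=> mf; split=> [|x]; [exact: measurableT_comp|exact: expR_ge0]. Qed.

Lemma Ex_fin_le f k : nnm f -> (Ex f <= k%:E)%E -> Ex f = (fine (Ex f))%:E /\ 0 <= fine (Ex f) <= k.
Proof.
move=> nf h; have f0 := Ex_ge0 nf.
have ff : Ex f \is a fin_num by rewrite ge0_fin_numE// (le_lt_trans h) ?ltry.
by rewrite fineK//; split=> //; rewrite -!lee_fin fineK// f0.
Qed.

End Ex.

(** * Gaussian exponential moments and variance *)

Section moments.
Context {R : realType}.
Notation stdR := (@stdR R).

Lemma measurable_sqr : measurable_fun setT (fun x : R => x ^+ 2).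
Proof. exact: measurable_funX. Qed.

(** This is the total mass one of the law of [c * y], read through its density relative to the
    standard Gaussian. *)
Lemma Ex_exp_sq (c : R) : 0 < c ->
  Ex stdR (fun x => expR ((1 - c ^- 2) / 2 * x ^+ 2)) = c%:E.
Proof.
move=> c0; have c0' : c != 0 by rewrite gt_eqF.
have nE : nnm (fun x : R => expR ((1 - c ^- 2) / 2 * x ^+ 2)).
  by apply: nnm_exp; apply: measurable_funM => //; exact: measurable_sqr.
have := @stdR_affine R 0 c (fun=> 1%E) c0; rewrite stdR_cst => /(_ _ _) H.
have {H} : Ex stdR (fun x => c^-1 * expR ((1 - c ^- 2) / 2 * x ^+ 2)) = 1%E.
  rewrite H//; apply: eq_integral => x _; rewrite mul1e; congr _%:E; congr (_ * expR _).
  by rewrite subr0; field.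
rewrite ExZ ?invr_ge0 ?(ltW c0)// => /(congr1 (fun x => c%:E * x)%E).
by rewrite muleA -EFinM divff// mul1e mule1.
Qed.

Definition K4 : R := Num.sqrt 2.

Lemma Ex_exp4 : Ex stdR (fun x => expR (x ^+ 2 / 4)) = K4%:E.
Proof.
rewrite -(@Ex_exp_sq K4) ?sqrtr_gt0//; apply: eq_Ex => x; congr expR.
by rewrite sqr_sqrtr//; field.
Qed.

Lemma K4_ge1 : 1 <= K4.
Proof. by rewrite -[leLHS]sqrtr1 ler_sqrt// ler1n. Qed.

Lemma nnm_exp4 : nnm (fun x : R => expR (x ^+ 2 / 4)).
Proof. by apply: nnm_exp; apply: measurable_funM => //; exact: measurable_sqr. Qed.

Lemma sq_le_exp (t : R) : 0 <= t -> t ^+ 2 <= 4 * expR t.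
Proof.
move=> t0; have h := expR_ge1Dx (t / 2).
have -> : expR t = expR (t / 2) ^+ 2 by rewrite expr2 -expRD; congr expR; field.
have h2 : 0 <= 1 + t / 2 by lra.
have : (1 + t / 2) ^+ 2 <= expR (t / 2) ^+ 2 by rewrite lerXn2r// nnegrE (le_trans h2).
nra.
Qed.

(** The variance is read off [Ex_exp_sq] near [c = 1]. By [1 + y <= expR y], the value [m] satisfies
    [m * (c + 1) <= 2 * c ^+ 2] for [c > 1] and the reverse inequality for [c < 1]. *)
Lemma Ex_sq : Ex stdR (fun x => x ^+ 2) = 1%E.
Proof.
have ns : nnm (fun x : R => x ^+ 2) by exact/nnm_sqr/measurable_id.
have [mE /andP[m0 m4]] : Ex stdR (fun x => x ^+ 2) = (fine (Ex stdR (fun x => x ^+ 2)))%:E /\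
   0 <= fine (Ex stdR (fun x => x ^+ 2)) <= 4 * K4.
  apply: Ex_fin_le => //; rewrite EFinM -Ex_exp4 -ExZ//; last exact: nnm_exp4.
  apply: Ex_le => //; first by apply: nnmZ => //; exact: nnm_exp4.
  by move=> x; have := expR_ge1Dx (x ^+ 2 / 4); lra.
set m := fine _ in mE m0 m4; rewrite mE; congr _%:E.
have hi c : 1 < c -> m * (c + 1) <= 2 * c ^+ 2.
  move=> c1; have c0 : 0 < c by lra.
  pose t := (1 - c ^- 2) / 2.
  have t0 : 0 <= t by rewrite divr_ge0// subr_ge0 invf_le1 ?exprn_gt0// exprn_ege1// ltW.
  have : (Ex stdR (fun x => 1 + t * x ^+ 2)%R <= Ex stdR (fun x => expR (t * x ^+ 2)%R))%E.
    apply: Ex_le.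
    - by apply: nnmD; [exact: nnm_cst|exact: nnmZ].
    - by apply: nnm_exp; apply: measurable_funM => //; exact: measurable_sqr.
    - by move=> x; exact: expR_ge1Dx.
  rewrite (ExD _ (nnm_cst _ (@ler01 R)) (nnmZ t0 ns)).
  rewrite Ex_cst ExZ// mE Ex_exp_sq// -EFinM -EFinD lee_fin => h.
  have tc : t * (2 * c ^+ 2) = (c - 1) * (c + 1) by rewrite /t; field; rewrite gt_eqF.
  have cc : 0 < c - 1 by lra.
  rewrite -(ler_pM2l cc).
  have : t * m * (2 * c ^+ 2) <= (c - 1) * (2 * c ^+ 2).
    by rewrite ler_wpM2r ?mulr_ge0 ?exprn_ge0 ?(ltW c0)//; lra.
  by rewrite mulrAC tc; lra.
have lo c : 0 < c -> c < 1 -> 2 * c ^+ 2 <= m * (c + 1).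
  move=> c0 c1.
  pose t := (c ^- 2 - 1) / 2.
  have t0 : 0 <= t by rewrite divr_ge0// subr_ge0 invf_ge1 ?exprn_gt0// exprn_ile1// ltW.
  have : (Ex stdR (fun x => 1%R) <= Ex stdR (fun x => expR ((1 - c ^- 2) / 2 * x ^+ 2) + t * x ^+ 2)%R)%E.
    apply: Ex_le.
    - exact: nnm_cst.
    - apply: nnmD; last exact: nnmZ.
      by apply: nnm_exp; apply: measurable_funM => //; exact: measurable_sqr.
    - move=> x; have := expR_ge1Dx ((1 - c ^- 2) / 2 * x ^+ 2); rewrite /t; lra.
  have ne : nnm (fun x : R => expR ((1 - c ^- 2) / 2 * x ^+ 2)).
    by apply: nnm_exp; apply: measurable_funM => //; exact: measurable_sqr.
  rewrite (ExD _ ne (nnmZ t0 ns)).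
  rewrite Ex_cst ExZ// mE Ex_exp_sq// -EFinM -EFinD lee_fin => h.
  have tc : t * (2 * c ^+ 2) = (1 - c) * (c + 1) by rewrite /t; field; rewrite gt_eqF.
  have cc : 0 < 1 - c by lra.
  rewrite -(ler_pM2l cc).
  have : (1 - c) * (2 * c ^+ 2) <= t * m * (2 * c ^+ 2).
    by rewrite ler_wpM2r ?mulr_ge0 ?exprn_ge0 ?(ltW c0)//; lra.
  by rewrite mulrAC tc; lra.
(* An explicit [c] at distance [|m - 1| / 4] from 1, on the side of [m], replaces the limit. *)
apply/eqP; rewrite eq_le; apply/andP; split; rewrite leNgt; apply/negP => hm.
  have h2 := hi 2 (ltr1n _ 2).
  have := hi (1 + (m - 1) / 4) ltac:(lra); nra.
have := lo (1 - (1 - m) / 4) ltac:(lra) ltac:(lra); nra.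
Qed.

End moments.

(** * Covariance of even functions of correlated Gaussians *)

Section cov.
Context {R : realType}.
Notation stdR := (@stdR R).

(** With [v = u / 2], the excess of the hyperbolic cosine over 1 is half the square of
    [expR v - expR (- v)], and for [u >= 0] this difference is at most [u * expR v]. *)
Lemma cosh_le (u : R) : (expR u + expR (- u)) / 2 <= 1 + u ^+ 2 * expR `|u| / 2.
Proof.
wlog u0 : u / 0 <= u.
  move=> H; have [|u0] := leP 0 u; first exact: H.
  by have := H (- u); rewrite opprK normrN sqrrN addrC; apply; rewrite oppr_ge0 ltW.
rewrite ger0_norm//; set v := u / 2.
have e1 : expR u = expR v ^+ 2 by rewrite expr2 -expRD; congr expR; rewrite /v; field.
have e2 : expR (- u) = expR (- v) ^+ 2 by rewrite expr2 -expRD; congr expR; rewrite /v; field.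
have e3 : expR v * expR (- v) = 1 by rewrite -expRD subrr expR0.
have h : 0 <= expR v - expR (- v) <= u * expR v.
  rewrite subr_ge0 ler_expR; apply/andP; split; first by rewrite /v; lra.
  have := expR_ge1Dx (- u) ; have ev := expR_gt0 v.
  have -> : expR (- v) = expR v * expR (- u) by rewrite -expRD; congr expR; rewrite /v; field.
  by move=> h; nra.
have : (expR v - expR (- v)) ^+ 2 <= (u * expR v) ^+ 2.
  by rewrite lerXn2r ?nnegrE//; case/andP: h => // h1 h2; exact: le_trans h2.
by rewrite e1 e2 exprMn; nra.
Qed.

Lemma cosh_ge1 (u : R) : 1 <= (expR u + expR (- u)) / 2.
Proof. by have := expR_ge1Dx u; have := expR_ge1Dx (- u); lra. Qed.

(* The law of [r * x + c * y], [y] standard Gaussian, symmetrized and taken relative to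
   the standard Gaussian.  Symmetrizing kills the term linear in [r], so this Mehler
   kernel is [1 + O(r ^+ 2)], see [mehler_bounds]. *)
Definition mehler (r c x w : R) : R :=
  (affine_density (r * x) c w + affine_density (r * x) c (- w)) / 2.

Lemma mehlerE (r c x w : R) : 0 < c -> c ^+ 2 = 1 - r ^+ 2 ->
  mehler r c x w = c^-1 * expR (- (r ^+ 2 * (x ^+ 2 + w ^+ 2) / (2 * c ^+ 2)))
    * ((expR (r * x * w / c ^+ 2) + expR (- (r * x * w / c ^+ 2))) / 2).
Proof.
move=> c0 cE; have c0' : c != 0 by rewrite gt_eqF.
have key v : expR (v ^+ 2 / 2 - (v - r * x) ^+ 2 / (2 * c ^+ 2)) =
  expR (- (r ^+ 2 * (x ^+ 2 + v ^+ 2) / (2 * c ^+ 2))) * expR (r * x * v / c ^+ 2).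
  rewrite -expRD; congr expR.
  have c2 : v ^+ 2 / 2 = v ^+ 2 * c ^+ 2 / (2 * c ^+ 2) by field.
  by rewrite c2 {1}cE; field.
rewrite /mehler /affine_density !key sqrrN mulrN mulNr; ring.
Qed.

(** Real arithmetic of [mehler_bounds]: [q] stands for [r ^+ 2], [ic] for [c^-1], [ek] for the
    decreasing exponential, [C] for the hyperbolic cosine and [V] for
    [expR ((x ^+ 2 + w ^+ 2) / 8)]. The constant 600 leaves room over
    [1 + 1024 / 2 + 1024 / 200]. *)
Lemma mehler_arith_up (q ic ek C U V : R) : 0 <= q -> q <= 100^-1 ->
  0 <= ic -> ic <= 1 + q -> 0 <= ek -> ek <= 1 -> 0 <= C -> C <= 1 + U / 2 ->
  0 <= U -> U <= 1024 * q * V -> 1 <= V -> ic * ek * C <= 1 + 600 * q * V.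
Proof.
move=> q0 q1 ic0 ic1 ek0 ek1 C0 C1 U0 U1 V1.
have h1 : ic * ek <= 1 + q by apply: le_trans ic1; rewrite ler_piMr.
have h2 : ic * ek * C <= (1 + q) * (1 + U / 2).
  by apply: ler_pM => //; rewrite mulr_ge0.
apply: (le_trans h2); clear - q0 q1 U0 U1 V1.
have h : q * U <= 100^-1 * U by apply: ler_wpM2r.
have h' : q <= q * V by rewrite ler_peMr.
lra.
Qed.

Lemma mehler_arith_lo (ic ek C k Z : R) : 1 <= ic -> 0 <= ek -> 1 <= C ->
  1 - k <= ek -> k <= Z -> 1 <= ic * ek * C + Z.
Proof.
move=> i1 e0 C1 ke kZ.
have h : 1 <= ic * C by rewrite -[leLHS]mulr1; apply: ler_pM.
have h2 : ek <= ic * ek * C by rewrite mulrAC ler_peMl.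
lra.
Qed.

Lemma inv_sqrt_le (c q : R) : 0 < c -> 0 <= q -> q <= 100^-1 -> c ^+ 2 = 1 - q ->
  [/\ 1 <= c^-1, c^-1 <= 1 + q, 0 < c ^- 2 & c ^- 2 <= 100 / 99].
Proof.
move=> c0 q0 q1 cE; have c20 : 0 < c ^+ 2 by rewrite exprn_gt0.
split.
- by rewrite invf_ge1//; nra.
- have q2 : 0 < 1 + q by lra.
  rewrite invf_ple ?posrE// -(ler_pM2r q2) mulVf ?gt_eqF//.
  have : 1 <= (c * (1 + q)) ^+ 2 by rewrite exprMn cE; nra.
  have y0 : 0 < c * (1 + q) by exact: mulr_gt0.
  by move: (c * (1 + q)) y0 => y y0 h; rewrite leNgt; apply/negP => h'; nra.
- by rewrite invr_gt0.
- by rewrite invf_ple ?posrE//; rewrite ?cE; lra.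
Qed.

(** Write [S = x ^+ 2 + w ^+ 2]. Correlation at most 1/10 keeps the argument of the hyperbolic
    cosine below [S / 16], half of the available exponent [S / 8]; the other half pays for the
    polynomial factor [S ^+ 2]. *)
Lemma mehler_u_bounds (r i x w : R) : `|r| <= 10^-1 -> 0 < i -> i <= 100 / 99 ->
  `|r * x * w * i| <= (x ^+ 2 + w ^+ 2) / 16 /\
  (r * x * w * i) ^+ 2 <= r ^+ 2 * (x ^+ 2 + w ^+ 2) ^+ 2.
Proof.
move=> r1 i0 i1; split.
  rewrite !normrM [`|i|]gtr0_norm//.
  have xw : `|x| * `|w| <= (x ^+ 2 + w ^+ 2) / 2.
    by have := sqr_ge0 (`|x| - `|w|); rewrite sqrrB !real_normK ?num_real//; lra.
  have xw0 : 0 <= `|x| * `|w| by rewrite mulr_ge0.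
  rewrite -!mulrA; apply: (@le_trans _ _ (10^-1 * ((x ^+ 2 + w ^+ 2) / 2 * (100 / 99)))).
    apply: ler_pM => //; first by rewrite !mulr_ge0// ltW.
    by rewrite mulrA; apply: ler_pM => //; rewrite ltW.
  by have := sqr_ge0 x; have := sqr_ge0 w; lra.
rewrite (_ : _ ^+ 2 = r ^+ 2 * (x ^+ 2 * w ^+ 2 * i ^+ 2)); last by ring.
apply: ler_wpM2l; first exact: sqr_ge0.
have xw : x ^+ 2 * w ^+ 2 <= (x ^+ 2 + w ^+ 2) ^+ 2 / 4 by have := sqr_ge0 (x ^+ 2 - w ^+ 2); lra.
have i4 : i ^+ 2 <= 4 by rewrite expr2 (le_trans (ler_pM _ _ i1 i1))// ?ltW//; lra.
have : x ^+ 2 * w ^+ 2 * i ^+ 2 <= (x ^+ 2 + w ^+ 2) ^+ 2 / 4 * 4.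
  by apply: ler_pM => //; [rewrite mulr_ge0 ?sqr_ge0|exact: sqr_ge0].
by move=> h; apply: (le_trans h); rewrite divfK.
Qed.

Lemma mehler_bounds (r c x w : R) : 0 < c -> c ^+ 2 = 1 - r ^+ 2 -> `|r| <= 10^-1 ->
  (mehler r c x w <= 1 + 600 * r ^+ 2 * (expR (x ^+ 2 / 8) * expR (w ^+ 2 / 8))) /\
  (1 <= mehler r c x w + 600 * r ^+ 2 * (expR (x ^+ 2 / 8) * expR (w ^+ 2 / 8))).
Proof.
move=> c0 cE r1.
have r20 : 0 <= r ^+ 2 by exact: sqr_ge0.
have r2 : r ^+ 2 <= 100^-1.
  by rewrite -real_normK ?num_real// expr2 (le_trans (ler_pM _ _ r1 r1))//; lra.
have [ic1 ic ic20 ic2] := inv_sqrt_le c0 r20 r2 cE.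
rewrite -expRD -mulrDl mehlerE//.
have [uS uu] := mehler_u_bounds x w r1 ic20 ic2.
have S0 : 0 <= x ^+ 2 + w ^+ 2 by rewrite addr_ge0 ?sqr_ge0.
have kk : 0 <= r ^+ 2 * (x ^+ 2 + w ^+ 2) / (2 * c ^+ 2) <= r ^+ 2 * (x ^+ 2 + w ^+ 2).
  rewrite (_ : _ / _ = r ^+ 2 * (x ^+ 2 + w ^+ 2) * (c ^- 2 / 2)); last by field; rewrite gt_eqF.
  have q0 : 0 <= r ^+ 2 * (x ^+ 2 + w ^+ 2) by rewrite mulr_ge0.
  apply/andP; split; first by rewrite mulr_ge0// divr_ge0 ?ltW//.
  by rewrite ler_piMr//; lra.
move: (x ^+ 2 + w ^+ 2) S0 uS uu kk => S S0.
move: (r * x * w / c ^+ 2) => u uS uu.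
move: (r ^+ 2 * S / _) => k /andP[k0 kS].
move: (r ^+ 2) r20 r2 {cE} ic uu kS => q q0 q1 ic uu kS.
move: (c^-1) ic1 ic => i i1 iq; clear c c0 ic20 ic2 r r1 x w.
(* [sq_le_exp] at [S / 16], with [1024 = 4 * 16 ^ 2]. *)
have SS : S ^+ 2 <= 1024 * expR (S / 16).
  by have := @sq_le_exp R (S / 16) ltac:(lra); lra.
have eu : expR `|u| <= expR (S / 16) by rewrite ler_expR.
have e8 : expR (S / 8) = expR (S / 16) * expR (S / 16) by rewrite -expRD; congr expR; field.
have e1 : 1 + S / 8 <= expR (S / 8) by exact: expR_ge1Dx.
have main : u ^+ 2 * expR `|u| <= 1024 * q * expR (S / 8).
  rewrite e8 (_ : _ * (_ * _) = (q * (1024 * expR (S / 16))) * expR (S / 16)); last by ring.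
  apply: ler_pM => //; rewrite ?sqr_ge0 ?expR_ge0//.
  by apply: (le_trans uu); exact: ler_wpM2l.
have C1 := cosh_ge1 u.
split.
  apply: (@mehler_arith_up q _ _ _ (u ^+ 2 * expR `|u|)) => //.
  - by rewrite (le_trans _ i1).
  - by rewrite -expR0 ler_expR oppr_le0.
  - exact: cosh_le.
  - by rewrite mulr_ge0 ?sqr_ge0 ?expR_ge0.
  - by apply: le_trans e1; rewrite lerDl divr_ge0.
apply: (@mehler_arith_lo _ _ _ k) => //; first exact: expR_ge1Dx.
apply: (le_trans kS); rewrite [600 * q]mulrC -mulrA; apply: ler_wpM2l => //.
by clear - e1 S0; lra.
Qed.

(** An even function sees only the even part of the density. This is where the symmetrized kernel
    comes from. *)
Lemma even_affine_Ex (g : R -> R) (m c : R) : 0 < c -> nnm g -> (forall x, g (- x) = g x) ->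
  Ex stdR (fun y => g (c * y + m)) =
  Ex stdR (fun w => g w * ((affine_density m c w + affine_density m c (- w)) / 2)).
Proof.
move=> c0 [mg g0] ge.
have nD : nnm (affine_density m c).
  by split; [exact: measurable_affine_density|move=> w; exact: affine_density_ge0].
have nDo : nnm (fun w : R => affine_density m c (- w)).
  by split; [apply: measurableT_comp => //; exact: measurable_affine_density|move=> w; exact: affine_density_ge0].
have E1 : Ex stdR (fun y => g (c * y + m)) = Ex stdR (fun w => g w * affine_density m c w).
  have := @stdR_affine R m c (fun x => (g x)%:E) c0; rewrite /Ex => ->//.
  exact/measurable_EFinP.
have E2 : Ex stdR (fun w => g w * affine_density m c (- w)) = Ex stdR (fun w => g w * affine_density m c w).
  have [h1 h2] : nnm (fun w : R => g w * affine_density m c w) by exact: nnmM.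
  have := @stdR_opp R (fun x => (g x * affine_density m c x)%:E); rewrite /Ex => <-//.
    by apply: eq_integral => x _; rewrite ge.
  exact/measurable_EFinP.
have h2 : (0 : R) <= 2^-1 by [].
have nD' : nnm (fun w : R => g w * (2^-1 * affine_density m c w)) by apply: nnmM => //; exact: nnmZ.
have nDo' : nnm (fun w : R => g w * (2^-1 * affine_density m c (- w))) by apply: nnmM => //; exact: nnmZ.
transitivity (Ex stdR (fun w => g w * (2^-1 * affine_density m c w) + g w * (2^-1 * affine_density m c (- w)))); last first.
  by apply: eq_Ex => w; field.
rewrite (ExD _ nD' nDo').
have e (D : R -> R) : nnm D -> Ex stdR (fun w => g w * (2^-1 * D w)) = ((2^-1)%:E * Ex stdR (fun w => (g w * D w)%R))%E.
  by move=> nDD; rewrite -ExZ//; [apply: eq_Ex => w; ring|exact: nnmM].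
rewrite (e _ nD) (e _ nDo) E2 E1 -ge0_muleDl ?lee_fin// -EFinD.
by rewrite [X in X%:E](_ : _ = 1) ?mul1e//; field.
Qed.

Lemma nnm_comp_lin (g : R -> R) (p q : R) : nnm g -> nnm (fun v : R * R => g (p * v.1 + q * v.2)).
Proof.
move=> [mg g0]; split => //; apply: (measurableT_comp mg).
by apply: measurable_funD; exact: measurable_funM.
Qed.

Definition Ex2 (F : R * R -> R) : \bar R := (\int[stdR]_x \int[stdR]_y (F (x, y))%:E)%E.

Lemma Ex2_prod (f g : R -> R) mf mg : nnm f -> nnm g -> Ex stdR f = mf%:E -> Ex stdR g = mg%:E ->
  Ex2 (fun v => f v.1 * g v.2) = (mf * mg)%:E.
Proof.
move=> nf ng fE gE; have mg0 : 0 <= mg by rewrite -lee_fin -gE; exact: Ex_ge0.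
rewrite EFinM -fE muleC -ExZ//.
apply: eq_integral => x _ /=.
by rewrite -[LHS]/(Ex stdR (fun y => f x * g y)) ExZ ?nf.2// gE -EFinM mulrC.
Qed.

Lemma measurable_Ex_snd (F : R * R -> R) : nnm F ->
  measurable_fun setT (fun x => \int[stdR]_y (F (x, y))%:E)%E.
Proof.
move=> [mF F0].
apply: (@measurable_fun_fubini_tonelli_F _ _ _ _ R stdR (fun v => (F v)%:E)).
  exact/measurable_EFinP.
by move=> v; rewrite lee_fin.
Qed.

Lemma Ex2_le (F G : R * R -> R) : nnm F -> nnm G -> (forall v, F v <= G v) -> (Ex2 F <= Ex2 G)%E.
Proof.
move=> [mF F0] [mG G0] FG; apply: ge0_le_integral => //.
- by move=> x _; apply: integral_ge0 => y _; rewrite lee_fin.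
- exact: measurable_Ex_snd.
- exact: measurable_Ex_snd.
move=> x _; apply: ge0_le_integral => //.
- by move=> y _; rewrite lee_fin.
- apply/measurable_EFinP; exact: (measurable_pair_snd x mF).
- apply/measurable_EFinP; exact: (measurable_pair_snd x mG).
- by move=> y _; rewrite lee_fin.
Qed.

Lemma Ex2D (F G : R * R -> R) : nnm F -> nnm G ->
  Ex2 (fun v => F v + G v) = (Ex2 F + Ex2 G)%E.
Proof.
move=> [mF F0] [mG G0]; rewrite /Ex2 -ge0_integralD//.
- apply: eq_integral => x _; rewrite -ge0_integralD//.
  + by move=> y _; rewrite lee_fin.
  + apply/measurable_EFinP; exact: (measurable_pair_snd x mF).
  + by move=> y _; rewrite lee_fin.
  + apply/measurable_EFinP; exact: (measurable_pair_snd x mG).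
- by move=> x _; apply: integral_ge0 => y _; rewrite lee_fin.
- exact: measurable_Ex_snd.
- by move=> x _; apply: integral_ge0 => y _; rewrite lee_fin.
- exact: measurable_Ex_snd.
Qed.

Lemma nnm_fst (g : R -> R) : nnm g -> nnm (fun v : R * R => g v.1).
Proof. by move=> [mg g0]; split => //; exact: measurableT_comp. Qed.

Lemma nnm_snd (g : R -> R) : nnm g -> nnm (fun v : R * R => g v.2).
Proof. by move=> [mg g0]; split => //; exact: measurableT_comp. Qed.

Lemma Ex2_ge0 (F : R * R -> R) : nnm F -> (0 <= Ex2 F)%E.
Proof.
by move=> [_ F0]; apply: integral_ge0 => x _; apply: integral_ge0 => y _; rewrite lee_fin.
Qed.

(** [gaussP_law2] fixes its factor only up to signs: [al] is 1 or -1, which evenness of [g1]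
    absorbs, and the sign of [ga] is absorbed by the symmetry of [y]. So [r] is the inner product up
    to sign, and only [r ^+ 2] is needed later. *)
Lemma law2_unit n (a b : 'cV[R]_n) (g1 g2 : R -> R) : nnm g1 -> nnm g2 ->
  (forall x, g1 (- x) = g1 x) -> dotv a a = 1 -> dotv b b = 1 ->
  exists r c : R, [/\ 0 <= c, c ^+ 2 = 1 - r ^+ 2, r ^+ 2 = dotv a b ^+ 2 &
    Ex (gaussP n) (fun z => g1 (dot a z) * g2 (dot b z)) =
    Ex2 (fun v => g1 v.1 * g2 (r * v.1 + c * v.2))].
Proof.
move=> n1 n2 e1 aa bb.
have [al [be [ga [Ha Hab Hb HF]]]] := gaussP_law2 a b.
exists be, `|ga|; split => //.
- by rewrite real_normK ?num_real//; lra.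
- by rewrite -Hab exprMn Ha aa mul1r.
have ng : nnm (fun v : R * R => g1 v.1 * g2 v.2).
  by apply: nnmM; [exact: nnm_fst|exact: nnm_snd].
transitivity (\int[stdR]_x \int[stdR]_y (g1 (al * x) * g2 (be * x + ga * y))%:E)%E.
  rewrite -(HF (fun p => (g1 p.1 * g2 p.2)%:E))//.
    by apply/measurable_EFinP; exact: ng.1.
  by move=> p; rewrite lee_fin ng.2.
have alE x : g1 (al * x) = g1 x.
  have : (al - 1) * (al + 1) = 0 by rewrite -subr_sqr expr1n Ha aa subrr.
  move/eqP; rewrite mulf_eq0 subr_eq0 addr_eq0 => /orP[] /eqP ->; first by rewrite mul1r.
  by rewrite mulN1r e1.
apply: eq_integral => x _ /=; under eq_integral do rewrite alE.
have [ga0|ga0] := leP 0 ga; first by rewrite ger0_norm.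
rewrite ltr0_norm// -stdR_opp//; last 2 first.
- apply/measurable_EFinP; apply: measurable_funM => //.
  apply: (measurableT_comp n2.1); apply: measurable_funD => //; exact: measurable_funM.
- by move=> y; rewrite lee_fin mulr_ge0 ?n1.2 ?n2.2.
by apply: eq_integral => y _; rewrite mulrN mulNr.
Qed.

Lemma nnm_dot n (a : 'cV[R]_n) (g : R -> R) : nnm g -> nnm (fun z => g (dot a z)).
Proof.
by move=> [mg g0]; split => //; apply: (measurableT_comp mg); exact: measurable_dot.
Qed.

Lemma law1 n (a : 'cV[R]_n) (g : R -> R) : nnm g ->
  exists2 al, al ^+ 2 = dotv a a &
   Ex (gaussP n) (fun z => g (dot a z)) = Ex stdR (fun x => g (al * x)).
Proof.
move=> ng; have [al [be [ga [Ha _ _ HF]]]] := gaussP_law2 a a.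
exists al => //; rewrite /Ex (HF (fun p => (g p.1)%:E)).
- by apply: eq_integral => x _ /=; rewrite stdR_cst.
- by apply/measurable_EFinP; exact: (nnm_fst ng).1.
- by move=> p; rewrite lee_fin ng.2.
Qed.

Lemma law1_unit n (a : 'cV[R]_n) (g : R -> R) : nnm g -> (forall x, g (- x) = g x) ->
  dotv a a = 1 -> Ex (gaussP n) (fun z => g (dot a z)) = Ex stdR g.
Proof.
move=> ng ge aa; have [al Ha ->] := law1 a ng; apply: eq_Ex => x.
have : (al - 1) * (al + 1) = 0 by rewrite -subr_sqr expr1n Ha aa subrr.
move/eqP; rewrite mulf_eq0 subr_eq0 addr_eq0 => /orP[] /eqP ->; first by rewrite mul1r.
by rewrite mulN1r ge.
Qed.

Lemma law1_exp4 n (a : 'cV[R]_n) : dotv a a = 1 ->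
  Ex (gaussP n) (fun z => expR (dot a z ^+ 2 / 4)) = K4%:E.
Proof.
move=> aa; rewrite -Ex_exp4.
apply: (@law1_unit n a (fun x => expR (x ^+ 2 / 4))) => //; first exact: nnm_exp4.
by move=> x; rewrite sqrrN.
Qed.

Lemma exp8_le (x : R) : expR (x ^+ 2 / 8) <= expR (x ^+ 2 / 4).
Proof. by rewrite ler_expR; have := sqr_ge0 x; lra. Qed.

Lemma Ex_exp8_bound (g : R -> R) a : nnm g -> 0 <= a -> (forall x, g x <= a * expR (x ^+ 2 / 8)) ->
  exists2 m, Ex stdR g = m%:E & 0 <= m <= a * K4.
Proof.
move=> ng a0 ga; exists (fine (Ex stdR g)); have [] := @Ex_fin_le _ _ R stdR g (a * K4) ng => //.
  rewrite EFinM -Ex_exp4 -ExZ//; last exact: nnm_exp4.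
  apply: Ex_le => //; first by apply: nnmZ => //; exact: nnm_exp4.
  by move=> x; apply: (le_trans (ga x)); apply: ler_wpM2l => //; exact: exp8_le.
rewrite EFinM -Ex_exp4 -ExZ//; last exact: nnm_exp4.
apply: Ex_le => //; first by apply: nnmZ => //; exact: nnm_exp4.
by move=> x; apply: (le_trans (ga x)); apply: ler_wpM2l => //; exact: exp8_le.
Qed.

End cov.

Section cov.
Context {R : realType}.
Notation stdR := (@stdR R).

Lemma nnm_mehler (r c : R) : 0 < c -> nnm (fun v : R * R => mehler r c v.1 v.2).
Proof.
move=> c0; have n1 := @nnm_fst R; split; last first.
  move=> v; rewrite /mehler; apply: divr_ge0 => //.
  by apply: addr_ge0; exact: affine_density_ge0.
have m1 : measurable_fun setT (fun v : R * R => r * v.1) by apply: measurable_funM.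
have m2 : measurable_fun setT (fun v : R * R => v.2) by exact: measurable_snd.
have m2o : measurable_fun setT (fun v : R * R => - v.2) by apply: measurableT_comp.
have md (f : R * R -> R) : measurable_fun setT f ->
    measurable_fun setT (fun v => affine_density (r * v.1) c (f v)).
  move=> mf; apply: measurable_funM => //; apply: measurableT_comp => //.
  have mf2 : measurable_fun setT (fun v => f v ^+ 2) by apply: measurable_funX.
  have mfm : measurable_fun setT (fun v => f v - r * v.1) by exact: measurable_funB.
  have mfm2 : measurable_fun setT (fun v => (f v - r * v.1) ^+ 2) by exact: measurable_funX.
  by apply: measurable_funB; apply: measurable_funM => //.
apply: measurable_funM => //; apply: measurable_funD; [exact: (md _ m2)|exact: (md _ m2o)].
Qed.

(* Keeps the literal 600 away from conversion in [gauss_cov_aux]. *)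
Lemma mehler_const : exists M : R, 100 <= M /\
  forall r c x w : R, 0 < c -> c ^+ 2 = 1 - r ^+ 2 -> `|r| <= 10^-1 ->
  (mehler r c x w <= 1 + M * r ^+ 2 * (expR (x ^+ 2 / 8) * expR (w ^+ 2 / 8))) /\
  (1 <= mehler r c x w + M * r ^+ 2 * (expR (x ^+ 2 / 8) * expR (w ^+ 2 / 8))).
Proof. by exists 600; split; [rewrite ler_nat|exact: mehler_bounds]. Qed.

Lemma gauss_cov_aux (M : R) : 100 <= M ->
  (forall r c x w : R, 0 < c -> c ^+ 2 = 1 - r ^+ 2 -> `|r| <= 10^-1 ->
  (mehler r c x w <= 1 + M * r ^+ 2 * (expR (x ^+ 2 / 8) * expR (w ^+ 2 / 8))) /\
  (1 <= mehler r c x w + M * r ^+ 2 * (expR (x ^+ 2 / 8) * expR (w ^+ 2 / 8)))) ->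
  let covC := M * (K4 + K4 ^+ 2) in
  forall n (a b : 'cV[R]_n) (g1 g2 : R -> R) (a1 a2 m1 m2 : R),
  nnm g1 -> nnm g2 -> (forall x, g1 (- x) = g1 x) -> (forall x, g2 (- x) = g2 x) ->
  0 <= a1 -> 0 <= a2 ->
  (forall x, g1 x <= a1 * expR (x ^+ 2 / 8)) -> (forall x, g2 x <= a2 * expR (x ^+ 2 / 8)) ->
  Ex stdR g1 = m1%:E -> Ex stdR g2 = m2%:E ->
  dotv a a = 1 -> dotv b b = 1 ->
  exists2 v, Ex (gaussP n) (fun z => g1 (dot a z) * g2 (dot b z)) = v%:E &
    `|v - m1 * m2| <= covC * dotv a b ^+ 2 * (a1 * a2).
Proof.
move=> M100 MB covC n a b g1 g2 a1 a2 m1 m2 n1 n2 e1 e2 a10 a20 b1 b2 E1 E2 aa bb.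
have [r [c [c0 cE rE EI]]] := law2_unit n1 n2 e1 aa bb; rewrite EI -rE.
have nI : nnm (fun v : R * R => g1 v.1 * g2 (r * v.1 + c * v.2)).
  by apply: nnmM; [exact: nnm_fst|exact: nnm_comp_lin].
set I := Ex2 _.
have I0 : (0 <= I)%E by exact: Ex2_ge0.
have aa0 : 0 <= a1 * a2 by exact: mulr_ge0.
have K1 := @K4_ge1 R.
have r20 := sqr_ge0 r.
(* Both inequalities are free of subtraction in the extended reals, and the first one also shows
   that [I] is finite. *)
suff [up lo] : (I <= (m1 * m2 + covC * r ^+ 2 * (a1 * a2))%:E)%E /\
    ((m1 * m2)%:E <= I + (covC * r ^+ 2 * (a1 * a2))%:E)%E.
  have If : I \is a fin_num by rewrite ge0_fin_numE// (le_lt_trans up) ?ltry.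
  exists (fine I); first by rewrite fineK.
  move: up lo; rewrite -(fineK If) -EFinD !lee_fin => up lo.
  by rewrite ler_norml; apply/andP; split; lra.
have [m1' E1' /andP[m10 m1K]] := Ex_exp8_bound n1 a10 b1.
have [m2' E2' /andP[m20 m2K]] := Ex_exp8_bound n2 a20 b2.
have ? : m1' = m1 by apply: EFin_inj; rewrite -E1'.
have ? : m2' = m2 by apply: EFin_inj; rewrite -E2'.
subst m1' m2'.
have mm : m1 * m2 <= a1 * a2 * K4 ^+ 2.
  by rewrite (_ : a1 * a2 * K4 ^+ 2 = (a1 * K4) * (a2 * K4)); [exact: ler_pM|ring].
have [rs|rb] := leP `|r| 10^-1.
  have r2 : r ^+ 2 <= 100^-1.
    by rewrite -real_normK ?num_real// expr2 (le_trans (ler_pM _ _ rs rs))//; lra.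
  have c0' : 0 < c.
    by rewrite lt_neqAle c0 andbT eq_sym; apply/eqP => cz; move: cE; rewrite cz; lra.
  (* The correlated pair becomes an independent one weighted by the kernel, whose distance to 1 is
     then the covariance. *)
  have IE : I = Ex2 (fun v => g1 v.1 * (g2 v.2 * mehler r c v.1 v.2)).
    apply: eq_integral => x _ /=.
    have g1x : 0 <= g1 x by exact: n1.2.
    have nc : nnm (fun y => g2 (c * y + r * x)).
      split => [|y]; last exact: n2.2.
      apply: (measurableT_comp n2.1); apply: measurable_funD => //; exact: measurable_funM.
    transitivity (Ex stdR (fun y => g1 x * g2 (c * y + r * x))).
      by apply: eq_integral => y _; rewrite addrC.
    rewrite ExZ// even_affine_Ex// -ExZ//.
    apply: nnmM => //; split.
      apply: measurable_funM => //; apply: measurable_funD; first exact: measurable_affine_density.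
      by apply: measurableT_comp => //; exact: measurable_affine_density.
    by move=> w; rewrite divr_ge0// addr_ge0// affine_density_ge0.
  have nM := nnm_mehler r c0'.
  have n12 := nnmM (nnm_fst n1) (nnm_snd n2).
  have nM1 : nnm (fun v : R * R => g1 v.1 * (g2 v.2 * mehler r c v.1 v.2)).
    exact: (nnmM (nnm_fst n1) (nnmM (nnm_snd n2) nM)).
  (* In each variable the weight 1/8 of the function and the weight 1/8 of the kernel error add up
     to 1/4, so the error is dominated by the integrable product of [h] and [expR (w ^+ 2 / 4)]. *)
  pose h (x : R) := M * r ^+ 2 * (a1 * a2) * expR (x ^+ 2 / 4).
  have M0 : 0 <= M by lra.
  have k6 : 0 <= M * r ^+ 2 := mulr_ge0 M0 r20.
  have k60 : 0 <= M * r ^+ 2 * (a1 * a2) by apply: mulr_ge0.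
  have nh : nnm h := nnmZ k60 (@nnm_exp4 R).
  have n4 := @nnm_exp4 R.
  have nE := nnmM (nnm_fst nh) (nnm_snd n4).
  have EE : Ex2 (fun v : R * R => h v.1 * expR (v.2 ^+ 2 / 4)) = (M * r ^+ 2 * (a1 * a2) * K4 * K4)%:E.
    have hE : Ex stdR h = (M * r ^+ 2 * (a1 * a2) * K4)%:E.
      by rewrite /h (ExZ _ k60 n4) Ex_exp4 -EFinM.
    exact: (Ex2_prod nh n4 hE (@Ex_exp4 R)).
  have E12 := Ex2_prod n1 n2 E1 E2.
  have bd x w : g1 x * g2 w * (M * r ^+ 2 * (expR (x ^+ 2 / 8) * expR (w ^+ 2 / 8)))
     <= h x * expR (w ^+ 2 / 4).
    have q (y : R) : expR (y ^+ 2 / 4) = expR (y ^+ 2 / 8) * expR (y ^+ 2 / 8) by rewrite -expRD; congr expR; field.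
    have p1 := ler_pM (n1.2 x) (n2.2 w) (b1 x) (b2 w).
    rewrite /h !q; set X := expR (x ^+ 2 / 8) in p1 *; set W := expR (w ^+ 2 / 8) in p1 *.
    have X0 : 0 <= X by exact: expR_ge0.
    have W0 : 0 <= W by exact: expR_ge0.
    rewrite (_ : _ * _ * _ * _ = (a1 * X) * (a2 * W) * (M * r ^+ 2 * (X * W))); last by ring.
    exact: (ler_wpM2r (mulr_ge0 k6 (mulr_ge0 X0 W0)) p1).
  have cC : M * r ^+ 2 * (a1 * a2) * K4 * K4 <= covC * r ^+ 2 * (a1 * a2).
    rewrite /covC (_ : _ * K4 * K4 = M * K4 ^+ 2 * (r ^+ 2 * (a1 * a2))); last by ring.
    rewrite -[leRHS]mulrA; apply: ler_wpM2r; first by rewrite mulr_ge0.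
    by rewrite ler_wpM2l// lerDr; apply: le_trans K1.
  split.
    rewrite IE; apply: (@le_trans _ _ (Ex2 (fun v => g1 v.1 * g2 v.2 + h v.1 * expR (v.2 ^+ 2 / 4)))).
      apply: Ex2_le => //; first exact: nnmD.
      move=> [x w] /=; have [hm _] := MB r c x w c0' cE rs.
      rewrite mulrA; apply: (le_trans (ler_wpM2l (mulr_ge0 (n1.2 x) (n2.2 w)) hm)).
      by rewrite mulrDr mulr1 lerD2l.
    by rewrite Ex2D// E12 EE -EFinD lee_fin lerD2l.
  rewrite -E12 IE; apply: (@le_trans _ _ (Ex2 (fun v => g1 v.1 * (g2 v.2 * mehler r c v.1 v.2) + h v.1 * expR (v.2 ^+ 2 / 4)))).
    apply: Ex2_le => //; first exact: nnmD.
    move=> [x w] /=; have [_ hm] := MB r c x w c0' cE rs.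
    rewrite mulrA -[leLHS]mulr1; apply: (le_trans (ler_wpM2l (mulr_ge0 (n1.2 x) (n2.2 w)) hm)).
    by rewrite mulrDr lerD2l.
  by rewrite Ex2D// EE leeD2l// lee_fin.
(* Large correlation: [1 <= M * r ^+ 2] because [100 <= M], so a bound on [I] that does not decay
   with [r] is enough. *)
have r2 : 1 <= 100 * r ^+ 2.
  rewrite -real_normK ?num_real//; move: (`|r|) rb => q qb; nra.
have big : a1 * a2 * (K4 + K4 ^+ 2) <= covC * r ^+ 2 * (a1 * a2).
  rewrite /covC (_ : _ * r ^+ 2 * _ = (a1 * a2 * (K4 + K4 ^+ 2)) * (M * r ^+ 2)); last by ring.
  rewrite ler_peMr//; last by apply: (le_trans r2); apply: ler_wpM2r.
  by apply: mulr_ge0 => //; apply: addr_ge0; [apply: le_trans K1|apply: sqr_ge0].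
have mm0 : 0 <= m1 * m2 by exact: mulr_ge0.
have aK : 0 <= a1 * a2 * K4 by rewrite mulr_ge0//; lra.
have aK2 : 0 <= a1 * a2 * K4 ^+ 2 by rewrite mulr_ge0// sqr_ge0.
rewrite mulrDr in big.
split; last by apply: (@le_trans _ _ (0 + (covC * r ^+ 2 * (a1 * a2))%:E)%E);
  [rewrite add0e lee_fin; lra|exact: leeD2r].
rewrite /I -EI.
have k0 : 0 <= a1 * a2 / 2 by lra.
have nA := nnmZ k0 (nnm_dot a (@nnm_exp4 R)).
have nB := nnmZ k0 (nnm_dot b (@nnm_exp4 R)).
(* The arithmetic-geometric mean inequality separates the two forms, so only their one-dimensional
   laws matter. *)
apply: (@le_trans _ _ (Ex (gaussP n) (fun z => (a1 * a2 / 2) * expR (dot a z ^+ 2 / 4) + (a1 * a2 / 2) * expR (dot b z ^+ 2 / 4)))).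
  apply: Ex_le; [by apply: nnmM; exact: nnm_dot|exact: nnmD|].
  move=> z /=; set x := dot a z; set w := dot b z.
  have q (t : R) : expR (t ^+ 2 / 4) = expR (t ^+ 2 / 8) ^+ 2 by rewrite [RHS]expr2 -expRD; congr expR; field.
  have p1 := ler_pM (n1.2 x) (n2.2 w) (b1 x) (b2 w).
  rewrite !q; apply: (le_trans p1); have := sqr_ge0 (expR (x ^+ 2 / 8) - expR (w ^+ 2 / 8)).
  move: (expR (x ^+ 2 / 8)) (expR (w ^+ 2 / 8)) => X W XW.
  rewrite (_ : a1 * X * (a2 * W) = a1 * a2 / 2 * (2 * (X * W))); last by field.
  by rewrite -mulrDr; apply: ler_wpM2l => //; clear - XW; lra.
rewrite (ExD _ nA nB) !ExZ//; [|exact: nnm_dot (@nnm_exp4 R)..].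
rewrite (law1_exp4 aa) (law1_exp4 bb).
rewrite -EFinM -EFinD lee_fin.
clear - big aK2 mm0; lra.
Qed.

Lemma gauss_cov : exists2 C : R, 0 <= C & forall n
  (a b : 'cV[R]_n) (g1 g2 : R -> R) (a1 a2 m1 m2 : R),
  nnm g1 -> nnm g2 -> (forall x, g1 (- x) = g1 x) -> (forall x, g2 (- x) = g2 x) ->
  0 <= a1 -> 0 <= a2 ->
  (forall x, g1 x <= a1 * expR (x ^+ 2 / 8)) -> (forall x, g2 x <= a2 * expR (x ^+ 2 / 8)) ->
  Ex stdR g1 = m1%:E -> Ex stdR g2 = m2%:E ->
  dotv a a = 1 -> dotv b b = 1 ->
  exists2 v, Ex (gaussP n) (fun z => g1 (dot a z) * g2 (dot b z)) = v%:E &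
    `|v - m1 * m2| <= C * dotv a b ^+ 2 * (a1 * a2).
Proof.
have [M [M100 MB]] := mehler_const.
exists (M * (K4 + K4 ^+ 2)); last exact: gauss_cov_aux.
have K1 := @K4_ge1 R; have K2 := sqr_ge0 (@K4 R).
by apply: mulr_ge0; lra.
Qed.

End cov.

(** * Second moment of a centred sum *)

Section EW2.
Context {R : realType}.
Notation stdR := (@stdR R).

Lemma Ex_sumM d0 (T : measurableType d0) (P : probability T R) (I : finType) (Q : pred I)
  (f1 f2 : I -> T -> R) (v : I -> I -> R) :
  (forall i, nnm (f1 i)) -> (forall i, nnm (f2 i)) ->
  (forall i j, Ex P (fun z => f1 i z * f2 j z) = (v i j)%:E) ->
  Ex P (fun z => (\sum_(i | Q i) f1 i z) * (\sum_(i | Q i) f2 i z)) =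
  (\sum_(i | Q i) \sum_(j | Q j) v i j)%:E.
Proof.
move=> n1 n2 vE.
transitivity (Ex P (fun z => \sum_(i | Q i) \sum_(j | Q j) f1 i z * f2 j z)).
  by apply: eq_Ex => z; rewrite big_distrlr.
have nn i j : nnm (fun z => f1 i z * f2 j z) by apply: nnmM.
rewrite Ex_sum; last by move=> i; apply: nnm_sum.
rewrite -sumEFin; apply: eq_bigr => i _; rewrite Ex_sum// -sumEFin.
by apply: eq_bigr => j _; exact: vE.
Qed.

(** The summand [g - be * h] is centred but signed, so its square is expanded into products of the
    nonnegative [g] and [h]. After the means cancel, the pair [(i, j)] contributes three
    covariances, each at most a multiple of the squared correlation by [gauss_cov]. *)
Lemma Ex_centered_sum_sq : exists2 C : R, 0 <= C & forall (n : nat) (I : finType)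
  (a : I -> 'cV[R]_n) (Q : pred I) (g h : R -> R) (ag ah mh be : R),
  nnm g -> nnm h -> (forall x, g (- x) = g x) -> (forall x, h (- x) = h x) ->
  0 <= ag -> 0 <= ah -> 0 <= be ->
  (forall x, g x <= ag * expR (x ^+ 2 / 8)) -> (forall x, h x <= ah * expR (x ^+ 2 / 8)) ->
  Ex stdR g = (be * mh)%:E -> Ex stdR h = mh%:E ->
  (forall i, dotv (a i) (a i) = 1) ->
  (Ex (gaussP n) (fun z => (\sum_(i | Q i) (g (dot (a i) z) - be * h (dot (a i) z))) ^+ 2)%R
   <= (C * (ag + be * ah) ^+ 2 * \sum_i \sum_j dotv (a i) (a j) ^+ 2)%:E)%E.
Proof.
have [C C0 HC] := @gauss_cov R.
exists C => // n I a Q g h ag ah mh be ng nh eg eh ag0 ah0 be0 bg bh Eg Eh aa.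
pose x i j := fine (Ex (gaussP n) (fun z => g (dot (a i) z) * g (dot (a j) z))).
pose y i j := fine (Ex (gaussP n) (fun z => h (dot (a i) z) * h (dot (a j) z))).
pose w i j := fine (Ex (gaussP n) (fun z => g (dot (a i) z) * h (dot (a j) z))).
have Hx i j : Ex (gaussP n) (fun z => g (dot (a i) z) * g (dot (a j) z)) = (x i j)%:E /\
   `|x i j - be * mh * (be * mh)| <= C * dotv (a i) (a j) ^+ 2 * (ag * ag).
  have [v vE vb] := HC n (a i) (a j) g g ag ag _ _ ng ng eg eg ag0 ag0 bg bg Eg Eg (aa i) (aa j).
  by rewrite /x vE.
have Hy i j : Ex (gaussP n) (fun z => h (dot (a i) z) * h (dot (a j) z)) = (y i j)%:E /\
   `|y i j - mh * mh| <= C * dotv (a i) (a j) ^+ 2 * (ah * ah).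
  have [v vE vb] := HC n (a i) (a j) h h ah ah _ _ nh nh eh eh ah0 ah0 bh bh Eh Eh (aa i) (aa j).
  by rewrite /y vE.
have Hw i j : Ex (gaussP n) (fun z => g (dot (a i) z) * h (dot (a j) z)) = (w i j)%:E /\
   `|w i j - be * mh * mh| <= C * dotv (a i) (a j) ^+ 2 * (ag * ah).
  have [v vE vb] := HC n (a i) (a j) g h ag ah _ _ ng nh eg eh ag0 ah0 bg bh Eg Eh (aa i) (aa j).
  by rewrite /w vE.
pose gs z := \sum_(i | Q i) g (dot (a i) z).
pose hs z := \sum_(i | Q i) h (dot (a i) z).
have ngi i : nnm (fun z => g (dot (a i) z)) by exact: nnm_dot.
have nhi i : nnm (fun z => h (dot (a i) z)) by exact: nnm_dot.
have ngs : nnm gs by exact: nnm_sum.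
have nhs : nnm hs by exact: nnm_sum.
have Eg2 := Ex_sumM Q ngi ngi (fun i j => (Hx i j).1).
have Eh2 := Ex_sumM Q nhi nhi (fun i j => (Hy i j).1).
have Egh := Ex_sumM Q ngi nhi (fun i j => (Hw i j).1).
rewrite -/gs -/hs in Eg2 Eh2 Egh.
set A := \sum_(i | Q i) _ in Eg2; set B := \sum_(i | Q i) _ in Eh2; set Z := \sum_(i | Q i) _ in Egh.
have WE z : \sum_(i | Q i) (g (dot (a i) z) - be * h (dot (a i) z)) = gs z - be * hs z.
  by rewrite sumrB -mulr_sumr.
rewrite (eq_Ex _ (fun z => congr1 (fun t => t ^+ 2) (WE z))).
have nW : nnm (fun z => (gs z - be * hs z) ^+ 2).
  by apply: nnm_sqr; apply: measurable_funB; [exact: ngs.1|apply: measurable_funM => //; exact: nhs.1].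
have be2 : 0 <= 2 * be by rewrite mulr_ge0.
have bes : 0 <= be ^+ 2 by exact: sqr_ge0.
(* The cross term stays on the left, so that both sides are sums of expectations of nonnegative
   functions. *)
have key : (Ex (gaussP n) (fun z => ((gs z - be * hs z) ^+ 2)%R) + (2 * be * Z)%:E = (A + be ^+ 2 * B)%:E)%E.
  rewrite EFinM -Egh -ExZ//; last exact: nnmM.
  rewrite -ExD//; last by apply: nnmZ => //; exact: nnmM.
  rewrite EFinD EFinM -Eg2 -Eh2 -ExZ//; last exact: nnmM.
  rewrite -ExD//; [|exact: nnmM|by apply: nnmZ => //; exact: nnmM].
  by apply: eq_Ex => z; rewrite -/(gs z) -/(hs z); ring.
have {key} -> : Ex (gaussP n) (fun z => (gs z - be * hs z) ^+ 2) = (A + be ^+ 2 * B - 2 * be * Z)%:E.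
  by rewrite EFinB -key addeK.
rewrite lee_fin.
(* The inserted products of means sum to zero, since [g] has mean [be * mh] and [h] has mean
   [mh]. *)
have -> : A + be ^+ 2 * B - 2 * be * Z = \sum_(i | Q i) \sum_(j | Q j)
   ((x i j - be * mh * (be * mh)) + be ^+ 2 * (y i j - mh * mh) - 2 * be * (w i j - be * mh * mh)).
  rewrite /A /B /Z !mulr_sumr -big_split /= -sumrB; apply: eq_bigr => i _.
  rewrite !mulr_sumr -big_split /= -sumrB; apply: eq_bigr => j _; ring.
rewrite mulr_sumr [leRHS](bigID Q) /= -[leLHS]addr0; apply: lerD; last first.
  by apply: sumr_ge0 => i _; apply: mulr_ge0; [rewrite mulr_ge0 ?sqr_ge0|apply: sumr_ge0 => j _; exact: sqr_ge0].
apply: ler_sum => i _.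
rewrite mulr_sumr [leRHS](bigID Q) /= -[leLHS]addr0; apply: lerD; last first.
  by apply: sumr_ge0 => j _; apply: mulr_ge0; [apply: mulr_ge0 => //; exact: sqr_ge0|exact: sqr_ge0].
apply: ler_sum => j _.
have [_] := Hx i j; have [_] := Hy i j; have [_] := Hw i j.
rewrite !ler_norml => /andP[w1 _] /andP[_ y2] /andP[_ x2].
set r2 := dotv _ _ ^+ 2 in w1 y2 x2 *.
have h1 := ler_wpM2l bes y2; have h2 := ler_wpM2l be2 w1.
clear - x2 h1 h2; nra.
Qed.

End EW2.

(** * The truncated second moment *)

Section beta.
Context {R : realType}.
Notation stdR := (@stdR R).
Notation stdN := (@stdN R).
Notation mu := (@lebesgue_measure R).

Definition htau (t x : R) : R := if t < `|x| then 1 else 0.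
Definition gtau (t x : R) : R := x ^+ 2 * htau t x.

Lemma nnm_htau t : nnm (htau t).
Proof.
split; last by move=> x; rewrite /htau; case: ifP.
apply: measurable_fun_ifT => //; apply: measurable_fun_ltr => //.
Qed.

Lemma nnm_gtau t : nnm (gtau t).
Proof. by apply: nnmM; [exact/nnm_sqr/measurable_id|exact: nnm_htau]. Qed.

Lemma htau_even t x : htau t (- x) = htau t x.
Proof. by rewrite /htau normrN. Qed.

Lemma gtau_even t x : gtau t (- x) = gtau t x.
Proof. by rewrite /gtau htau_even sqrrN. Qed.

Lemma htau_exp (t x k : R) : 0 <= t -> 0 <= k -> htau t x <= expR (k * (x ^+ 2 - t ^+ 2)).
Proof.
move=> t0 k0; rewrite /htau; case: ifPn => h; last exact: expR_ge0.
rewrite -expR0 ler_expR mulr_ge0// subr_ge0 -[x ^+ 2]real_normK ?num_real//.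
by rewrite lerXn2r ?nnegrE// ltW.
Qed.

Lemma htau_bound (t x : R) : 0 <= t -> htau t x <= expR (- (t ^+ 2 / 16)) * expR (x ^+ 2 / 8).
Proof.
move=> t0; apply: (le_trans (@htau_exp t x 16^-1 t0 _)) => //.
by rewrite -expRD ler_expR; have := sqr_ge0 x; lra.
Qed.

(** Half of the exponent [x ^+ 2 / 8] pays for the factor [x ^+ 2]; the other half, compared with
    [t ^+ 2 / 16] beyond the threshold, yields the decay in [t]. *)
Lemma gtau_bound (t x : R) : 0 <= t -> gtau t x <= 16 * expR (- (t ^+ 2 / 16)) * expR (x ^+ 2 / 8).
Proof.
move=> t0; rewrite /gtau.
have h1 := @htau_exp t x 16^-1 t0 ltac:(by []).
have h2 : x ^+ 2 <= 16 * expR (x ^+ 2 / 16) by have := expR_ge1Dx (x ^+ 2 / 16); lra.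
have := ler_pM (sqr_ge0 x) ((nnm_htau t).2 x) h2 h1.
move/le_trans; apply; rewrite -!mulrA ler_wpM2l// -!expRD ler_expR.
by have := sqr_ge0 x; lra.
Qed.

Lemma stdN_set1 (t : R) : stdN [set t] = 0%E.
Proof. by rewrite /stdN /normal_prob; exact: integral_set1. Qed.

Lemma indic_point (t : R) : (fun x : R => (x == t)%:R : R) = \1_[set t].
Proof.
apply/funext => x; rewrite indicE; congr ((nat_of_bool _)%:R).
by apply/idP/idP => [/eqP ->|]; rewrite inE// => ->.
Qed.

Lemma Ex_indic (A : set R) : measurable A -> Ex stdR (\1_A) = stdN A.
Proof.
move=> mA; rewrite /Ex stdRE.
- rewrite integral_indic; [|by []|exact: mA].
  exact: (congr1 stdN (setIT A)).
- by apply/measurable_EFinP; exact: measurable_indic.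
- by move=> x; rewrite lee_fin.
Qed.

Lemma Ex_point (t : R) : Ex stdR (fun x => (x == t)%:R) = 0%E.
Proof. by rewrite indic_point Ex_indic ?stdN_set1. Qed.

Lemma nnm_point (t : R) : nnm (fun x => (x == t)%:R : R).
Proof.
split=> [|x]; last exact: ler0n.
rewrite indic_point.
exact: measurable_indic.
Qed.

(* [beta] conditions on [t <= |x|], the estimator thresholds at [t < |x|]: both
   indicators agree almost everywhere, see [htau_ae]. *)
Definition h'tau (t x : R) : R := \1_[set y : R | t <= `|y|] x.

Lemma h'tauE t x : h'tau t x = if t <= `|x| then 1 else 0.
Proof.
rewrite /h'tau indicE (_ : (x \in _) = (t <= `|x|)); first by case: (t <= _).
by apply: asboolb.
Qed.

Lemma measurable_h'set t : measurable [set y : R | t <= `|y|].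
Proof.
have m : measurable_fun setT (fun y : R => t <= `|y|) by apply: measurable_fun_ler.
have := m measurableT [set true] I; rewrite setTI => h.
by rewrite (_ : [set y | _] = (fun y : R => t <= `|y|) @^-1` [set true]).
Qed.

Lemma nnm_h'tau t : nnm (h'tau t).
Proof.
split; last by move=> x; rewrite h'tauE; case: ifP.
apply: measurable_indic; exact: measurable_h'set.
Qed.

Lemma htau_ae (f : R -> R) t : nnm f ->
  Ex stdR (fun x => f x * h'tau t x) = Ex stdR (fun x => f x * htau t x).
Proof.
move=> nf; have nh := nnmM nf (nnm_htau t); have nh' := nnmM nf (nnm_h'tau t).
apply/eqP; rewrite eq_le; apply/andP; split; last first.
  apply: Ex_le => // x; rewrite h'tauE /htau; apply: ler_wpM2l; first exact: nf.2.
  by case: ltP => [/ltW ->//|_]; case: ifP.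
have n1 := nnmZ (nf.2 t) (nnm_point t); have n2 := nnmZ (nf.2 (- t)) (nnm_point (- t)).
apply: (@le_trans _ _ (Ex stdR (fun x => f x * htau t x + (f t * (x == t)%:R + f (- t) * (x == - t)%:R)))).
  apply: Ex_le => //; first by apply: nnmD => //; exact: nnmD.
  move=> x; rewrite h'tauE /htau; case: (leP t `|x|) => xt; last first.
    rewrite mulr0; apply: addr_ge0; first exact: (nh.2 x).
    by apply: addr_ge0; [exact: n1.2|exact: n2.2].
  case: (ltP t `|x|) => tx.
    by rewrite mulr1 lerDl addr_ge0 ?n1.2 ?n2.2.
  have {xt tx} tE : t = `|x| by apply/eqP; rewrite eq_le xt.
  rewrite mulr0 add0r mulr1; have [x0|x0] := leP 0 x.
    have -> : x = t by rewrite tE ger0_norm.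
    by rewrite eqxx mulr1 lerDl; exact: n2.2.
  have -> : x = - t by rewrite tE ltr0_norm// opprK.
  by rewrite eqxx mulr1 lerDr; exact: n1.2.
rewrite ExD//; last exact: nnmD.
rewrite ExD// ExZ ?nf.2//; last exact: nnm_point.
rewrite ExZ ?nf.2//; last exact: nnm_point.
by rewrite !Ex_point !mule0 !adde0.
Qed.

Definition ctail : R := normal_peak 1 * expR (- 1).

Lemma ctail_gt0 : 0 < ctail.
Proof. by rewrite mulr_gt0 ?expR_gt0// normal_peak_gt0// oner_neq0. Qed.

(** On the unit interval to the right of [t] the density is at least its value at [t + 1], and
    [(t + 1) ^+ 2 <= 2 * t ^+ 2 + 2]. The exponent is not sharp, but it matches the remainder in
    [Ex_gtau_upper]. *)
Lemma tail_lower (t : R) : 0 <= t -> ((ctail * expR (- t ^+ 2))%:E <= Ex stdR (htau t))%E.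
Proof.
move=> t0.
have mI : measurable (`]t, (t + 1)[%classic : set R) by exact: measurable_itv.
apply: (@le_trans _ _ (stdN `]t, (t + 1)[%classic)); last first.
  rewrite -(Ex_indic mI).
  apply: Ex_le; [by split => //; exact: measurable_indic|exact: nnm_htau|].
  move=> x; rewrite indicE /htau; case: (boolP (x \in _)) => [|_]; last by case: ifP.
  by rewrite inE /= in_itv /= => /andP[h _]; rewrite ger0_norm ?h// (le_trans t0)// ltW.
rewrite /stdN /normal_prob.
apply: (@le_trans _ _ (\int[mu]_(x in `]t, (t + 1)%R[%classic) (ctail * expR (- t ^+ 2))%:E)%E).
  rewrite integral_cst//= lebesgue_measure_itv/= lte_fin ltrDl ltr01.
  by rewrite -EFinD addrAC subrr add0r mule1.
have mp := @measurable_gpdf R.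
apply: ge0_le_integral => //.
- by move=> x _; rewrite lee_fin mulr_ge0 ?expR_ge0// ltW// ctail_gt0.
- by apply/measurable_EFinP; apply: measurable_funTS; exact: mp.
move=> x /=; rewrite in_itv /= => /andP[h1 h2]; rewrite lee_fin -/(gpdf x) gpdfE /ctail -mulrA.
apply: ler_wpM2l; first exact: normal_peak_ge0.
rewrite -expRD ler_expR.
have : x ^+ 2 <= (t + 1) ^+ 2 by rewrite lerXn2r ?nnegrE//; lra.
by have := sqr_ge0 (t - 1); lra.
Qed.

Lemma Ex_htau_fin (t : R) : exists2 m, Ex stdR (htau t) = m%:E & 0 <= m <= 1.
Proof.
exists (fine (Ex stdR (htau t))); have [] := @Ex_fin_le _ _ R stdR (htau t) 1 (nnm_htau t) => //;
  rewrite -(Ex_cst stdR 1); apply: Ex_le => //; do ?[exact: nnm_htau|exact: nnm_cst];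
  by move=> x; rewrite /htau; case: ifP.
Qed.

(** Split at [2 * t]. Below, [x ^+ 2 <= 4 * t ^+ 2]. Above, [x ^+ 2 <= 8 * expR (x ^+ 2 / 8)], and
    [t ^+ 2 <= x ^+ 2 / 4] allows the factor [expR (- t ^+ 2)] at the price of the exponent
    [3 / 8 * x ^+ 2], whose exponential has expectation 2. *)
Lemma Ex_gtau_upper (t : R) : 0 <= t ->
  (Ex stdR (gtau t) <= (4 * t ^+ 2)%:E * Ex stdR (htau t) + (16 * expR (- t ^+ 2))%:E)%E.
Proof.
move=> t0; have k0 : 0 <= 4 * t ^+ 2 by rewrite mulr_ge0 ?sqr_ge0.
pose f (x : R) := expR ((1 - 2 ^- 2) / 2 * x ^+ 2).
have nf : nnm f by apply: nnm_exp; apply: measurable_funM => //; exact: measurable_sqr.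
have c0 : 0 <= 8 * expR (- t ^+ 2) by rewrite mulr_ge0 ?expR_ge0.
have fE : Ex stdR f = 2%:E by rewrite Ex_exp_sq.
have -> : (16 * expR (- t ^+ 2))%:E = Ex stdR (fun x => 8 * expR (- t ^+ 2) * f x).
  by rewrite ExZ// fE -EFinM; congr _%:E; ring.
rewrite -ExZ//; last exact: nnm_htau.
rewrite -ExD; [|by apply: nnmZ => //; exact: nnm_htau|exact: nnmZ].
apply: Ex_le; [exact: nnm_gtau|by apply: nnmD; [apply: nnmZ => //; exact: nnm_htau|exact: nnmZ]|].
move=> x; rewrite /gtau /htau; case: ifPn => h; last first.
  by rewrite !mulr0 add0r mulr_ge0// nf.2.
rewrite !mulr1; have [h2|h2] := leP `|x| (2 * t).
  have : x ^+ 2 <= (2 * t) ^+ 2.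
    by rewrite -[x ^+ 2]real_normK ?num_real// lerXn2r ?nnegrE// (le_trans _ h2).
  by have := mulr_ge0 c0 (nf.2 x); lra.
have x2 : (2 * t) ^+ 2 <= x ^+ 2.
  by rewrite -[x ^+ 2]real_normK ?num_real// lerXn2r ?nnegrE ?(ltW h2)// mulr_ge0.
have e : x ^+ 2 <= 8 * expR (x ^+ 2 / 8) by have := expR_ge1Dx (x ^+ 2 / 8); lra.
apply: (le_trans e); rewrite -[leLHS]add0r; apply: lerD => //.
rewrite -mulrA ler_wpM2l// /f -expRD ler_expR; lra.
Qed.

(** [Ex_gtau_upper] divided by the tail probability [m]: the remainder [16 * expR (- t ^+ 2)] is at
    most [16 / ctail * m] by [tail_lower]. The product form [beta t * m] is the centring condition
    of [Ex_centered_sum_sq]. *)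
Lemma beta_spec : exists2 C : R, 0 <= C & forall t : R, 0 <= t ->
  exists2 m, Ex stdR (htau t) = m%:E &
   [/\ Ex stdR (gtau t) = (beta t * m)%:E, 0 <= beta t & beta t <= 4 * t ^+ 2 + C].
Proof.
exists (16 / ctail) => [|t t0]; first by rewrite divr_ge0// ltW// ctail_gt0.
have [m mE /andP[m0 m1]] := Ex_htau_fin t; exists m => //.
have tl := tail_lower t0; rewrite mE lee_fin in tl.
have mp : 0 < m by apply: lt_le_trans tl; rewrite mulr_gt0 ?ctail_gt0 ?expR_gt0.
have gu := Ex_gtau_upper t0; rewrite mE -EFinM -EFinD in gu.
have [gE /andP[g0 gu']] := Ex_fin_le (nnm_gtau t) gu.
have E1 : stdN [set y : R | t <= `|y|] = m%:E.
  rewrite -mE; transitivity (Ex stdR (fun x => 1 * h'tau t x)); last first.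
    rewrite htau_ae; last exact: nnm_cst.
    by apply: eq_Ex => x; rewrite mul1r.
  rewrite -Ex_indic; last exact: measurable_h'set.
  by apply: eq_Ex => x; rewrite mul1r.
have E2 : (\int[stdN]_x ((x ^+ 2) * (\1_[set y : R | (t <= `|y|)%R] x))%:E)%E = Ex stdR (gtau t).
  have ns : nnm (fun x : R => x ^+ 2) by exact/nnm_sqr/measurable_id.
  rewrite -(htau_ae t ns) /Ex stdRE//.
  - by apply/measurable_EFinP; exact: (nnmM ns (nnm_h'tau t)).1.
  - by move=> x; rewrite lee_fin; exact: (nnmM ns (nnm_h'tau t)).2.
have bE : beta t = fine (Ex stdR (gtau t)) / m by rewrite /beta E1 E2.
have bm : beta t * m = fine (Ex stdR (gtau t)) by rewrite bE divfK// gt_eqF.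
split; first by rewrite bm.
  by rewrite bE divr_ge0.
rewrite -(ler_pM2r mp) bm; apply: (le_trans gu').
have -> : (4 * t ^+ 2 + 16 / ctail) * m = 4 * t ^+ 2 * m + 16 * (m / ctail).
  by field; rewrite gt_eqF// ctail_gt0.
by rewrite lerD2l ler_wpM2l// ler_pdivlMr ?ctail_gt0// mulrC.
Qed.

End beta.

(** * Square roots of covariance matrices *)

Section psd.
Context {R : realType}.

Lemma is_cov_block d (al : R) (v : 'cV[R]_d) (B : 'M[R]_d) (t : R) (y : 'cV[R]_d) :
  ((col_mx t%:M y)^T *m block_mx al%:M v^T v B *m col_mx t%:M y) 0 0
  = al * t ^+ 2 + 2 * t * (v^T *m y) 0 0 + (y^T *m B *m y) 0 0.
Proof.
rewrite tr_col_mx mul_row_block mul_row_col tr_scalar_mx.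
have yv : y^T *m v = v^T *m y.
  by apply/matrixP => i j; rewrite !ord1 !mxE; apply: eq_bigr => k _; rewrite !mxE mulrC.
rewrite !mulmxDl !mul_scalar_mx !mul_mx_scalar -!scalemxAl yv.
move: (v^T *m y) (y^T *m B *m y) => P Q; rewrite !mxE eqxx mulr1n; ring.
Qed.

(* Cholesky-type recursion on the dimension; a zero pivot forces a zero row. *)
Lemma psd_sqrt d (S : 'M[R]_d) : is_cov S -> exists A : 'M[R]_d, A *m A^T = S.
Proof.
elim: d S => [|d IH] S [sS pS].
  by exists 0; apply/matrixP => -[].
pose S' : 'M[R]_(1 + d) := S.
pose al : R := S' 0 0; pose v := dlsubmx S'; pose B := drsubmx S'.
have sS' : S'^T = S' := sS.
have SE : S' = block_mx al%:M v^T v B.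
  rewrite -[LHS]submxK; congr block_mx.
    by rewrite [LHS]mx11_scalar; congr (_%:M); rewrite !mxE /al; congr (S' _ _); apply: val_inj.
  by rewrite /v trmx_dlsub sS'.
have sB : B^T = B by rewrite /B trmx_drsub sS'.
have q (t : R) (y : 'cV[R]_d) : 0 <= al * t ^+ 2 + 2 * t * (v^T *m y) 0 0 + (y^T *m B *m y) 0 0.
  by rewrite -is_cov_block -SE; exact: pS.
clearbody al v B.
have al0 : 0 <= al by have := q 1 0; rewrite !mulmx0 !mxE expr1n !mulr0 !addr0 mulr1.
have v0 : al = 0 -> v = 0.
  move=> alz; apply/matrixP => i j; rewrite ord1 mxE; apply/eqP; apply/negPn/negP => vi.
  set N := (v^T *m v) 0 0.
  have N0 : 0 < N.
    rewrite /N mxE (bigD1 i)//= ltr_pwDl//; first by rewrite mxE -expr2 exprn_even_gt0.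
    by apply: sumr_ge0 => k _; rewrite mxE -expr2 sqr_ge0.
  set p := (v^T *m B *m v) 0 0.
  (* With a zero pivot the form is affine in [t] along [v], and this [t] gives it the value -1. *)
  have := q (- (p + 1) / (2 * N)) v; rewrite alz -/N -/p mul0r add0r.
  have -> : 2 * (- (p + 1) / (2 * N)) * N = - (p + 1) by field; rewrite gt_eqF.
  lra.
(* The Schur complement. Its form at [y] is the value of the full form at the minimising [t]; since
   the inverse of 0 is 0, the same formulas cover a zero pivot. *)
pose B' := B - al^-1 *: (v *m v^T).
have cB' : is_cov B'.
  split; first by rewrite /B' linearB /= linearZ /= trmx_mul trmxK sB.
  move=> y; pose t := - al^-1 * (v^T *m y) 0 0.
  suff <- : al * t ^+ 2 + 2 * t * (v^T *m y) 0 0 + (y^T *m B *m y) 0 0 = (y^T *m B' *m y) 0 0 by exact: q.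
  have mB (P Q : 'M[R]_1) c : (P - c *: Q) 0 0 = P 0 0 - c * Q 0 0 by rewrite !mxE.
  rewrite /B' mulmxBr mulmxBl -scalemxAr -scalemxAl mB.
  have -> : (y^T *m (v *m v^T) *m y) 0 0 = (v^T *m y) 0 0 ^+ 2.
    rewrite mulmxA -mulmxA mxE big_ord1 expr2; congr (_ * _).
    by rewrite !mxE; apply: eq_bigr => k _; rewrite !mxE mulrC.
  rewrite /t; move: ((v^T *m y) 0 0) => w.
  have [->|alz] := eqVneq al 0; first by rewrite invr0 !(mul0r, oppr0, mulr0, add0r, subr0).
  by field.
have [A' AE] := IH _ cB'.
pose A : 'M[R]_(1 + d) := block_mx (Num.sqrt al)%:M 0 ((Num.sqrt al)^-1 *: v) A'.
suff E : A *m A^T = S' by exists A.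
rewrite SE /A tr_block_mx mulmx_block.
rewrite !trmx0 !mul0mx !mulmx0 !addr0 tr_scalar_mx linearZ /=.
have sv : Num.sqrt al *: ((Num.sqrt al)^-1 *: v) = v.
  have [alz|alz] := eqVneq al 0; first by rewrite v0// !scaler0.
  by rewrite scalerA divff ?scale1r// sqrtr_eq0 -ltNge lt0r alz.
congr block_mx.
- by rewrite -scalar_mxM -expr2 sqr_sqrtr.
- transitivity ((Num.sqrt al *: ((Num.sqrt al)^-1 *: v))^T); last by rewrite sv.
  by rewrite mul_scalar_mx; apply/matrixP => i j; rewrite !mxE.
- by rewrite mul_mx_scalar.
rewrite AE /B' -scalemxAl -scalemxAr scalerA -invfM -expr2 sqr_sqrtr//.
by rewrite addrC subrK.
Qed.

Lemma cov_sqrtP d (S : 'M[R]_d) : is_cov S -> cov_sqrt S *m (cov_sqrt S)^T = S.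
Proof. by move=> /psd_sqrt; exact: (@ClassicalEpsilon.epsilon_spec _ _ (fun A => A *m A^T = S)). Qed.

Definition rowv d n (A : 'M[R]_(d, n)) (i : 'I_d) : 'cV[R]_n := \col_k A i k.

Lemma mulmx_colt d (A : 'M[R]_d) z i : (A *m colt z) i 0 = dot (rowv A i) z.
Proof. by rewrite mxE; apply: eq_bigr => k _; rewrite !mxE. Qed.

Lemma dotv_rowv d n (A : 'M[R]_(d, n)) i j : dotv (rowv A i) (rowv A j) = (A *m A^T) i j.
Proof. by rewrite mxE; apply: eq_bigr => k _; rewrite !mxE. Qed.

Lemma cauchy_schwarz_sum (I : finType) (P : pred I) (x y : I -> R) :
  (\sum_(i | P i) x i * y i) ^+ 2 <= (\sum_(i | P i) x i ^+ 2) * (\sum_(i | P i) y i ^+ 2).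
Proof.
set Z := \sum_(i | P i) x i * y i; set X := \sum_(i | P i) x i ^+ 2; set Y := \sum_(i | P i) y i ^+ 2.
have Y0 : 0 <= Y by apply: sumr_ge0 => i _; exact: sqr_ge0.
have : 0 <= \sum_(i | P i) (Y * x i - Z * y i) ^+ 2 by apply: sumr_ge0 => i _; exact: sqr_ge0.
have -> : \sum_(i | P i) (Y * x i - Z * y i) ^+ 2 = Y * (X * Y - Z ^+ 2).
  transitivity (\sum_(i | P i) (Y ^+ 2 * x i ^+ 2 - 2 * Y * Z * (x i * y i) + Z ^+ 2 * y i ^+ 2)).
    by apply: eq_bigr => i _; ring.
  by rewrite big_split sumrB /= -!mulr_sumr -/X -/Y -/Z; ring.
have [Yz|Yz] := eqVneq Y 0.
  move=> _; rewrite Yz mulr0 (_ : Z = 0) ?expr0n// /Z big1// => i Pi.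
  have /eqP := Yz; rewrite psumr_eq0; last by move=> j _; exact: sqr_ge0.
  by move=> /allP /(_ i (mem_index_enum i)); rewrite Pi sqrf_eq0 => /eqP ->; rewrite mulr0.
by rewrite pmulr_rge0 ?subr_ge0// lt0r Yz.
Qed.

End psd.

(** * Mean square error of the quadratic functional *)

Section upper.
Context {R : realType}.
Notation stdR := (@stdR R).

Lemma Ex_dot_sq n (a : 'cV[R]_n) : Ex (gaussP n) (fun z => dot a z ^+ 2) = (dotv a a)%:E.
Proof.
have ns : nnm (fun x : R => x ^+ 2) by exact/nnm_sqr/measurable_id.
have [al Ha ->] := law1 a ns.
rewrite -[RHS]mule1 -Ex_sq -Ha -ExZ ?sqr_ge0//.
by apply: eq_Ex => x; rewrite exprMn.
Qed.

Lemma Ex_dot_4 n (a : 'cV[R]_n) : dotv a a = 1 ->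
  (Ex (gaussP n) (fun z => (dot a z ^+ 2) ^+ 2)%R <= (64 * K4)%:E)%E.
Proof.
move=> aa; have n4 := nnm_dot a (@nnm_exp4 R).
rewrite EFinM -(law1_exp4 aa) -ExZ//; apply: Ex_le.
- by apply: nnm_sqr; apply: measurable_funX; exact: measurable_dot.
- exact: nnmZ.
move=> z; have := @sq_le_exp R (dot a z ^+ 2 / 4).
by rewrite divr_ge0 ?sqr_ge0// => /(_ isT); lra.
Qed.

Lemma sqr4_le (x y z w : R) : (x + y - z + w) ^+ 2 <= 4 * (x ^+ 2 + y ^+ 2 + z ^+ 2 + w ^+ 2).
Proof.
have := sqr_ge0 (x - y); have := sqr_ge0 (x + z); have := sqr_ge0 (x - w).
have := sqr_ge0 (y + z); have := sqr_ge0 (y - w); have := sqr_ge0 (z + w); lra.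
Qed.

Lemma sqr2_le (x y : R) : (x + y) ^+ 2 <= 2 * (x ^+ 2 + y ^+ 2).
Proof. by have := sqr_ge0 (x - y); lra. Qed.

(** Serves the case [rho < s], where the rate is [rho] and nothing is thresholded. The error is
    [2 * sigma * dot b z + sigma ^+ 2 * W z], a linear form and a centred quadratic one. *)
Lemma mse_dense : exists2 C : R, 0 <= C & forall (d : nat) (th : 'cV[R]_d)
  (a : 'I_d -> 'cV[R]_d) (sigma rho : R),
  (forall i, dotv (a i) (a i) = 1) -> 0 <= rho ->
  \sum_i \sum_j dotv (a i) (a j) ^+ 2 <= rho ^+ 2 ->
  forall t2, t2 = \sum_i th i 0 ^+ 2 ->
  (Ex (gaussP d) (fun z => (\sum_i ((th i 0 + sigma * dot (a i) z) ^+ 2 - sigma ^+ 2) - t2) ^+ 2)%R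
   <= (C * (sigma ^+ 2 * rho) * (sigma ^+ 2 * rho + t2))%:E)%E.
Proof.
have [C1 C10 HW] := @Ex_centered_sum_sq R.
exists (8 + 2 * (C1 * 81)); first by rewrite addr_ge0// mulr_ge0// mulr_ge0.
move=> d th a sigma rho aa rho0 frobS t2 t2E.
have t20 : 0 <= t2 by rewrite t2E; apply: sumr_ge0 => i _; exact: sqr_ge0.
pose b : 'cV[R]_d := \sum_i th i 0 *: a i.
have bE z : \sum_i th i 0 * dot (a i) z = dot b z.
  rewrite /dot /b; transitivity (\sum_i \sum_k th i 0 * (a i k 0 * tnth z k)).
    by apply: eq_bigr => i _; rewrite mulr_sumr.
  rewrite exchange_big; apply: eq_bigr => k _ /=; rewrite summxE mulr_suml.
  by apply: eq_bigr => i _; rewrite mxE mulrA.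
(* The variance of the linear term is the quadratic form of the covariance at [th]; Cauchy-Schwarz
   over pairs of indices bounds it by the Frobenius norm times [t2]. *)
have bb : dotv b b <= rho * t2.
  have E : dotv b b = \sum_i \sum_j dotv (a i) (a j) * (th i 0 * th j 0).
    rewrite /dotv /b; transitivity (\sum_k \sum_i \sum_j (a i k 0 * a j k 0) * (th i 0 * th j 0)).
      apply: eq_bigr => k _; rewrite !summxE big_distrlr /=; apply: eq_bigr => i _; apply: eq_bigr => j _.
      by rewrite !mxE mulrACA mulrC.
    rewrite exchange_big; apply: eq_bigr => i _; rewrite exchange_big; apply: eq_bigr => j _ /=.
    by rewrite mulr_suml.
  have h : dotv b b ^+ 2 <= (rho * t2) ^+ 2.
    rewrite E pair_big /=.
    apply: (le_trans (cauchy_schwarz_sum _ (fun p : 'I_d * 'I_d => dotv (a p.1) (a p.2)) (fun p => th p.1 0 * th p.2 0))).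
    rewrite exprMn; apply: ler_pM.
    - by apply: sumr_ge0 => i _; exact: sqr_ge0.
    - by apply: sumr_ge0 => i _; exact: sqr_ge0.
    - by move: frobS; rewrite pair_big.
    - rewrite expr2 t2E big_distrlr pair_big /=; apply: ler_sum => p _.
      by rewrite exprMn.
  have r0 : 0 <= rho * t2 by rewrite mulr_ge0.
  have b0 : 0 <= dotv b b by apply: sumr_ge0 => i _; rewrite -expr2 sqr_ge0.
  by move: h; rewrite ler_pXn2r ?nnegrE.
pose W z := \sum_(i | xpredT i) (dot (a i) z ^+ 2 - 1 * 1).
have ns : nnm (fun x : R => x ^+ 2) by exact/nnm_sqr/measurable_id.
have EW : (Ex (gaussP d) (fun z => W z ^+ 2)%R <= (C1 * 81 * rho ^+ 2)%:E)%E.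
  (* Here [g] is the square and [h] the constant 1, with weights 8 and 1; hence the factor
     [(8 + 1) ^+ 2 = 81]. *)
  have := HW d _ a xpredT (fun x => x ^+ 2) (fun=> 1) 8 1 1 1 ns (nnm_cst _ ler01).
  move=> /(_ (fun x => sqrrN x) (fun=> erefl) (ler0n _ 8) ler01 ler01).
  have b1 (x : R) : x ^+ 2 <= 8 * expR (x ^+ 2 / 8) by have := expR_ge1Dx (x ^+ 2 / 8); lra.
  have b2 (x : R) : 1 <= 1 * expR (x ^+ 2 / 8).
    by have := expR_ge1Dx (x ^+ 2 / 8); have := sqr_ge0 x; lra.
  have e1 : Ex stdR (fun x => x ^+ 2) = (1 * 1)%:E by rewrite mulr1 Ex_sq.
  move=> /(_ b1 b2 e1 (Ex_cst _ _) aa) /le_trans; apply.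
  rewrite lee_fin mulr1 (_ : 8 + 1 = 9 :> R); last by lra.
  rewrite (_ : 9 ^+ 2 = 81 :> R); last by lra.
  by apply: ler_wpM2l => //; rewrite mulr_ge0.
have mW : measurable_fun setT W.
  apply: measurable_sum => i; apply: measurable_funB => //; apply: measurable_funX; exact: measurable_dot.
have nW := nnm_sqr mW.
have nb := nnm_sqr (@measurable_dot R d b).
have k1 : 0 <= 8 * sigma ^+ 2 by rewrite mulr_ge0 ?sqr_ge0.
have k2 : 0 <= 2 * sigma ^+ 4 by rewrite mulr_ge0 ?exprn_even_ge0.
apply: (@le_trans _ _ (Ex (gaussP d) (fun z => 8 * sigma ^+ 2 * dot b z ^+ 2 + 2 * sigma ^+ 4 * W z ^+ 2)%R)).
  apply: Ex_le.
  - apply: nnm_sqr; apply: measurable_funB => //; apply: measurable_sum => i; apply: measurable_funB => //.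
    apply: measurable_funX; apply: measurable_funD => //; apply: measurable_funM => //; exact: measurable_dot.
  - by apply: nnmD; exact: nnmZ.
  move=> z; have -> : \sum_i ((th i 0 + sigma * dot (a i) z) ^+ 2 - sigma ^+ 2) - t2
     = 2 * sigma * dot b z + sigma ^+ 2 * W z.
    rewrite -bE /W t2E -sumrB !mulr_sumr -big_split /=; apply: eq_bigr => i _; ring.
  apply: (le_trans (sqr2_le _ _)); rewrite le_eqVlt; apply/orP; left; apply/eqP; ring.
rewrite ExD; [|exact: nnmZ|exact: nnmZ].
rewrite !ExZ// Ex_dot_sq -EFinM.
apply: (@le_trans _ _ ((8 * sigma ^+ 2 * dotv b b)%:E + (2 * sigma ^+ 4)%:E * (C1 * 81 * rho ^+ 2)%:E)%E).
  by apply: leeD2l; apply: lee_wpmul2l => //; rewrite lee_fin.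
rewrite -EFinM -EFinD lee_fin.
have h1 := ler_wpM2l k1 bb.
have X0 : 0 <= sigma ^+ 2 * rho by rewrite mulr_ge0 ?sqr_ge0.
have h2 : 0 <= C1 * 81 by rewrite mulr_ge0.
move: (C1 * 81) h2 => K K0.
have p1 : 0 <= K * (sigma ^+ 2 * rho) * t2 by apply: mulr_ge0 => //; apply: mulr_ge0.
have p2 : 0 <= (sigma ^+ 2 * rho) * (sigma ^+ 2 * rho) by rewrite mulr_ge0.
apply: (le_trans (lerD h1 (lexx _))).
rewrite -subr_ge0 (_ : _ - _ = 2 * (K * (sigma ^+ 2 * rho) * t2) + 8 * ((sigma ^+ 2 * rho) * (sigma ^+ 2 * rho))); last by ring.
by rewrite addr_ge0// mulr_ge0.
Qed.

End upper.

Section upper.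
Context {R : realType}.

Lemma ln_ge_half (x : R) : 2 <= x -> 2^-1 <= ln x.
Proof.
move=> x2; have x0 : 0 < x by lra.
rewrite -ler_expR lnK ?posrE//; apply: le_trans x2.
have := expR_ge1Dx (- 2^-1 : R); rewrite expRN => h.
have e0 := expR_gt0 (2^-1 : R).
have h2 : 2^-1 <= (expR (2^-1 : R))^-1 by lra.
by rewrite lef_pV2 ?posrE in h2.
Qed.

Lemma mse_sparse : exists2 C : R, 0 <= C & forall (d : nat) (th : 'cV[R]_d)
  (a : 'I_d -> 'cV[R]_d) (sigma rho : R) (s : nat),
  (forall i, dotv (a i) (a i) = 1) -> 0 < sigma -> (0 < s)%N -> s%:R <= rho -> (l0 th <= s)%N ->
  \sum_i \sum_j dotv (a i) (a j) ^+ 2 <= rho ^+ 2 ->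
  forall t2 ph, t2 = \sum_i th i 0 ^+ 2 -> ph = s%:R * ln (1 + rho ^+ 2 / s%:R ^+ 2) ->
  let t := tau s rho in
  (Ex (gaussP d) (fun z => (\sum_i ((th i 0 + sigma * dot (a i) z) ^+ 2 - sigma ^+ 2 * beta t) *
      (if sigma * t < `|th i 0 + sigma * dot (a i) z| then 1 else 0) - t2) ^+ 2)%R
   <= (C * (sigma ^+ 2 * ph) * (sigma ^+ 2 * ph + t2))%:E)%E.
Proof.
have [C1 C10 HW] := @Ex_centered_sum_sq R.
have [C0 C00 HB] := @beta_spec R.
(* [KA] comes from fourth moments on the support, [KB] from thresholding there, [KC] from the noise
   off the support. From [t ^+ 2 = 9 * L], [beta t <= 36 * L + C0] and [1 <= 2 * L] follow
   [t ^+ 2 + beta t <= (45 + 2 * C0) * L] and [16 + beta t <= (68 + 2 * C0) * L]. *)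
pose KA : R := 256 * K4; pose KB := (45 + 2 * C0) ^+ 2; pose KC := C1 * (68 + 2 * C0) ^+ 2.
have KA0 : 0 <= KA by rewrite mulr_ge0// (le_trans _ K4_ge1).
have KB0 : 0 <= KB by exact: sqr_ge0.
have KC0 : 0 <= KC by rewrite mulr_ge0 ?sqr_ge0.
exists (32 + 4 * KA + 4 * KB + 4 * KC).
  by apply: addr_ge0; [apply: addr_ge0; [apply: addr_ge0 => //|]|]; apply: mulr_ge0.
move=> d th a sigma rho s aa sigma0 s0 srho thS frobS t2 ph t2E phE.
set t := tau s rho; rewrite /=.
have sR : 1 <= s%:R :> R by rewrite ler1n.
have s0R : 0 < s%:R :> R by lra.
have rho0 : 0 < rho by lra.
set L := ln (1 + rho ^+ 2 / s%:R ^+ 2) in phE.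
have q1 : 1 <= rho ^+ 2 / s%:R ^+ 2.
  rewrite ler_pdivlMr ?exprn_gt0// mul1r; apply: lerXn2r => //; rewrite nnegrE ltW//.
have L2 : 2^-1 <= L by apply: ln_ge_half; lra.
have tE2 : t ^+ 2 = 9 * L.
  rewrite /t /tau -/L exprMn sqr_sqrtr; last by lra.
  by congr (_ * _); lra.
have t0 : 0 <= t by rewrite mulr_ge0 ?sqrtr_ge0.
have [m hE [gE b0 bC]] := HB t t0.
have eL : expR (- L) * rho ^+ 2 <= s%:R ^+ 2.
  rewrite expRN lnK ?posrE; last by lra.
  rewrite mulrC ler_pdivrMr; last by lra.
  rewrite mulrDr mulr1 mulrCA divff ?mulr1; last by rewrite gt_eqF// exprn_gt0.
  by rewrite lerDr sqr_ge0.
pose P i := th i 0 != 0.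
have cP : (\sum_(i | P i) 1 : R) <= s%:R.
  rewrite sumr_const ler_nat; apply: leq_trans thS; rewrite /l0; apply/eq_leq/eq_card => i.
  by apply/idP/idP => h; [apply: mem_set; exact: h|exact: set_mem h].
pose W z := \sum_(i | ~~ P i) (gtau t (dot (a i) z) - beta t * htau t (dot (a i) z)).
have EW : (Ex (gaussP d) (fun z => W z ^+ 2)%R <= (KC * ph ^+ 2)%:E)%E.
  set e := expR (- (t ^+ 2 / 16)).
  have e0 : 0 <= e by exact: expR_ge0.
  have e16 : 0 <= 16 * e by rewrite mulr_ge0.
  have := HW d _ a (fun i => ~~ P i) (gtau t) (htau t) (16 * e) e m (beta t) (nnm_gtau t) (nnm_htau t)
    (gtau_even t) (htau_even t) e16 e0 b0 (fun x => gtau_bound x t0) (fun x => htau_bound x t0) gE hE aa.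
  move=> /le_trans; apply; rewrite lee_fin.
  (* The exponent on the left is [9 / 8 * L]: this is what the factor 3 in [tau] buys. *)
  have ee : e ^+ 2 <= expR (- L).
    by rewrite /e tE2 expr2 -expRD ler_expR; lra.
  set Z := \sum_i \sum_j dotv (a i) (a j) ^+ 2 in frobS *.
  have Z0 : 0 <= Z by apply: sumr_ge0 => i _; apply: sumr_ge0 => j _; exact: sqr_ge0.
  have -> : C1 * (16 * e + beta t * e) ^+ 2 * Z = C1 * ((16 + beta t) ^+ 2 * (e ^+ 2 * Z)) by ring.
  have -> : KC * ph ^+ 2 = C1 * ((68 + 2 * C0) ^+ 2 * ph ^+ 2) by rewrite /KC; ring.
  apply: ler_wpM2l => //.
  have bb : 16 + beta t <= (68 + 2 * C0) * L.
    have : C0 * 1 <= C0 * (2 * L) by apply: ler_wpM2l => //; lra.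
    by rewrite tE2 in bC; lra.
  apply: (@le_trans _ _ (((68 + 2 * C0) * L) ^+ 2 * s%:R ^+ 2)); last first.
    by rewrite phE le_eqVlt; apply/orP; left; apply/eqP; ring.
  have w1 : (16 + beta t) ^+ 2 <= ((68 + 2 * C0) * L) ^+ 2.
    by apply: lerXn2r => //; rewrite nnegrE; lra.
  have w2 : e ^+ 2 * Z <= s%:R ^+ 2.
    by apply: le_trans eL; apply: (ler_pM (sqr_ge0 e) Z0 ee frobS).
  exact: (ler_pM (sqr_ge0 _) (mulr_ge0 (sqr_ge0 e) Z0) w1 w2).
have mD i : measurable_fun setT (dot (a i)) by exact: measurable_dot.
have mW : measurable_fun setT W.
  have mg i : measurable_fun setT (fun z => gtau t (dot (a i) z)) := (nnm_dot (a i) (nnm_gtau t)).1.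
  have mh i : measurable_fun setT (fun z => htau t (dot (a i) z)) := (nnm_dot (a i) (nnm_htau t)).1.
  rewrite (_ : W = fun z => \sum_i (if ~~ P i then gtau t (dot (a i) z) - beta t * htau t (dot (a i) z) else 0)); last first.
    by apply/funext => z; rewrite /W big_mkcond.
  apply: measurable_sum => i; case: (P i) => //=; apply: measurable_funB => //; exact: measurable_funM.
have nW := nnm_sqr mW.
have n2 i : nnm (fun z => dot (a i) z ^+ 2) := nnm_sqr (mD i).
have n4 i : nnm (fun z => (dot (a i) z ^+ 2) ^+ 2) := nnm_sqr (n2 i).1.
pose S2 z := \sum_(i | P i) dot (a i) z ^+ 2.
pose S4 z := \sum_(i | P i) (dot (a i) z ^+ 2) ^+ 2.
have nS2 : nnm S2 by exact: nnm_sum.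
have nS4 : nnm S4 by exact: nnm_sum.
have ES2 : (Ex (gaussP d) S2 <= s%:R%:E)%E.
  rewrite Ex_sum//; under eq_bigr do rewrite Ex_dot_sq aa.
  by rewrite sumEFin lee_fin.
have ES4 : (Ex (gaussP d) S4 <= (s%:R * (64 * K4))%:E)%E.
  rewrite Ex_sum//; apply: (@le_trans _ _ (\sum_(i | P i) (64 * K4)%:E)%E).
    by apply: lee_sum => i _; exact: Ex_dot_4.
  rewrite sumEFin lee_fin -[X in \sum_(_ | _) X]mul1r -mulr_suml.
  by apply: ler_wpM2r => //; rewrite mulr_ge0// (le_trans _ K4_ge1).
have t20 : 0 <= t2 by rewrite t2E; apply: sumr_ge0 => i _; exact: sqr_ge0.
pose M := sigma ^+ 2 * (t ^+ 2 + beta t).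
have M0 : 0 <= M by rewrite mulr_ge0 ?sqr_ge0// addr_ge0 ?sqr_ge0.
pose F z := 16 * sigma ^+ 2 * t2 * S2 z + (4 * sigma ^+ 4 * s%:R * S4 z + (4 * (s%:R * M) ^+ 2 + 4 * sigma ^+ 4 * W z ^+ 2)).
have s2 : 0 <= sigma ^+ 2 by exact: sqr_ge0.
have s4 : 0 <= sigma ^+ 4 by exact: exprn_even_ge0.
have k1 : 0 <= 16 * sigma ^+ 2 * t2 by apply: mulr_ge0 => //; apply: mulr_ge0.
have k2 : 0 <= 4 * sigma ^+ 4 * s%:R by apply: mulr_ge0; [apply: mulr_ge0|exact: ltW].
have k3 : 0 <= 4 * (s%:R * M) ^+ 2 by apply: mulr_ge0 => //; exact: sqr_ge0.
have k4 : 0 <= 4 * sigma ^+ 4 by apply: mulr_ge0.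
have nF1 := nnmZ k1 nS2; have nF2 := nnmZ k2 nS4; have nF3 := nnm_cst [the measurableType _ of d.-tuple R] k3; have nF4 := nnmZ k4 nW.
have nF34 := nnmD nF3 nF4; have nF234 := nnmD nF2 nF34.
apply: (@le_trans _ _ (Ex (gaussP d) F)).
  apply: Ex_le; [|exact: (nnmD nF1 nF234)|].
    apply: nnm_sqr; apply: measurable_funB => //; apply: measurable_sum => i.
    have mY : measurable_fun setT (fun z => th i 0 + sigma * dot (a i) z).
      by apply: measurable_funD => //; exact: measurable_funM.
    apply: measurable_funM.
      by apply: measurable_funB => //; exact: measurable_funX.
    apply: measurable_fun_ifT => //; apply: measurable_fun_ltr => //.
    exact: measurableT_comp.
  move=> z; rewrite /F.
  pose y i := th i 0 + sigma * dot (a i) z.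
  (* What is lost against [y i ^+ 2] on the support: the centring if the coordinate is kept, the
     whole square if it is cut, and then that square is at most [(sigma * t) ^+ 2]. *)
  pose er i := if sigma * t < `|y i| then sigma ^+ 2 * beta t else y i ^+ 2.
  have er0 i : 0 <= er i <= M.
    rewrite /er /M mulrDr; case: ltP => h.
      by rewrite mulr_ge0//= lerDr mulr_ge0 ?sqr_ge0.
    rewrite sqr_ge0 /= -[y i ^+ 2]real_normK ?num_real//.
    apply: (@le_trans _ _ (sigma ^+ 2 * t ^+ 2)); last by rewrite lerDl mulr_ge0.
    by rewrite -exprMn; apply: lerXn2r => //; rewrite nnegrE// mulr_ge0// ltW.
  pose X := \sum_(i | P i) th i 0 * dot (a i) z.
  pose Er := \sum_(i | P i) er i.
  have t2P : t2 = \sum_(i | P i) th i 0 ^+ 2.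
    rewrite t2E (bigID P) /= [X in _ + X]big1 ?addr0// => i.
    by rewrite negbK => /eqP ->; rewrite expr0n.
  have -> : \sum_i (y i ^+ 2 - sigma ^+ 2 * beta t) * (if sigma * t < `|y i| then 1 else 0) - t2
     = 2 * sigma * X + sigma ^+ 2 * S2 z - Er + sigma ^+ 2 * W z.
    rewrite (bigID P) /= addrAC t2P -sumrB; congr (_ + _).
      rewrite /X /S2 /Er !mulr_sumr -big_split -sumrB /=; apply: eq_bigr => i _.
      by rewrite /er /y; case: ifP => _; ring.
    rewrite /W mulr_sumr; apply: eq_bigr => i; rewrite negbK => /eqP thi.
    rewrite /y thi add0r /gtau /htau normrM [`|sigma|]gtr0_norm// ltr_pM2l//.
    by case: ifP => _; ring.
  have X2 : X ^+ 2 <= t2 * S2 z.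
    by rewrite t2P; apply: cauchy_schwarz_sum.
  have S22 : S2 z ^+ 2 <= s%:R * S4 z.
    have := cauchy_schwarz_sum P (fun=> 1) (fun i => dot (a i) z ^+ 2).
    under eq_bigr do rewrite mul1r.
    rewrite -/(S2 z) -/(S4 z); under eq_bigr do rewrite expr1n.
    by move/le_trans; apply; apply: ler_wpM2r => //; exact: nS4.2.
  have Er2 : Er ^+ 2 <= (s%:R * M) ^+ 2.
    have Er0 : 0 <= Er by apply: sumr_ge0 => i _; case/andP: (er0 i).
    apply: lerXn2r; rewrite ?nnegrE//; first by rewrite mulr_ge0// ltW.
    apply: (@le_trans _ _ (\sum_(i | P i) 1 * M)).
      by apply: ler_sum => i _; rewrite mul1r; case/andP: (er0 i).
    by rewrite -mulr_suml; apply: ler_wpM2r.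
  apply: (le_trans (sqr4_le _ _ _ _)).
  have h1 := ler_wpM2l s2 X2; have h2 := ler_wpM2l s4 S22.
  move: (S2 z) (S4 z) (W z) X2 S22 h1 h2 => u2 u4 w X2 S22 h1 h2.
  have -> : (2 * sigma * X) ^+ 2 = 4 * (sigma ^+ 2 * X ^+ 2) by ring.
  have -> : (sigma ^+ 2 * u2) ^+ 2 = sigma ^+ 4 * u2 ^+ 2 by ring.
  have -> : (sigma ^+ 2 * w) ^+ 2 = sigma ^+ 4 * w ^+ 2 by ring.
  move: (Er ^+ 2) ((s%:R * M) ^+ 2) Er2 (sigma ^+ 2 * X ^+ 2) (sigma ^+ 4 * u2 ^+ 2) h1 h2.
  by clear => A B AB E G h1 h2; lra.
have phs : s%:R <= 2 * ph.
  by rewrite phE; have := ler_wpM2l (ltW s0R) L2; clear; lra.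
have ph0 : 0 <= ph by clear - phs s0R; lra.
rewrite (ExD _ nF1 nF234) (ExD _ nF2 nF34) (ExD _ nF3 nF4) Ex_cst !ExZ//.
apply: (@le_trans _ _ ((16 * sigma ^+ 2 * t2)%:E * s%:R%:E + ((4 * sigma ^+ 4 * s%:R)%:E * (s%:R * (64 * K4))%:E
   + ((4 * (s%:R * M) ^+ 2)%:E + (4 * sigma ^+ 4)%:E * (KC * ph ^+ 2)%:E)))%E).
  apply: leeD; first by apply: lee_wpmul2l => //; rewrite lee_fin.
  apply: leeD; first by apply: lee_wpmul2l => //; rewrite lee_fin.
  by apply: leeD2l; apply: lee_wpmul2l => //; rewrite lee_fin.
rewrite -!EFinM -!EFinD lee_fin.
have b1 : 16 * sigma ^+ 2 * t2 * s%:R <= 32 * (sigma ^+ 2 * ph * t2).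
  have := ler_wpM2l k1 phs; clear; lra.
have b2 : 4 * sigma ^+ 4 * s%:R * (s%:R * (64 * K4)) <= 4 * KA * (sigma ^+ 2 * ph) ^+ 2.
  have ss : s%:R * s%:R <= 2 * ph * (2 * ph) by apply: ler_pM => //; exact: ltW.
  have kk : 0 <= sigma ^+ 4 * KA by apply: mulr_ge0.
  have := ler_wpM2l kk ss; rewrite /KA; move: (K4 : R) => k; clear; lra.
have b3 : 4 * (s%:R * M) ^+ 2 <= 4 * KB * (sigma ^+ 2 * ph) ^+ 2.
  have : s%:R * M <= (45 + 2 * C0) * (sigma ^+ 2 * ph).
    have cL : C0 * 1 <= C0 * (2 * L) by apply: ler_wpM2l => //; lra.
    have : t ^+ 2 + beta t <= (45 + 2 * C0) * L by rewrite tE2 in bC *; lra.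
    move=> /(ler_wpM2l (mulr_ge0 (ltW s0R) s2)); rewrite /M phE; clear; lra.
  move=> h; rewrite -mulrA ler_wpM2l// /KB -exprMn; apply: lerXn2r => //; rewrite nnegrE.
    by apply: mulr_ge0 => //; exact: ltW.
  by apply: le_trans h; apply: mulr_ge0 => //; exact: ltW.
have b4 : 4 * sigma ^+ 4 * (KC * ph ^+ 2) = 4 * KC * (sigma ^+ 2 * ph) ^+ 2 by ring.
have A0 : 0 <= sigma ^+ 2 * ph by apply: mulr_ge0.
move: (4 * sigma ^+ 4 * (KC * ph ^+ 2)) b4 => x4 ->.
move: (4 * (s%:R * M) ^+ 2) b3 => x3 b3.
move: (4 * sigma ^+ 4 * s%:R * (s%:R * (64 * K4))) b2 => x2 b2.
move: (16 * sigma ^+ 2 * t2 * s%:R) b1 => x1 b1.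
move: (sigma ^+ 2 * ph) A0 b1 b2 b3 => A A0 b1 b2 b3.
have p1 : 0 <= KA * A * t2 by apply: mulr_ge0 => //; apply: mulr_ge0.
have p2 : 0 <= KB * A * t2 by apply: mulr_ge0 => //; apply: mulr_ge0.
have p3 : 0 <= KC * A * t2 by apply: mulr_ge0 => //; apply: mulr_ge0.
have p4 : 0 <= A * A by apply: mulr_ge0.
move: KA KB KC p1 p2 p3 b2 b3 {KA0 KB0 KC0 EW} => ka kb kc p1 p2 p3 b2 b3.
by clear - b1 b2 b3 p1 p2 p3 p4; lra.
Qed.

End upper.

(** * Lower bound *)

Section blocks.
Context {R : realType}.

Lemma sum_inj (P I : finType) (f : P -> I) (G : I -> R) : injective f ->
  (forall i, (forall p, f p != i) -> G i = 0) -> \sum_i G i = \sum_p G (f p).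
Proof.
move=> finj G0.
transitivity (\sum_i \sum_(p | f p == i) G i).
  apply: eq_bigr => i _; case: (pickP (fun p => f p == i)) => [p /eqP fp|no].
    rewrite (big_pred1 p)// => p' /=; rewrite -fp; exact: inj_eq.
  by rewrite big_pred0// G0// => p; rewrite no.
rewrite (exchange_big_dep predT)//=; apply: eq_bigr => p _.
by rewrite (big_pred1 (f p))// => i /=; rewrite eq_sym.
Qed.

Context (d m q k : nat) (qkm : (q * k * m <= d)%N) (m0 : (0 < m)%N).

Let B := ('I_q * 'I_k)%type.
Let P := (B * 'I_m)%type.

Lemma block_card : (#|{: P}| <= d)%N.
Proof. by rewrite !card_prod !card_ord. Qed.

Definition block_inj (p : P) : 'I_d := widen_ord block_card (enum_rank p).

Lemma block_injP : injective block_inj.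
Proof. by move=> p p' /(congr1 val) /= /val_inj /enum_rank_inj. Qed.

(** Labels the classes of perfectly correlated coordinates: those of a block share its label, and
    every leftover coordinate is alone in its class. Leftovers thus need no separate treatment in
    [Sblock]. *)
Definition key (i : 'I_d) : B + 'I_d :=
  if [pick p | block_inj p == i] is Some p then inl p.1 else inr i.

Lemma key_block p : key (block_inj p) = inl p.1.
Proof.
rewrite /key; case: pickP => [p' /eqP /block_injP ->//|/(_ p)]; by rewrite eqxx.
Qed.

Lemma key_inr i : (forall p, block_inj p != i) -> key i = inr i.
Proof. by rewrite /key; case: pickP => // p pi /(_ p); rewrite pi. Qed.

Lemma key_inr_inj i j : key j = inr i -> j = i.
Proof. by rewrite /key; case: pickP => // _ [->]. Qed.

Lemma sum_key (F : B + 'I_d -> R) : (forall i, F (inr i) = 0) ->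
  \sum_i F (key i) = m%:R * \sum_b F (inl b).
Proof.
move=> F0; rewrite (sum_inj block_injP); last by move=> i /key_inr ->; rewrite F0.
transitivity (\sum_(b : B) \sum_(l < m) F (inl b)).
  by rewrite pair_big /=; apply: eq_bigr => -[b l] _; rewrite key_block.
by rewrite mulr_sumr; apply: eq_bigr => b _; rewrite sumr_const card_ord mulr_natl.
Qed.

(* Coordinates sharing a block of size [m] are perfectly correlated; the [q] groups of
   [k] blocks carry the random support [c], which picks one block per group. *)
Definition Sblock : 'M[R]_d := \matrix_(i, j) (key i == key j)%:R.

(** The quadratic form is the sum over labels of the square of the sum of the coordinates carrying
    that label. *)
Lemma Sblock_cov : is_cov Sblock.
Proof.
split; first by apply/matrixP => i j; rewrite !mxE eq_sym.
move=> x.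
have -> : (x^T *m Sblock *m x) 0 0 = \sum_(b : B + 'I_d) (\sum_i (key i == b)%:R * x i 0) ^+ 2.
  transitivity (\sum_j \sum_i \sum_b (key i == b)%:R * (key j == b)%:R * (x i 0 * x j 0)).
    rewrite mxE; apply: eq_bigr => j _; rewrite mxE mulr_suml; apply: eq_bigr => i _.
    rewrite !mxE (bigD1 (key i))//= big1; last first.
      by move=> b /negPf bk; rewrite eq_sym bk !mul0r.
    by rewrite eqxx addr0 mul1r eq_sym; ring.
  under eq_bigr do rewrite exchange_big /=.
  rewrite exchange_big /=; apply: eq_bigr => b _; rewrite expr2 big_distrlr /=.
  by rewrite exchange_big /=; apply: eq_bigr => i _; apply: eq_bigr => j _; ring.
by apply: sumr_ge0 => b _; exact: sqr_ge0.
Qed.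

Lemma Sblock_diag i : Sblock i i = 1.
Proof. by rewrite mxE eqxx. Qed.

Lemma block_size b : \sum_j (inl b == key j)%:R = m%:R :> R.
Proof.
rewrite (@sum_key (fun t => (inl b == t)%:R))//.
rewrite (bigD1 b)//= eqxx big1 ?addr0 ?mulr1// => b' bb'.
by rewrite (_ : (inl b == inl b') = (b == b'))// eq_sym (negPf bb').
Qed.

Lemma Sblock_frob : \sum_i \sum_j Sblock i j ^+ 2 <= d%:R + (m%:R - 1) * (m * q * k)%:R.
Proof.
pose F (t : B + 'I_d) : R := if t is inl _ then m%:R - 1 else 0.
have row i : \sum_j Sblock i j ^+ 2 = 1 + F (key i).
  transitivity (\sum_j (key i == key j)%:R : R).
    by apply: eq_bigr => j _; rewrite mxE; case: (_ == _); rewrite ?expr1n ?expr0n.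
  case ki: (key i) => [b|i'] /=; first by rewrite block_size addrC subrK.
  have ? := key_inr_inj ki; subst i'.
  rewrite (bigD1 i)//= ki eqxx big1 ?addr0// => j ji.
  case: eqP => // e; have := key_inr_inj (esym e) => ij.
  by rewrite ij eqxx in ji.
under eq_bigr do rewrite row.
rewrite big_split /= sumr_const card_ord sum_key//= lerD2l.
rewrite sumr_const card_prod !card_ord -[_ *+ (q * k)]mulr_natr -mulnA [(m * _)%:R]natrM.
by rewrite mulrCA.
Qed.

Definition fsel (c : {ffun 'I_q -> 'I_k}) (t : B + 'I_d) : R :=
  if t is inl b then (c b.1 == b.2)%:R else 0.

Definition thsel (a : R) (c : {ffun 'I_q -> 'I_k}) : 'cV[R]_d := \col_i (a * fsel c (key i)).

Lemma Sblock_thsel a c : Sblock *m thsel a c = m%:R *: thsel a c.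
Proof.
apply/colP => i; rewrite !mxE.
transitivity (\sum_j (key i == key j)%:R * (a * fsel c (key i))).
  by apply: eq_bigr => j _; rewrite !mxE; case: eqP => [->//|_]; rewrite !mul0r.
rewrite -mulr_suml; case: (key i) => [b|i'] /=; first by rewrite block_size.
by rewrite !mulr0.
Qed.

Lemma thsel_dot a c c' : dotv (thsel a c) (thsel a c') = a ^+ 2 * m%:R * \sum_g (c g == c' g)%:R.
Proof.
rewrite /dotv.
transitivity (\sum_i a ^+ 2 * (fsel c (key i) * fsel c' (key i))).
  by apply: eq_bigr => i _; rewrite !mxE; ring.
rewrite -mulr_sumr (@sum_key (fun t => fsel c t * fsel c' t)); last by move=> i; rewrite mul0r.
rewrite mulrA; congr (_ * _); rewrite -(pair_big predT predT (fun g j => (c g == j)%:R * (c' g == j)%:R)) /=.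
apply: eq_bigr => g _; rewrite (bigD1 (c g))//= eqxx mul1r big1 ?addr0; first by rewrite eq_sym.
by move=> j; rewrite eq_sym => /negPf ->; rewrite mul0r.
Qed.

Lemma thsel_norm a c : dotv (thsel a c) (thsel a c) = a ^+ 2 * (m * q)%:R.
Proof.
rewrite thsel_dot natrM mulrA; congr (_ * _).
under eq_bigr do rewrite eqxx.
by rewrite sumr_const card_ord.
Qed.

Lemma thsel_l0 a c : (l0 (thsel a c) <= m * q)%N.
Proof.
rewrite -(ler_nat R).
apply: (@le_trans _ _ (\sum_i fsel c (key i))).
  rewrite /l0 -sum1_card natr_sum big_mkcond /=; apply: ler_sum => i _.
  have f0 : 0 <= fsel c (key i) by case: (key i) => //= b; exact: ler0n.
  case: ifP => // /set_mem /=; rewrite mxE.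
  case: (key i) => [b|i'] /=; last by rewrite mulr0 eqxx.
  by case: (c b.1 == b.2) => //=; rewrite mulr0 eqxx.
rewrite (@sum_key (fsel c))// natrM; apply: ler_wpM2l => //.
rewrite -(pair_big predT predT (fun g j => (c g == j)%:R : R)) /=.
rewrite (eq_bigr (fun=> 1)); first by rewrite sumr_const card_ord.
move=> g _; rewrite (bigD1 (c g))//= eqxx big1 ?addr0//.
by move=> j; rewrite eq_sym => /negPf ->.
Qed.

End blocks.

(** * Testing the origin against a mixture of shifts *)

Section two_points.
Context {R : realType}.

(** Likelihood ratio of the standard Gaussian law shifted by [u] against the unshifted one. *)
Definition lik n (u : 'cV[R]_n) (z : n.-tuple R) : R := expR (dot u z - dotv u u / 2).

Lemma nnm_lik n (u : 'cV[R]_n) : nnm (lik u).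
Proof. by apply: nnm_exp; apply: measurable_funB => //; exact: measurable_dot. Qed.

Lemma Ex_lik_shift n (u : 'cV[R]_n) (F : n.-tuple R -> R) : nnm F ->
  Ex (gaussP n) (fun z => F (addt z u)) = Ex (gaussP n) (fun z => F z * lik u z).
Proof.
move=> [mF F0]; rewrite /Ex (@cameron_martin R n u (fun z => (F z)%:E))//.
exact/measurable_EFinP.
Qed.

Lemma Ex_lik n (u : 'cV[R]_n) : Ex (gaussP n) (lik u) = 1%E.
Proof.
have := Ex_lik_shift u (nnm_cst [the measurableType _ of n.-tuple R] (@ler01 R)).
rewrite Ex_cst => ->; by apply: eq_Ex => z; rewrite mul1r.
Qed.

Lemma dotvDl n (u v w : 'cV[R]_n) : dotv (u + v) w = dotv u w + dotv v w.
Proof. by rewrite /dotv -big_split /=; apply: eq_bigr => i _; rewrite mxE mulrDl. Qed.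

Lemma dotvC n (u v : 'cV[R]_n) : dotv u v = dotv v u.
Proof. by apply: eq_bigr => i _; rewrite mulrC. Qed.

Lemma Ex_likM n (u v : 'cV[R]_n) :
  Ex (gaussP n) (fun z => lik u z * lik v z) = (expR (dotv u v))%:E.
Proof.
have E z : lik u z * lik v z = expR (dotv u v) * lik (u + v) z.
  rewrite /lik -!expRD; congr expR.
  have -> : dot (u + v) z = dot u z + dot v z.
    by rewrite /dot -big_split /=; apply: eq_bigr => i _; rewrite mxE mulrDl.
  rewrite dotvDl ![dotv _ (u + v)]dotvC !dotvDl [dotv v u]dotvC.
  by field.
rewrite (eq_Ex _ E) ExZ ?expR_ge0//; last exact: nnm_lik.
by rewrite Ex_lik mule1.
Qed.

(** With [l = L / n], the minimum over [t] of [t ^+ 2 + (t - r) ^+ 2 * l] is [r ^+ 2 * l / (1 + l)],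
    which lies above the parabola [r ^+ 2 * (3 * l - l ^+ 2) / 4], touching it at [l = 1]. Only the
    first two moments of the likelihood ratio are then needed. *)
Lemma two_point_pointwise (n L t r : R) : 0 < n -> 0 <= L ->
  3 * r ^+ 2 / 4 * L <= n * t ^+ 2 + (t - r) ^+ 2 * L + r ^+ 2 / (4 * n) * L ^+ 2.
Proof.
move=> n0 L0; set l := L / n.
have l0 : 0 <= l by rewrite divr_ge0// ltW.
have LE : L = n * l by rewrite /l mulrCA divff ?mulr1// gt_eqF.
have -> : r ^+ 2 / (4 * n) * L ^+ 2 = n * (r ^+ 2 / 4 * l ^+ 2) by rewrite LE; field; rewrite gt_eqF.
rewrite LE; have key : 3 * r ^+ 2 / 4 * l <= t ^+ 2 + (t - r) ^+ 2 * l + r ^+ 2 / 4 * l ^+ 2.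
  have l1 : 0 < 1 + l by lra.
  rewrite -(ler_pM2l l1) -subr_ge0.
  have -> : (1 + l) * (t ^+ 2 + (t - r) ^+ 2 * l + r ^+ 2 / 4 * l ^+ 2) - (1 + l) * (3 * r ^+ 2 / 4 * l)
    = ((1 + l) * t - r * l) ^+ 2 + r ^+ 2 * l / 4 * (l - 1) ^+ 2 by field.
  by rewrite addr_ge0 ?sqr_ge0// mulr_ge0 ?sqr_ge0// divr_ge0// mulr_ge0 ?sqr_ge0.
have := ler_wpM2l (ltW n0) key; lra.
Qed.

(** Taking expectations in [two_point_pointwise] and dividing by the number of shifts gives
    [3 / 4 * r ^+ 2 <= 2 * M + r ^+ 2 / 2], the last term being the second moment bound 2 times
    [r ^+ 2 / 4]. *)
Lemma two_point_bound n (J : finType) (u : J -> 'cV[R]_n) (T : n.-tuple R -> R) (r M : R) :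
  measurable_fun setT T -> (0 < #|J|)%N ->
  \sum_c \sum_c' expR (dotv (u c) (u c')) <= 2 * #|J|%:R ^+ 2 ->
  (Ex (gaussP n) (fun z => T z ^+ 2)%R <= M%:E)%E ->
  (forall c, Ex (gaussP n) (fun z => (T z - r) ^+ 2 * lik (u c) z)%R <= M%:E)%E ->
  r ^+ 2 / 8 <= M.
Proof.
move=> mT J0 h2 h0 hc.
pose N : R := #|J|%:R.
have N0 : 0 < N by rewrite ltr0n.
pose L z := \sum_c lik (u c) z.
have nl c : nnm (lik (u c)) by exact: nnm_lik.
have nL : nnm L by exact: nnm_sum.
have nT2 : nnm (fun z => T z ^+ 2) by exact: nnm_sqr.
have nTr : nnm (fun z => (T z - r) ^+ 2) by apply: nnm_sqr; exact: measurable_funB.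
have r2 : 0 <= r ^+ 2 by exact: sqr_ge0.
have k1 : 0 <= 3 * r ^+ 2 / 4 by rewrite divr_ge0// mulr_ge0.
have k2 : 0 <= r ^+ 2 / (4 * N) by rewrite divr_ge0// mulr_ge0// ltW.
have EL : Ex (gaussP n) L = N%:E.
  rewrite Ex_sum//; under eq_bigr do rewrite Ex_lik.
  by rewrite sumEFin sumr_const.
have nL2 : nnm (fun z => L z ^+ 2) by apply: nnm_sqr; exact: nL.1.
have EL2 : (Ex (gaussP n) (fun z => L z ^+ 2)%R <= (2 * N ^+ 2)%:E)%E.
  apply: (@le_trans _ _ (\sum_c \sum_c' expR (dotv (u c) (u c')))%:E); last by rewrite lee_fin; exact: h2.
  rewrite (eq_Ex _ (fun z => expr2 (L z))).
  have LE z : L z * L z = \sum_c \sum_c' lik (u c) z * lik (u c') z by rewrite /L big_distrlr.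
  rewrite (eq_Ex _ LE).
  rewrite Ex_sum; last by move=> c; apply: nnm_sum => c'; exact: nnmM.
  rewrite -sumEFin; apply: lee_sum => c _; rewrite Ex_sum; last by move=> c'; exact: nnmM.
  by rewrite -sumEFin; apply: lee_sum => c' _; rewrite Ex_likM.
have nA := nnmZ (ltW N0) nT2; have nB := nnmM nTr nL; have nC := nnmZ k2 nL2.
have nAB := nnmD nA nB.
have EB : (Ex (gaussP n) (fun z => (T z - r) ^+ 2 * L z)%R <= (N * M)%:E)%E.
  have LE z : (T z - r) ^+ 2 * L z = \sum_c (T z - r) ^+ 2 * lik (u c) z by rewrite /L mulr_sumr.
  rewrite (eq_Ex _ LE).
  rewrite Ex_sum; last by move=> c; exact: nnmM.
  apply: (@le_trans _ _ (\sum_(c : J) M%:E)%E); first by apply: lee_sum => c _; exact: hc.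
  by rewrite sumEFin sumr_const lee_fin -mulr_natl.
have : (Ex (gaussP n) (fun z => 3 * r ^+ 2 / 4 * L z)%R <=
    Ex (gaussP n) (fun z => N * T z ^+ 2 + (T z - r) ^+ 2 * L z + r ^+ 2 / (4 * N) * L z ^+ 2)%R)%E.
  apply: Ex_le; [exact: nnmZ|exact: nnmD|].
  by move=> z; apply: two_point_pointwise => //; exact: nL.2.
rewrite (ExD _ nAB nC) (ExD _ nA nB) !ExZ ?(ltW N0)// EL -EFinM => h.
have : ((3 * r ^+ 2 / 4 * N)%:E <= (N * M + N * M + r ^+ 2 / (4 * N) * (2 * N ^+ 2))%:E)%E.
  apply: (le_trans h); rewrite !EFinD; apply: leeD; first apply: leeD => //.
    by rewrite EFinM; apply: lee_wpmul2l => //; rewrite lee_fin ltW.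
  by rewrite (EFinM (r ^+ 2 / (4 * N))); apply: lee_wpmul2l => //; rewrite lee_fin.
rewrite lee_fin (_ : r ^+ 2 / (4 * N) * (2 * N ^+ 2) = N * (r ^+ 2 / 2)); last by field; rewrite gt_eqF.
rewrite [leLHS]mulrC -!mulrDr ler_pM2l//; lra.
Qed.

(** The groups choose independently, so the average factorises into [q] factors
    [1 + (expR lam - 1) / k]. The value of [lam] makes each equal to [1 + 1 / (2 * q)], and the
    product is at most [expR 2^-1 <= 2]. *)
Lemma selection_moment (q k : nat) (lam : R) : (0 < q)%N -> (0 < k)%N ->
  expR lam = 1 + k%:R / (2 * q%:R) ->
  \sum_(c : {ffun 'I_q -> 'I_k}) \sum_(c' : {ffun 'I_q -> 'I_k})
     expR (lam * \sum_g (c g == c' g)%:R) <= 2 * #|{ffun 'I_q -> 'I_k}|%:R ^+ 2.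
Proof.
move=> q0 k0 lE.
have q0R : 0 < q%:R :> R by rewrite ltr0n.
have k0R : 0 < k%:R :> R by rewrite ltr0n.
have in1 (c : {ffun 'I_q -> 'I_k}) : \sum_(c' : {ffun 'I_q -> 'I_k})
     expR (lam * \sum_g (c g == c' g)%:R) = (expR lam + k%:R - 1) ^+ q.
  transitivity (\sum_(c' : {ffun 'I_q -> 'I_k}) \prod_g expR (lam * (c g == c' g)%:R)).
    by apply: eq_bigr => c' _; rewrite mulr_sumr expR_sum.
  rewrite -(bigA_distr_bigA (fun g j => expR (lam * (c g == j)%:R))) /=.
  rewrite (eq_bigr (fun=> expR lam + k%:R - 1)); first by rewrite prodr_const card_ord.
  move=> g _; rewrite (bigD1 (c g))//= eqxx mulr1 -addrA; congr (_ + _).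
  rewrite (eq_bigr (fun=> 1)); last by move=> j; rewrite eq_sym => /negPf ->; rewrite mulr0 expR0.
  rewrite sumr_const cardC1 card_ord -subn1 natrB//.
under eq_bigr do rewrite in1.
rewrite sumr_const card_ffun !card_ord -[_ *+ (k ^ q)]mulr_natl.
have -> : (expR lam + k%:R - 1) ^+ q = (k ^ q)%:R * (1 + (2 * q%:R)^-1) ^+ q.
  rewrite natrX -exprMn; congr (_ ^+ _); rewrite lE; field; rewrite gt_eqF//.
rewrite mulrA -expr2 mulrC ler_wpM2r ?sqr_ge0//.
have h : 1 + (2 * q%:R)^-1 <= expR ((2 * q%:R)^-1 : R) by exact: expR_ge1Dx.
have i0 : 0 <= (2 * q%:R)^-1 :> R by rewrite invr_ge0 mulr_ge0.
apply: (@le_trans _ _ (expR ((2 * q%:R)^-1 : R) ^+ q)).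
  by apply: lerXn2r => //; rewrite nnegrE ?expR_ge0// addr_ge0.
have -> : expR ((2 * q%:R)^-1 : R) ^+ q = expR 2^-1.
  by rewrite -expRM_natl; congr expR; field; rewrite gt_eqF.
have := expR_ge1Dx (- 2^-1 : R); rewrite expRN => h2.
have e0 := expR_gt0 (2^-1 : R).
have h3 : 2^-1 <= (expR (2^-1 : R))^-1 by lra.
by rewrite lef_pV2 ?posrE in h3.
Qed.

End two_points.

(** * Lower bound on the maximal risk *)

Section lower.
Context {R : realType}.

Lemma dotv_adj n d (A : 'M[R]_(d, n)) x y : dotv (A^T *m x) y = dotv x (A *m y).
Proof.
rewrite /dotv; transitivity (\sum_i \sum_j A j i * x j 0 * y i 0).
  apply: eq_bigr => i _; rewrite mxE mulr_suml; apply: eq_bigr => j _; by rewrite mxE.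
rewrite exchange_big; apply: eq_bigr => j _ /=; rewrite mxE mulr_sumr.
by apply: eq_bigr => i _; ring.
Qed.

Lemma dotvZl n (t : R) (x y : 'cV[R]_n) : dotv (t *: x) y = t * dotv x y.
Proof. by rewrite /dotv mulr_sumr; apply: eq_bigr => i _; rewrite mxE mulrA. Qed.

Lemma dotvZr n (t : R) (x y : 'cV[R]_n) : dotv x (t *: y) = t * dotv x y.
Proof. by rewrite dotvC dotvZl dotvC. Qed.

Lemma norm2E n (v : 'cV[R]_n) : norm2 v = Num.sqrt (dotv v v).
Proof. by congr Num.sqrt; apply: eq_bigr => i _; rewrite expr2. Qed.

Lemma colt_addt n (z : n.-tuple R) u : colt (addt z u) = colt z + u.
Proof. by apply/colP => i; rewrite !mxE tnth_mktuple. Qed.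

Lemma model_coord d (th : 'cV[R]_d) (sigma : R) (A : 'M[R]_d) z i :
  (th + sigma *: (A *m colt z)) i 0 = th i 0 + sigma * dot (rowv A i) z.
Proof. by rewrite mxE [X in _ + X]mxE mulmx_colt. Qed.

Lemma measurable_model d (T : 'cV[R]_d -> R) (th : 'cV[R]_d) (sigma : R) (A : 'M[R]_d) : estimator T ->
  measurable_fun setT (fun z : d.-tuple R => T (th + sigma *: (A *m colt z))).
Proof.
move=> eT.
pose w (z : d.-tuple R) : d.-tuple R := [tuple (th + sigma *: (A *m colt z)) i 0 | i < d].
have -> : (fun z : d.-tuple R => T (th + sigma *: (A *m colt z))) = (fun z => T (colt z)) \o w.
  by apply/funext => z /=; congr T; apply/colP => i; rewrite [RHS]mxE tnth_mktuple.
apply: measurableT_comp => //; apply/measurable_fun_tnthP => i.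
rewrite (_ : _ \o _ = fun z => th i 0 + sigma * dot (rowv A i) z).
  by apply: measurable_funD => //; apply: measurable_funM => //; exact: measurable_dot.
by apply/funext => z /=; rewrite tnth_mktuple model_coord.
Qed.

Lemma riskE d (T : 'cV[R]_d -> R) (th : 'cV[R]_d) (S : 'M[R]_d) (sigma : R) :
  measurable_fun setT (fun z : d.-tuple R => T (th + sigma *: (cov_sqrt S *m colt z))) ->
  risk sigma T th S =
  Ex (gaussP d) (fun z => (T (th + sigma *: (cov_sqrt S *m colt z)) - norm2 th) ^+ 2).
Proof.
move=> mT; rewrite /risk /model_expect gauss_intE//.
  by apply/measurable_EFinP; apply: measurable_funX; exact: measurable_funB.
by move=> z; rewrite lee_fin sqr_ge0.
Qed.

Lemma frob_le d (S : 'M[R]_d) (rho : R) : 0 <= rho ->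
  \sum_i \sum_j S i j ^+ 2 <= rho ^+ 2 -> frob S <= rho.
Proof.
move=> rho0 h; rewrite /frob -(ger0_norm rho0) -sqrtr_sqr ler_sqrt//.
exact: sqr_ge0.
Qed.

(* As [Sblock *m th = m *: th], the signal [th c] is the Cameron-Martin shift by
   [u c], although [Sblock] is singular. *)
Lemma lower_block (d s m q k : nat) (rho sigma : R) (T : 'cV[R]_d -> R) :
  (0 < m)%N -> (0 < q)%N -> (0 < k)%N -> (m * q <= s)%N -> (q * k * m <= d)%N ->
  d%:R + (m%:R - 1) * (m * q * k)%:R <= rho ^+ 2 -> 0 <= rho -> 0 < sigma -> estimator T ->
  ((sigma ^+ 2 * (m * q)%:R * ln (1 + k%:R / (2 * q%:R)) / 8)%:E <= max_risk s rho sigma T)%E.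
Proof.
move=> m0 q0 k0 mqs qkm hF rho0 sigma0 eT.
have q0R : 0 < q%:R :> R by rewrite ltr0n.
have k0R : 0 < k%:R :> R by rewrite ltr0n.
have m0R : 0 < m%:R :> R by rewrite ltr0n.
have w0 : 0 < k%:R / (2 * q%:R) :> R by rewrite divr_gt0// mulr_gt0.
set lam := ln _.
have lE : expR lam = 1 + k%:R / (2 * q%:R) by rewrite lnK// posrE addr_gt0.
have lam0 : 0 <= lam by apply: ln_ge0; rewrite lerDl ltW.
(* The amplitude for which the shifts satisfy [dotv (u c) (u c') = lam * overlap], as
   [selection_moment] needs. *)
pose a := sigma * Num.sqrt lam.
have a2 : a ^+ 2 = sigma ^+ 2 * lam by rewrite exprMn sqr_sqrtr.
pose S := Sblock (R := R) qkm.
have covS : is_cov S by exact: Sblock_cov.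
have AE := cov_sqrtP covS; set A := cov_sqrt S in AE.
have frS : frob S <= rho.
  by apply: frob_le => //; apply: le_trans hF; exact: Sblock_frob.
have inTh th : (l0 th <= s)%N -> Theta s rho th S.
  by move=> l; split=> //; split=> //; split => // i; exact: Sblock_diag.
have sup th : (l0 th <= s)%N -> (risk sigma T th S <= max_risk s rho sigma T)%E.
  by move=> l; apply: ereal_sup_ubound; exists th, S; split => //; exact: inTh.
pose J : finType := {ffun 'I_q -> 'I_k}.
pose th (c : J) := thsel qkm a c.
pose u (c : J) : 'cV[R]_d := (sigma * m%:R)^-1 *: (A^T *m th c).
pose r := Num.sqrt (a ^+ 2 * (m * q)%:R).
have rE c : norm2 (th c) = r by rewrite norm2E thsel_norm.
have r2 : r ^+ 2 = sigma ^+ 2 * (m * q)%:R * lam.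
  by rewrite /r sqr_sqrtr; [rewrite a2; ring|rewrite mulr_ge0 ?sqr_ge0].
pose T' (z : d.-tuple R) := T (sigma *: (A *m colt z)).
have mT' : measurable_fun setT T'.
  have := measurable_model 0 sigma A eT; under eq_fun do rewrite add0r; exact.
have shift c z : th c + sigma *: (A *m colt z) = sigma *: (A *m colt (addt z (u c))).
  rewrite colt_addt mulmxDr scalerDr addrC; congr (_ + _).
  rewrite /u -scalemxAr mulmxA AE Sblock_thsel !scalerA.
  have -> : sigma / (sigma * m%:R) * m%:R = 1 by field; rewrite !gt_eqF.
  by rewrite scale1r.
have uu c c' : dotv (u c) (u c') = lam * \sum_g (c g == c' g)%:R.
  rewrite /u dotvZl dotvZr dotv_adj mulmxA AE Sblock_thsel dotvZr thsel_dot a2.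
  by field; rewrite !gt_eqF.
have th0 : (l0 (0 : 'cV[R]_d) <= s)%N.
  rewrite /l0 eq_card0// => i; apply/negbTE/negP => /set_mem /=; by rewrite mxE eqxx.
have R0 : risk sigma T 0 S = Ex (gaussP d) (fun z => T' z ^+ 2).
  rewrite riskE; last exact: measurable_model.
  apply: eq_Ex => z; rewrite add0r norm2E (_ : dotv 0 0 = 0) ?sqrtr0 ?subr0//.
  by rewrite /dotv big1// => i _; rewrite mxE mul0r.
have Rc c : risk sigma T (th c) S = Ex (gaussP d) (fun z => (T' z - r) ^+ 2 * lik (u c) z).
  rewrite riskE; last exact: measurable_model.
  rewrite -(@Ex_lik_shift R d (u c) (fun z => (T' z - r) ^+ 2)).
    by apply: eq_Ex => z; rewrite rE shift.
  by apply: nnm_sqr; exact: measurable_funB.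
have lc c : (l0 (th c) <= s)%N by apply: leq_trans mqs; exact: thsel_l0.
case mr : (max_risk s rho sigma T) => [M| |]; last 2 first.
- exact: leey.
- have := sup 0 th0; rewrite mr R0 => /(le_trans (Ex_ge0 _ (nnm_sqr mT'))).
  by rewrite leeNy_eq.
rewrite lee_fin -r2.
apply: (@two_point_bound R d J u T' r M) => //.
- by rewrite card_ffun !card_ord expn_gt0 k0.
- under eq_bigr do under eq_bigr do rewrite uu.
  exact: selection_moment.
- by rewrite -R0 -mr; exact: sup.
- by move=> c; rewrite -Rc -mr; exact: sup.
Qed.

(** Lets [ln16] compare logarithms up to the factor 16, whether the larger argument is linear or
    quadratic in [v]. Both bounds follow by repeated squaring. *)
Lemma bernoulli16 (v : R) : 0 <= v -> 1 + 16 * v <= (1 + v) ^+ 16 /\ (1 + 8 * v) ^+ 2 <= (1 + v) ^+ 16.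
Proof.
move=> v0.
have b2 (n : nat) (w : R) : 0 <= w -> 1 + w <= (1 + v) ^+ n -> 1 + 2 * w <= (1 + v) ^+ (n * 2).
  move=> w0 h; rewrite exprM; apply: (@le_trans _ _ ((1 + w) ^+ 2)); first by nra.
  by apply: lerXn2r => //; rewrite nnegrE ?addr_ge0// exprn_ge0// addr_ge0.
have h1 := b2 1%N v v0 ltac:(by rewrite expr1).
have h2 := b2 2%N (2 * v) ltac:(lra) h1.
have h4 := b2 4%N (2 * (2 * v)) ltac:(lra) h2.
have h8 := b2 8%N (2 * (2 * (2 * v))) ltac:(lra) h4.
split; first by move: h8; rewrite -[(8 * 2)%N]/16%N; lra.
rewrite -[16%N]/(8 * 2)%N exprM; apply: lerXn2r; rewrite ?nnegrE; first by lra.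
  by rewrite exprn_ge0// addr_ge0.
by move: h4; rewrite -[(4 * 2)%N]/8%N; lra.
Qed.

Lemma ln16 (v x : R) : 0 <= v -> 0 <= x -> 1 + x <= (1 + v) ^+ 16 -> ln (1 + x) / 16 <= ln (1 + v).
Proof.
move=> v0 x0 h; rewrite ler_pdivrMr//.
have -> : ln (1 + v) * 16 = ln ((1 + v) ^+ 16) by rewrite lnXn ?mulr_natr// ltr_pwDl.
by rewrite ler_ln ?posrE ?exprn_gt0// ltr_pwDl.
Qed.

Lemma truncn_ge_half (x : R) : 1 <= x -> x / 2 <= (Num.truncn x)%:R.
Proof.
move=> x1; have x0 : 0 <= x by lra.
have /andP[_ h] := truncn_itv x0.
have h2 : 1 <= (Num.truncn x)%:R :> R by rewrite ler1n truncn_gt0.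
by rewrite -natr1 in h; lra.
Qed.

Lemma divn_ge_half (d m : nat) : (0 < m <= d)%N -> d%:R / (2 * m%:R) <= (d %/ m)%:R :> R.
Proof.
move=> /andP[m0 md]; have m0R : 0 < m%:R :> R by rewrite ltr0n.
rewrite ler_pdivrMr ?mulr_gt0// -natrM -natrM ler_nat.
have k0 : (0 < d %/ m)%N by rewrite divn_gt0.
have := ltn_ceil d m0; move: (d %/ m)%N k0 => k k0.
by rewrite mulSn => h; apply: ltnW; apply: (leq_trans h); nia.
Qed.

(** For [s > rho] the rate [rho] is comparable to the logarithmic formula at the integer part of
    [rho], so the lower bound only has to treat sparsities [p <= rho]. The factor 4 combines the
    rounding [p >= rho / 2] with a logarithm of at least 1/2. *)
Lemma phi_le_trunc (s : nat) (rho : R) : (0 < s)%N -> 1 <= rho ->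
  let p := minn s (Num.truncn rho) in
  phi s (rho ^+ 2) <= 4 * (p%:R * ln (1 + rho ^+ 2 / p%:R ^+ 2)).
Proof.
move=> s0 rho1 /=; have rho0 : 0 <= rho by lra.
have /andP[tl tu] := truncn_itv rho0; set f := Num.truncn rho in tl tu *.
rewrite /phi sqrtr_sqr ger0_norm//; case: (leP s%:R rho) => sr.
  have sf : (s <= f)%N by rewrite truncn_ge_nat.
  rewrite (minn_idPl sf); have : 0 <= s%:R * ln (1 + rho ^+ 2 / s%:R ^+ 2).
    by rewrite mulr_ge0// ln_ge0// lerDl divr_ge0// sqr_ge0.
  by move: (s%:R * _) => X X0; lra.
have fs : (f <= s)%N by rewrite -(ler_nat R) (le_trans tl)// ltW.
rewrite (minn_idPr fs).
have f1 : 1 <= f%:R :> R by rewrite ler1n truncn_gt0.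
have fh : rho / 2 <= f%:R by exact: truncn_ge_half.
have L2 : 2^-1 <= ln (1 + rho ^+ 2 / f%:R ^+ 2).
  apply: ln_ge_half; have : 1 <= rho ^+ 2 / f%:R ^+ 2; last by lra.
  by rewrite ler_pdivlMr ?mul1r ?exprn_gt0//; [apply: lerXn2r; rewrite ?nnegrE|lra].
move: (ln _) L2 => L L2.
have h : rho / 2 * 2^-1 <= f%:R * L by apply: ler_pM => //; rewrite divr_ge0.
by clear - h; lra.
Qed.

(* If [rho ^+ 2 < 4 * d], identity covariance ([m = 1]) with [q = p] groups suffices;
   otherwise a single group of blocks of size about [p / 2] is used. *)
Lemma lower_main (d s : nat) (rho sigma : R) (T : 'cV[R]_d -> R) :
  (0 < s <= d)%N -> Num.sqrt d%:R <= rho -> rho <= d%:R -> 0 < sigma -> estimator T ->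
  ((1024^-1 * sigma ^+ 2 * phi s (rho ^+ 2))%:E <= max_risk s rho sigma T)%E.
Proof.
move=> /andP[s0 sd] dr rd sigma0 eT.
have d0 : (0 < d)%N by exact: leq_trans sd.
have d1 : 1 <= d%:R :> R by rewrite ler1n.
have rho1 : 1 <= rho by apply: le_trans dr; rewrite -[leLHS]sqrtr1 ler_sqrt.
have rho0 : 0 <= rho by lra.
have dr2 : d%:R <= rho ^+ 2.
  rewrite -[leLHS](@sqr_sqrtr _ d%:R)//; by apply: lerXn2r => //; rewrite nnegrE.
have /= hp := phi_le_trunc s0 rho1; set p := minn s _ in hp.
have p0 : (0 < p)%N by rewrite leq_min s0 truncn_gt0.
have ps : (p <= s)%N by exact: geq_minl.
have pd : (p <= d)%N by exact: leq_trans sd.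
have prho : p%:R <= rho.
  have /andP[tl _] := truncn_itv rho0; apply: le_trans tl; rewrite ler_nat; exact: geq_minr.
have p1 : 1 <= p%:R :> R by rewrite ler1n.
have p20 : 0 < p%:R ^+ 2 :> R by apply: exprn_gt0; lra.
set L := ln (1 + rho ^+ 2 / p%:R ^+ 2) in hp.
have L0 : 0 <= L by apply: ln_ge0; rewrite lerDl divr_ge0 ?sqr_ge0.
have s2 : 0 < sigma ^+ 2 by rewrite exprn_gt0.
(* The constant 256 is 8 from the two-point bound, 16 from [ln16] and 2 from [m >= p / 2];
   [phi_le_trunc] contributes the remaining 4 of 1024. *)
suff [x [xb xr]] : exists x : R, p%:R * L / 256 <= x /\ ((sigma ^+ 2 * x)%:E <= max_risk s rho sigma T)%E.
  apply: le_trans xr; rewrite lee_fin -mulrA mulrCA ler_pM2l//.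
  by apply: le_trans xb; lra.
have [big|small] := leP (4 * d%:R) (rho ^+ 2); last first.
  pose k := (d %/ p)%N.
  have k0 : (0 < k)%N by rewrite divn_gt0.
  have kh : d%:R / (2 * p%:R) <= k%:R :> R by apply: divn_ge_half; rewrite p0.
  exists (p%:R * ln (1 + k%:R / (2 * p%:R)) / 8); split; last first.
    have := @lower_block d s 1 p k rho sigma T isT p0 k0.
    rewrite !mul1n muln1 subrr mul0r addr0 mulnC leq_divM => /(_ ps isT dr2 rho0 sigma0 eT).
    by rewrite -!mulrA.
  have v0 : 0 <= k%:R / (2 * p%:R) :> R by rewrite divr_ge0// mulr_ge0.
  have x0 : 0 <= rho ^+ 2 / p%:R ^+ 2 by rewrite divr_ge0 ?sqr_ge0.
  have hv : rho ^+ 2 / p%:R ^+ 2 <= 16 * (k%:R / (2 * p%:R)).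
    rewrite ler_pdivrMr//.
    have -> : 16 * (k%:R / (2 * p%:R)) * p%:R ^+ 2 = 16 * (k%:R * p%:R / 2) :> R by field; rewrite gt_eqF//; lra.
    have : d%:R <= k%:R * (2 * p%:R) :> R by move: kh; rewrite ler_pdivrMr//; lra.
    by clear - small; lra.
  have [b16 _] := bernoulli16 v0.
  have hl : L / 16 <= ln (1 + k%:R / (2 * p%:R)) by apply: ln16 => //; apply: le_trans b16; rewrite lerD2l.
  move: (ln (1 + k%:R / _)) hl => l hl.
  have h := ler_wpM2l (ler0n R p) hl.
  have pL : 0 <= p%:R * L by rewrite mulr_ge0.
  by clear - h pL; lra.
have rho2 : 2 <= rho.
  by rewrite leNgt; apply/negP => rl; clear - rl rho0 big d1; nra.
(* Half of [p], so that [m <= 3 / 4 * rho]: then [rho ^+ 2 - d], at least [3 / 4 * rho ^+ 2], has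
   room for one block of Frobenius cost [m ^+ 2]. *)
pose m := uphalf p.
have m0 : (0 < m)%N by rewrite uphalf_gt0.
have mp : (m <= p)%N by rewrite /m; clear -p0; lia.
have mp2 : (p <= m * 2)%N by rewrite /m; clear; lia.
have mp3 : (m * 2 <= p + 1)%N by rewrite /m; clear; lia.
have md : (m <= d)%N by exact: leq_trans pd.
have mR : 1 <= m%:R :> R by rewrite ler1n.
have mpR : m%:R <= p%:R :> R by rewrite ler_nat.
have mp2R : p%:R <= m%:R * 2 :> R by rewrite -natrM ler_nat.
have mrho : m%:R <= 3 / 4 * rho.
  have : m%:R * 2 <= p%:R + 1 :> R by rewrite -natrM natr1 ler_nat -[p.+1]addn1.
  by clear - prho rho2; lra.
have m20 : 0 < m%:R ^+ 2 :> R by apply: exprn_gt0; lra.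
pose X := (rho ^+ 2 - d%:R) / m%:R ^+ 2.
have X34 : 3 / 4 * (rho ^+ 2 / m%:R ^+ 2) <= X.
  by rewrite mulrA /X ler_pM2r ?invr_gt0//; clear - big; lra.
have X1 : 1 <= X.
  rewrite /X ler_pdivlMr// mul1r; have : m%:R ^+ 2 <= (3 / 4 * rho) ^+ 2.
    by apply: lerXn2r => //; rewrite nnegrE//; clear -rho0; lra.
  by have := sqr_ge0 rho; clear - big; lra.
(* The first bound makes [k] blocks fit into [d] coordinates, the second keeps [d + m ^+ 2 * k]
   below [rho ^+ 2]. *)
pose k := minn (d %/ m) (Num.truncn X).
have k0 : (0 < k)%N by rewrite leq_min divn_gt0// md truncn_gt0.
have kX : k%:R <= X.
  have /andP[tl _] := truncn_itv (le_trans ler01 X1); apply: le_trans tl; rewrite ler_nat; exact: geq_minr.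
have km : (1 * k * m <= d)%N.
  by rewrite mul1n; apply: leq_trans (leq_divM d m); rewrite leq_mul2r geq_minl orbT.
have hF : d%:R + (m%:R - 1) * (m * 1 * k)%:R <= rho ^+ 2.
  have h1 : m%:R ^+ 2 * k%:R <= rho ^+ 2 - d%:R by move: kX; rewrite /X ler_pdivlMr// mulrC.
  have h2 : 0 <= m%:R * k%:R :> R by rewrite mulr_ge0.
  by rewrite muln1 natrM; clear - h1 h2; lra.
exists (m%:R * ln (1 + k%:R / 2) / 8); split; last first.
  have := @lower_block d s m 1 k rho sigma T m0 isT k0.
  rewrite muln1 mulr1 => /(_ (leq_trans mp ps) km); rewrite muln1 in hF.
  by move=> /(_ hF rho0 sigma0 eT); rewrite -!mulrA.
have y0 : 0 <= rho / m%:R by rewrite divr_ge0.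
have v0 : 0 <= k%:R / 2 :> R by rewrite divr_ge0.
have [b16 b8] := bernoulli16 v0.
(* If the dimension limits [k], then [rho <= d] gives [rho / m <= 2 * k] and the quadratic form of
   [bernoulli16] applies. If the Frobenius norm does, [(rho / m) ^+ 2] is itself at most a multiple
   of [k] and the linear form applies. *)
have hv : 1 + (rho / m%:R) ^+ 2 <= (1 + k%:R / 2) ^+ 16.
  have [h|h] := leqP (d %/ m) (Num.truncn X).
    have kE : k = (d %/ m)%N by apply/minn_idPl.
    have kh : d%:R / (2 * m%:R) <= k%:R :> R by rewrite kE; apply: divn_ge_half; rewrite m0.
    have yv : rho / m%:R <= 2 * k%:R.
      rewrite ler_pdivrMr; last by lra.
      by move: kh; rewrite ler_pdivrMr; [clear - rd; lra|clear - mR; lra].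
    apply: le_trans b8; move: (rho / m%:R) y0 yv => y y0 yv.
    have : (1 + y) ^+ 2 <= (1 + 8 * (k%:R / 2)) ^+ 2.
      by apply: lerXn2r; rewrite ?nnegrE; clear -y0 yv v0; lra.
    by clear -y0; nra.
  have kE : k = Num.truncn X by apply/minn_idPr/ltnW.
  have kh : X / 2 <= k%:R by rewrite kE; exact: truncn_ge_half.
  apply: le_trans b16; rewrite lerD2l expr_div_n.
  have : 0 <= rho ^+ 2 / m%:R ^+ 2 by rewrite divr_ge0 ?sqr_ge0.
  by clear - kh X34; lra.
have hl := ln16 v0 (sqr_ge0 (rho / m%:R)) hv.
have LL : L <= ln (1 + (rho / m%:R) ^+ 2).
  rewrite ler_ln ?posrE ?lerD2l; last 2 first.
  - by rewrite ltr_pwDl// divr_ge0 ?sqr_ge0.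
  - by rewrite ltr_pwDl// sqr_ge0.
  rewrite expr_div_n; apply: ler_wpM2l; first exact: sqr_ge0.
  rewrite lef_pV2 ?posrE//; apply: lerXn2r; rewrite ?nnegrE//; clear -mR p1; lra.
move: (ln (1 + k%:R / 2)) hl => l hl.
have h1 : L / 16 <= l by clear - hl LL; lra.
have h : p%:R / 2 * (L / 16) <= m%:R * l.
  by apply: (ler_pM (divr_ge0 (ler0n R p) (ler0n R 2)) (divr_ge0 L0 (ler0n R 16)) _ h1); clear - mp2R; lra.
by clear - h; lra.
Qed.

(** Packages the constant together with [c <= 1], from which the order of the two constants of the
    theorem follows. *)
Lemma lower_const : exists2 c : R, 0 < c <= 1 & forall (d s : nat) (rho sigma : R) (T : 'cV[R]_d -> R),
  (0 < s <= d)%N -> Num.sqrt d%:R <= rho -> rho <= d%:R -> 0 < sigma -> estimator T ->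
  ((c * sigma ^+ 2 * phi s (rho ^+ 2))%:E <= max_risk s rho sigma T)%E.
Proof.
exists 1024^-1; last exact: lower_main.
apply/andP; split; first by rewrite invr_gt0 (ltr0n R 1024).
by rewrite (invf_le1 (ltr0Sn R 1023)) (ler1n R 1024).
Qed.

End lower.

(** * Upper bound *)

Section upper_main.
Context {R : realType}.

(** The statistic once all variances equal 1; the covariance matrix has disappeared from it. *)
Definition Qfun (s : nat) (rho sigma : R) d (y : 'I_d -> R) : R :=
  if s%:R <= rho then
    \sum_i (y i ^+ 2 - sigma ^+ 2 * beta (tau s rho)) * (if sigma * tau s rho < `|y i| then 1 else 0)
  else \sum_i (y i ^+ 2 - sigma ^+ 2).

Lemma NtildeE d (s : nat) (rho sigma : R) (S : 'M[R]_d) (Y : 'cV[R]_d) : (forall i, S i i = 1) ->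
  Ntilde s rho sigma S Y = Num.sqrt `|Qfun s rho sigma (fun i => Y i 0)|.
Proof.
move=> S1; rewrite /Ntilde /Qfun; congr (Num.sqrt `|_|).
by case: ifP => _; apply: eq_bigr => i _; rewrite S1 ?sqrtr1 !mulr1.
Qed.

Lemma measurable_Qfun d0 (T : measurableType d0) (s : nat) (rho sigma : R) d (y : 'I_d -> T -> R) :
  (forall i, measurable_fun setT (y i)) ->
  measurable_fun setT (fun z => Qfun s rho sigma (y ^~ z)).
Proof.
move=> my; rewrite /Qfun; case: (s%:R <= rho).
  apply: measurable_sum => i; apply: measurable_funM.
    by apply: measurable_funB => //; exact: measurable_funX.
  apply: measurable_fun_ifT => //; apply: measurable_fun_ltr => //.
  exact: measurableT_comp.
apply: measurable_sum => i; apply: measurable_funB => //; exact: measurable_funX.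
Qed.

Lemma measurable_sqrt_norm d0 (T : measurableType d0) (f : T -> R) :
  measurable_fun setT f -> measurable_fun setT (fun z => Num.sqrt `|f z|).
Proof.
move=> mf; have ms : measurable_fun setT (@Num.sqrt R).
  exact: continuous_measurable_fun (@sqrt_continuous R).
by apply: (measurableT_comp ms); exact: measurableT_comp.
Qed.

(* [e = |sqrt |x| - t|] satisfies both [e ^+ 2 <= D] and [e * t <= D] for
   [D = |x - t ^+ 2|]. *)
Lemma sqrt_error (x t A : R) : 0 < A -> 0 <= t ->
  (Num.sqrt `|x| - t) ^+ 2 <= A + 2 / (A + t ^+ 2) * (x - t ^+ 2) ^+ 2.
Proof.
move=> A0 t0; set r := Num.sqrt `|x|.
have r0 : 0 <= r by exact: sqrtr_ge0.
have r2 : r ^+ 2 = `|x| by rewrite sqr_sqrtr.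
pose D : R := `|x - t ^+ 2|.
have D2 : (x - t ^+ 2) ^+ 2 = D ^+ 2 by rewrite real_normK ?num_real.
have rt : `|r ^+ 2 - t ^+ 2| <= D.
  rewrite r2 /D; have -> : `| `|x| - t ^+ 2| = `| `|x| - `|t ^+ 2| | by rewrite [`|t ^+ 2|]ger0_norm ?sqr_ge0.
  exact: ler_dist_dist.
have D0 : 0 <= D by exact: normr_ge0.
have f : r ^+ 2 - t ^+ 2 = (r - t) * (r + t) by rewrite subr_sqr.
rewrite f normrM [`|r + t|]ger0_norm ?addr_ge0// in rt.
pose e : R := `|r - t|; rewrite -/e in rt.
have e0 : 0 <= e by exact: normr_ge0.
have eE : (r - t) ^+ 2 = e ^+ 2 by rewrite real_normK ?num_real.
have er : e <= r + t.
  by rewrite /e ler_norml; apply/andP; split; clear - r0 t0; lra.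
have et : e * t <= D.
  by apply: le_trans rt; apply: ler_wpM2l => //; clear - r0; lra.
have ee : e ^+ 2 <= D.
  by apply: le_trans rt; rewrite expr2; apply: ler_wpM2l.
have et2 : e ^+ 2 * t ^+ 2 <= D ^+ 2.
  by rewrite -exprMn; apply: lerXn2r; rewrite ?nnegrE// mulr_ge0.
have At : 0 < A + t ^+ 2 by rewrite ltr_pwDl// sqr_ge0.
rewrite eE D2 -(ler_pM2r At) mulrDl [X in _ <= _ + X]mulrAC (divfK (lt0r_neq0 At)).
have eA : e ^+ 2 * A <= D * A by apply: ler_wpM2r => //; exact: ltW.
have tA : 0 <= A * t ^+ 2 by rewrite mulr_ge0 ?sqr_ge0// ltW.
have := sqr_ge0 (A - D).
move: (e ^+ 2) (t ^+ 2) eA et2 tA => E2 T2 eA et2 tA h.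
by have := sqr_ge0 D; clear - eA et2 tA h; nra.
Qed.

Lemma mse_all : exists2 C : R, 0 <= C & forall (d : nat) (th : 'cV[R]_d)
  (a : 'I_d -> 'cV[R]_d) (sigma rho : R) (s : nat),
  (forall i, dotv (a i) (a i) = 1) -> 0 < sigma -> (0 < s)%N -> 0 <= rho -> (l0 th <= s)%N ->
  \sum_i \sum_j dotv (a i) (a j) ^+ 2 <= rho ^+ 2 ->
  forall t2 ph, t2 = \sum_i th i 0 ^+ 2 -> ph = phi s (rho ^+ 2) ->
  (Ex (gaussP d) (fun z => (Qfun s rho sigma (fun i => th i 0 + sigma * dot (a i) z) - t2) ^+ 2)%R
   <= (C * (sigma ^+ 2 * ph) * (sigma ^+ 2 * ph + t2))%:E)%E.
Proof.
have [C1 C10 H1] := @mse_dense R; have [C2 C20 H2] := @mse_sparse R.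
exists (C1 + C2); first exact: addr_ge0.
move=> d th a sigma rho s aa sigma0 s0 rho0 thS fr t2 ph t2E phE.
have t20 : 0 <= t2 by rewrite t2E; apply: sumr_ge0 => i _; exact: sqr_ge0.
move: phE; rewrite /phi sqrtr_sqr ger0_norm// /Qfun; case: (leP s%:R rho) => sr phE.
  have ph0 : 0 <= ph by rewrite phE mulr_ge0// ln_ge0// lerDl divr_ge0// sqr_ge0.
  apply: (le_trans (H2 d th a sigma rho s aa sigma0 s0 sr thS fr t2 ph t2E phE)).
  have A0 : 0 <= sigma ^+ 2 * ph by rewrite mulr_ge0 ?sqr_ge0.
  rewrite lee_fin; apply: ler_wpM2r; first exact: addr_ge0.
  by apply: ler_wpM2r => //; rewrite lerDr.
have A0 : 0 <= sigma ^+ 2 * rho by rewrite mulr_ge0 ?sqr_ge0.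
rewrite phE; apply: (le_trans (H1 d th a sigma rho aa rho0 fr t2 t2E)).
rewrite lee_fin; apply: ler_wpM2r; first exact: addr_ge0.
by apply: ler_wpM2r => //; rewrite lerDl.
Qed.

Lemma phi_gt0 (s : nat) (rho : R) : (0 < s)%N -> 0 < rho -> 0 < phi s (rho ^+ 2).
Proof.
move=> s0 rho0; rewrite /phi sqrtr_sqr gtr0_norm//; case: ifP => // _.
have s0R : 0 < s%:R :> R by rewrite ltr0n.
by rewrite mulr_gt0// ln_gt0// ltrDl divr_gt0// exprn_gt0.
Qed.

(** Taking [A = sigma ^+ 2 * phi] in [sqrt_error], the weight [2 / (A + t ^+ 2)] cancels the factor
    [A + t ^+ 2] of the mean square error, which leaves [(1 + 2 * C) * A] whatever the size of the
    signal. *)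
Lemma upper_main : exists2 C : R, 0 <= C & forall (d s : nat) (rho sigma : R)
  (th : 'cV[R]_d) (S : 'M[R]_d), (0 < s)%N -> 0 < rho -> 0 < sigma -> Theta s rho th S ->
  (risk sigma (Ntilde s rho sigma S) th S <= (C * sigma ^+ 2 * phi s (rho ^+ 2))%:E)%E.
Proof.
have [C C0 HC] := mse_all.
exists (1 + 2 * C); first by rewrite addr_ge0// mulr_ge0.
move=> d s rho sigma th S s0 rho0 sigma0 [thS [covS [S1 frS]]].
have AE := cov_sqrtP covS; set A := cov_sqrt S in AE.
pose a i := rowv A i.
have aE i j : dotv (a i) (a j) = S i j by rewrite dotv_rowv AE.
have aa i : dotv (a i) (a i) = 1 by rewrite aE.
have fr : \sum_i \sum_j dotv (a i) (a j) ^+ 2 <= rho ^+ 2.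
  have -> : \sum_i \sum_j dotv (a i) (a j) ^+ 2 = frob S ^+ 2.
    rewrite sqr_sqrtr; last by apply: sumr_ge0 => i _; apply: sumr_ge0 => j _; exact: sqr_ge0.
    by apply: eq_bigr => i _; apply: eq_bigr => j _; rewrite aE.
  by apply: lerXn2r => //; rewrite nnegrE ?sqrtr_ge0// ltW.
have my i : measurable_fun setT (fun z : d.-tuple R => th i 0 + sigma * dot (a i) z).
  by apply: measurable_funD => //; apply: measurable_funM => //; exact: measurable_dot.
pose y (z : d.-tuple R) := fun i => th i 0 + sigma * dot (a i) z.
pose Q z := Qfun s rho sigma (y z).
have mQ : measurable_fun setT Q by exact: measurable_Qfun.
have NE z : Ntilde s rho sigma S (th + sigma *: (A *m colt z)) = Num.sqrt `|Q z|.
  rewrite NtildeE// /Q; congr (Num.sqrt `|Qfun _ _ _ _|); apply/funext => i.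
  exact: model_coord.
have mN : measurable_fun setT (fun z : d.-tuple R => Ntilde s rho sigma S (th + sigma *: (A *m colt z))).
  by under eq_fun do rewrite NE; exact: measurable_sqrt_norm.
rewrite riskE//.
set t := norm2 th; have t0 : 0 <= t by exact: sqrtr_ge0.
have t2E : t ^+ 2 = \sum_i th i 0 ^+ 2.
  by rewrite sqr_sqrtr//; apply: sumr_ge0 => i _; exact: sqr_ge0.
set ph := phi s (rho ^+ 2); have ph0 : 0 < ph by exact: phi_gt0.
pose B := sigma ^+ 2 * ph; have B0 : 0 < B by rewrite mulr_gt0// exprn_gt0.
have mse := HC d th a sigma rho s aa sigma0 s0 (ltW rho0) thS fr (t ^+ 2) ph t2E erefl.
rewrite -/B in mse.
have Bt : 0 < B + t ^+ 2 by rewrite ltr_pwDl// sqr_ge0.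
have k0 : 0 <= 2 / (B + t ^+ 2) by rewrite divr_ge0// ltW.
have nD : nnm (fun z => (Q z - t ^+ 2) ^+ 2) by apply: nnm_sqr; exact: measurable_funB.
have nB := nnm_cst [the measurableType _ of d.-tuple R] (ltW B0).
apply: (@le_trans _ _ (Ex (gaussP d) (fun z => B + 2 / (B + t ^+ 2) * (Q z - t ^+ 2) ^+ 2)%R)).
  apply: Ex_le; [by apply: nnm_sqr; exact: measurable_funB|by apply: nnmD => //; exact: nnmZ|].
  by move=> z; rewrite NE; exact: sqrt_error.
rewrite (ExD _ nB (nnmZ k0 nD)) Ex_cst ExZ//.
apply: (@le_trans _ _ (B%:E + (2 / (B + t ^+ 2))%:E * (C * B * (B + t ^+ 2))%:E)%E).
  by apply: leeD2l; apply: lee_wpmul2l => //; rewrite lee_fin.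
rewrite -EFinM -EFinD lee_fin le_eqVlt; apply/orP; left; apply/eqP.
by rewrite -[RHS]mulrA -/B; field; rewrite gt_eqF.
Qed.

End upper_main.

Theorem theorem4 (R : realType) :
  exists c C : R, 0 < c /\ c <= C /\
  forall (d s : nat) (rho sigma : R),
    (1 <= d)%N -> (1 <= s <= d)%N ->
    Num.sqrt d%:R <= rho -> rho <= d%:R -> 0 < sigma ->
    let ph := phi s (rho ^+ 2) in
    (max_riskS s rho sigma (fun (S : 'M[R]_d) (Y : 'cV[R]_d) => Ntilde s rho sigma S Y)
       <= (C * sigma ^+ 2 * ph)%:E)%E
    /\ ((c * sigma ^+ 2)%:E
        <= ereal_inf [set max_risk s rho sigma T * (ph^-1)%:E
                     | T in [set T : 'cV[R]_d -> R | estimator T]])%E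
    /\ (ereal_inf [set max_risk s rho sigma T * (ph^-1)%:E
                  | T in [set T : 'cV[R]_d -> R | estimator T]]
        <= (C * sigma ^+ 2)%:E)%E.
Proof.
have [C C0 HC] := @upper_main R.
have [c /andP[c0 c1] Hc] := @lower_const R.
exists c, (1 + C); split=> //; split; first by rewrite (le_trans c1)// lerDl.
move=> d s rho sigma d1 /andP[s1 sd] dr rd sigma0 ph.
have d1R : 1 <= d%:R :> R by rewrite ler1n.
have rho0 : 0 < rho.
  by apply: lt_le_trans dr; rewrite sqrtr_gt0 ltr0n.
have ph0 : 0 < ph by exact: phi_gt0.
have s20 : 0 <= sigma ^+ 2 by exact: sqr_ge0.
have CC : C * sigma ^+ 2 * ph <= (1 + C) * sigma ^+ 2 * ph.
  apply: ler_wpM2r; first exact: ltW.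
  by apply: ler_wpM2r => //; rewrite lerDr.
have up : (max_riskS s rho sigma (fun (S : 'M[R]_d) (Y : 'cV[R]_d) => Ntilde s rho sigma S Y)
       <= ((1 + C) * sigma ^+ 2 * ph)%:E)%E.
  apply: ge_ereal_sup => _ [th [S [TS ->]]].
  by apply: (le_trans (HC d s rho sigma th S s1 rho0 sigma0 TS)); rewrite lee_fin.
split=> //; split.
  apply: le_ereal_inf_tmp => _ [T /= eT <-].
  rewrite lee_pdivlMr// -EFinM.
  by apply: Hc => //; rewrite s1.
(* All covariances in [Theta] have unit diagonal, so the procedure run with the identity matrix
   coincides with the one run with the true covariance; it is thus an admissible competitor in the
   infimum. *)
pose T0 := Ntilde s rho sigma (1%:M : 'M[R]_d).
have one i : (1%:M : 'M[R]_d) i i = 1 by rewrite mxE eqxx.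
have eT0 : estimator T0.
  rewrite /estimator /T0; under eq_fun do rewrite NtildeE//.
  apply: measurable_sqrt_norm.
  apply: (@measurable_Qfun R _ _ s rho sigma d (fun i z => (colt z) i 0)) => i.
  by under eq_fun do rewrite mxE; exact: measurable_tnth.
have mE : max_risk s rho sigma T0 = max_riskS s rho sigma (fun (S : 'M[R]_d) (Y : 'cV[R]_d) => Ntilde s rho sigma S Y).
  congr ereal_sup; apply/seteqP; split => x [th [S [TS ->]]]; exists th, S; split => //;
    (congr (risk sigma _ th S); apply/funext => Y; case: TS => _ [_ [S1 _]]; by rewrite /T0 !NtildeE).
apply: (@le_trans _ _ (max_risk s rho sigma T0 * (ph^-1)%:E)%E).
  by apply: ereal_inf_lbound; exists T0.
by rewrite lee_pdivrMr// mE -EFinM.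
Qed.
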